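(* The inclusions $\mathrm{SO}(3)\to\mathrm{SO}(3,\mathbb{C})$ and $\mathrm{SO}(2)\to B$ induce an isomorphism of complex line bundles from $Q\simeq\mathrm{SO}(3)\times_{\mathrm{SO}(2)}\mathbb{C}$ onto the holomorphic line bundle $\mathrm{SO}(3,\mathbb{C})\times_B\mathbb{C}$ over $\mathrm{SO}(3,\mathbb{C})/B$. The $\mathbb{C}^3$-valued holomorphic $(1,0)$-form $$\widetilde\Omega_{(g,q)}(\delta g,\delta q)=\frac1q\,\langle g^{-1}\circ\delta g(e_3),\,e_1+ie_2\rangle\; g(e_1+ie_2)$$ on $\mathrm{SO}(3,\mathbb{C})\times(\mathbb{C}\setminus\{0\})$ is the pull-back, under the projection onto $\mathrm{SO}(3,\mathbb{C})\times_B(\mathbb{C}\setminus\{0\})$, of a $\mathbb{C}^3$-valued holomorphic $(1,0)$-form $\Omega$. The form $\Omega$ is $\mathrm{SO}(3,\mathbb{C})$-equivariant, and under the identification of $Q\setminus 0_Q$ with $\mathrm{SO}(3,\mathbb{C})\times_B(\mathbb{C}\setminus\{0\})$ one has $\omega=\operatorname{Re}\Omega$.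
   Context: $S$ is the unit sphere in $\mathbb{R}^3$, $T_sS=s^\perp\subset\mathbb{R}^3$. For $s\in S$, $Q_s$ is the real two-dimensional space of symmetric trace-zero linear maps $T_sS\to T_sS$; these form a vector bundle $\pi:Q\to S$ with zero section $0_Q$. On $Q\setminus 0_Q$, $\omega$ is the $\mathbb{R}^3$-valued one-form $\omega_q(v)=q^{-1}(T_q\pi(v))$. $\mathrm{SO}(2)\subset\mathrm{SO}(3)$ is the group of rotations about the axis $\mathbb{R}e_3$. $Q_{e_3}$ is identified with $\mathbb{C}$ by identifying $\begin{pmatrix}a&b\\ b&-a\end{pmatrix}$ with $a+ib$; conjugation by the rotation through angle $\phi$ then acts on $\mathbb{C}$ as multiplication by $e^{2i\phi}$. $\mathrm{SO}(3)\times_{\mathrm{SO}(2)}\mathbb{C}$ is the quotient of $\mathrm{SO}(3)\times\mathbb{C}$ by the action $r\cdot(g,q)=(gr^{-1},e^{2i\phi}q)$ ($r$ the rotation through $\phi$), identified with $Q$ by sending the class of $(g,q)$ to $g\,q\,g^{-1}\in Q_{g(e_3)}$. $\mathrm{SO}(3,\mathbb{C})$ is the group of complex $3\times3$ matrices of determinant one preserving the complex bilinear form $\langle z,w\rangle=\sum z_jw_j$ on $\mathbb{C}^3$. $B$ is the closed subgroup of all $b\in\mathrm{SO}(3,\mathbb{C})$ with $b(\mathbb{C}(e_1+ie_2))=\mathbb{C}(e_1+ie_2)$, and $\rho:B\to\mathbb{C}\setminus\{0\}$ is the character defined by $b(e_1+ie_2)=\rho(b)(e_1+ie_2)$. $\mathrm{SO}(3,\mathbb{C})\times_B\mathbb{C}$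 is the quotient of $\mathrm{SO}(3,\mathbb{C})\times\mathbb{C}$ by the action $b\cdot(g,q)=(gb^{-1},\rho(b)^{-2}q)$. $\mathrm{SO}(3,\mathbb{C})$ acts on it by left multiplication $L_h$ on the first factor; equivariance of $\Omega$ means $L_h^*\Omega=h\,\Omega$ for all $h\in\mathrm{SO}(3,\mathbb{C})$, where on the right $h$ acts on the values in $\mathbb{C}^3$. *)

(* Defs.v *)
From HB Require Import structures.
From mathcomp Require Import all_boot all_order all_algebra.
From mathcomp Require Import generic_quotient complex.
From mathcomp Require Import all_classical all_reals all_analysis.
Import numFieldNormedType.Exports.

Set Implicit Arguments.
Unset Strict Implicit.
Unset Printing Implicit Defensive.

Import Order.TTheory GRing.Theory Num.Theory.
Local Open Scope classical_set_scope.
Local Open Scope quotient_scope.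
Local Open Scope complex_scope.
Local Open Scope ring_scope.

(** A regularity class: [reg V W O f] says that [f] is of that class on the
    open set [O]. It is instantiated by [smooth R] and [holomorphic R]. *)
Definition regularity (K : numFieldType) :=
  forall V W : normedModType K, set V -> (V -> W) -> Prop.

(** On a finite-dimensional [V] this is C^k: all iterated directional
    derivatives of order at most [k] exist and are continuous. *)
Fixpoint Ck (K : numFieldType) (V W : normedModType K) (k : nat) (O : set V)
    (f : V -> W) : Prop :=
  if k is k'.+1 then
    (forall x, O x -> differentiable f x) /\
    (forall v, Ck k' O (fun x => 'D_v f x))
  else forall x, O x -> {for x, continuous f}.

Definition smooth (R : realType) : regularity R :=
  fun V W O f => forall k, Ck k O f.

(** Differentiability here is over the field R[i]. *)
Definition holomorphic (R : realType) : regularity R[i] :=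
  fun V W O f => forall x, O x -> differentiable f x.

(** A chart is a bijection [cmap] from [cdom] onto an open set of K^n, whose
    inverse is (the restriction to that open set of) [cinv]; see [chart_ok]. *)
Record chart (K : numFieldType) (n : nat) (X : Type) := Chart {
  cdom : set X;
  cmap : X -> 'rV[K]_n;
  cinv : 'rV[K]_n -> X
}.

Definition cimg (K : numFieldType) (n : nat) (X : Type)
  (c : chart K n X) : set 'rV[K]_n := cmap c @` cdom c.

Definition chart_ok (K : numFieldType) (n : nat) (X : Type)
    (c : chart K n X) : Prop :=
  open (cimg c) /\ (forall x, cdom c x -> cinv c (cmap c x) = x).

Section Manifold.
Variables (K : numFieldType) (reg : regularity K).

(** The topology of [X] is the one generated by the atlas. *)
Definition is_manifold (n : nat) (X : Type) (A : set (chart K n X)) : Prop :=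
  [/\ forall c, A c -> chart_ok c,
      exists u : nat -> chart K n X,
        (forall k, A (u k)) /\ (forall x, exists k, cdom (u k) x),
      forall c c', A c -> A c' ->
        open (cmap c @` (cdom c `&` cdom c')) /\
        reg (cmap c @` (cdom c `&` cdom c')) (cmap c' \o cinv c)
    & forall x x', x <> x' -> exists c c',
        [/\ A c, A c', cdom c x, cdom c' x' & cdom c `&` cdom c' = set0]].

(** The canonical (maximal) atlas on the quotient [p : P -> X] of the embedded
    submanifold [i : P -> V]: charts are the bijections onto open sets such that
    [cmap c \o p] is a submersion, that is, locally extends to a regular map on
    [V] and has regular local sections through every point of [P].
    With [p = id] it is the atlas of the submanifold [P] of [V] itself. *)
Definition quot_atlas (n : nat) (V : normedModType K) (P X : Type)
    (i : P -> V) (p : P -> X) : set (chart K n X) :=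
  [set c | chart_ok c /\
    forall m, cdom c (p m) ->
      (exists (O : set V) (F : V -> 'rV[K]_n),
         [/\ open O, O (i m), reg O F
           & forall m', O (i m') ->
               cdom c (p m') /\ cmap c (p m') = F (i m')]) /\
      (exists (O : set 'rV[K]_n) (s : 'rV[K]_n -> P),
         [/\ open O, O (cmap c (p m)), reg O (i \o s), s (cmap c (p m)) = m
           & forall y, O y -> cimg c y /\ p (s y) = cinv c y])].

Definition regular_map (n n' : nat) (X Y : Type) (A : set (chart K n X))
    (A' : set (chart K n' Y)) (f : X -> Y) : Prop :=
  forall x, exists c c',
    [/\ A c, A' c', cdom c x, (forall y, cdom c y -> cdom c' (f y))
      & reg (cimg c) (cmap c' \o f \o cinv c)].

Definition diffeo (n n' : nat) (X Y : Type) (A : set (chart K n X))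
    (A' : set (chart K n' Y)) (f : X -> Y) : Prop :=
  exists g : Y -> X,
    [/\ cancel f g, cancel g f, regular_map A A' f & regular_map A' A g].

(** Vector bundle [p : E -> X] over the scalars [k] with typical fibre [L].
    The vector space structure of the fibres is given by the relation
    [lin a e1 e2 e3], meaning that [e1], [e2], [e3] lie in the same fibre and
    [e3 = a e1 + e2] there. [vec] identifies [L] with K^r; [k] may differ from
    [K], as for a smooth complex line bundle ([K] = R, [k] = [L] = R[i],
    [r] = 2). The local trivialisation over the chart domain [cdom c] is
    [e |-> (p e, t e)]; it is a diffeomorphism onto [cdom c * L], i.e., it is
    itself a chart of [E] once [cdom c] is read in the chart [c]. *)
Definition is_vector_bundle (n r : nat) (k : nzRingType) (L : lmodType k)
    (vec : L -> 'rV[K]_r) (E X : Type) (AE : set (chart K (n + r) E))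
    (AX : set (chart K n X)) (p : E -> X) (lin : k -> E -> E -> E -> Prop)
    : Prop :=
  [/\ is_manifold AE, is_manifold AX
    & forall x, exists c (t : E -> L) (s : 'rV[K]_(n + r) -> E),
      [/\ AX c /\ cdom c x,
          AE (Chart [set e | cdom c (p e)]
                    (fun e => row_mx (cmap c (p e)) (vec (t e))) s),
          forall y l, cdom c y -> exists e, p e = y /\ t e = l
        & forall a e1 e2 e3, cdom c (p e1) ->
            (lin a e1 e2 e3 <->
             [/\ p e2 = p e1, p e3 = p e1 & t e3 = a *: t e1 + t e2])]].

Definition bundle_iso (nE nX nE' nX' : nat) (k E X E' X' : Type)
    (AE : set (chart K nE E)) (AX : set (chart K nX X))
    (p : E -> X) (lin : k -> E -> E -> E -> Prop)
    (AE' : set (chart K nE' E')) (AX' : set (chart K nX' X'))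
    (p' : E' -> X') (lin' : k -> E' -> E' -> E' -> Prop)
    (F : E -> E') (f : X -> X') : Prop :=
  [/\ diffeo AE AE' F, diffeo AX AX' f, (forall e, p' (F e) = f (p e))
    & forall a e1 e2 e3, lin a e1 e2 e3 -> lin' a (F e1) (F e2) (F e3)].

(** A [W]-valued one-form, given by its local expressions: [a c x v] is the
    value at [x] on the tangent vector with coordinates [v] in the chart [c].
    Only the values for [c] in the atlas are relevant. *)
Definition oneform (n : nat) (X : Type) (W : normedModType K) :=
  chart K n X -> X -> 'rV[K]_n -> W.

(** [a] is a one-form of class [reg] on the open subset [D] of [X]. For
    [K] = R[i] the local expressions are complex linear in complex charts:
    these are the forms of type (1,0). *)
Definition is_oneform (n : nat) (X : Type) (W : normedModType K)
    (A : set (chart K n X)) (D : set X) (a : oneform n X W) : Prop :=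
  [/\ forall c x, A c -> D x -> cdom c x -> linear (a c x),
      forall c c' x v, A c -> A c' -> D x -> cdom c x -> cdom c' x ->
        a c x v = a c' x ('d (cmap c' \o cinv c) (cmap c x) v)
    & forall c v, A c ->
        reg (cmap c @` (cdom c `&` D)) (fun y => a c (cinv c y) v)].

(** [b] is the pull-back of [a] by [f] on [D]. *)
Definition is_pullback (n n' : nat) (X Y : Type) (W : normedModType K)
    (A : set (chart K n X)) (A' : set (chart K n' Y)) (D : set X)
    (f : X -> Y) (a : oneform n' Y W) (b : oneform n X W) : Prop :=
  forall c c' x, A c -> A' c' -> D x -> cdom c x -> cdom c' (f x) ->
    differentiable (cmap c' \o f \o cinv c) (cmap c x) /\
    forall v, b c x v =
      a c' (f x) ('d (cmap c' \o f \o cinv c) (cmap c x) v).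

(** The one-form on a submanifold [i : P -> V] given by a formula [beta m w]
    in terms of the tangent vectors [w : V] of [P] at [m]. *)
Definition ambient_form (n : nat) (V W : normedModType K) (P : Type)
    (i : P -> V) (beta : P -> V -> W) : oneform n P W :=
  fun c m v => beta m ('d (i \o cinv c) (cmap c m) v).

End Manifold.

(** The charts of the underlying real manifold of a complex manifold are the
    charts whose complexification [cplx_chart] is a chart of the latter. *)
Section Realification.
Variable R : realType.

Definition cplx_vec (n : nat) (v : 'rV[R]_(n + n)) : 'rV[R[i]]_n :=
  \row_j (v 0 (lshift n j) +i* v 0 (rshift n j)).

Definition real_vec (n : nat) (z : 'rV[R[i]]_n) : 'rV[R]_(n + n) :=
  row_mx (map_mx (@complex.Re R) z) (map_mx (@complex.Im R) z).

Definition cplx_chart (n : nat) (X : Type) (d : chart R (n + n) X) :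
    chart R[i] n X :=
  Chart (cdom d) (fun x => cplx_vec (cmap d x)) (fun z => cinv d (real_vec z)).

Definition real_atlas (n : nat) (X : Type) (A : set (chart R[i] n X)) :
    set (chart R (n + n) X) := [set d | A (cplx_chart d)].

Definition re_form (n m : nat) (X : Type) (a : oneform n X 'cV[R[i]]_m) :
    oneform (n + n) X 'cV[R]_m :=
  fun d x v => map_mx (@complex.Re R) (a (cplx_chart d) x (cplx_vec v)).

End Realification.

Section Linear3.
Variable K : numFieldType.

Definition mx3 (s : seq (seq K)) : 'M[K]_3 :=
  \matrix_(i, j) (nth [::] s i)`_j.

Definition col3 (s : seq K) : 'cV[K]_3 := \col_j s`_j.

Definition e3 : 'cV[K]_3 := col3 [:: 0; 0; 1].

(** The (for [K] = R[i], complex bilinear) form [sum_j z_j w_j]. *)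
Definition bil (z w : 'cV[K]_3) : K := \sum_(j < 3) z j 0 * w j 0.

Definition inSO3 : pred 'M[K]_3 := fun g =>
  (\det g == 1) && `[< forall z w, bil (g *m z) (g *m w) = bil z w >].

Definition SO3 := {g : 'M[K]_3 | inSO3 g}.

Lemma bilE z w : bil z w = (z^T *m w) 0 0.
Proof. by rewrite mxE; apply: eq_bigr => j _; rewrite mxE. Qed.

Lemma inSO3P g : inSO3 g <-> \det g = 1 /\ g^T *m g = 1%:M.
Proof.
split=> [/andP[/eqP dg /asboolP gP]|[dg gg]].
  split=> //; apply/matrixP => i j.
  have := gP (delta_mx i 0) (delta_mx j 0).
  rewrite !bilE trmx_mul -mulmxA (mulmxA g^T) mulmxA trmx_delta -rowE -colE.
  by rewrite mxE [row _ _ _ _]mxE => ->; rewrite -rowE !mxE eqxx andbT.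
apply/andP; split; first exact/eqP.
by apply/asboolP => z w; rewrite !bilE trmx_mul -mulmxA (mulmxA g^T) gg mul1mx.
Qed.

Lemma inSO3_unit g : inSO3 g -> g \in unitmx.
Proof. by case/inSO3P => dg _; rewrite unitmxE dg unitr1. Qed.

Lemma inSO31 : inSO3 1%:M.
Proof. by apply/inSO3P; rewrite det1 trmx1 mul1mx. Qed.

Lemma inSO3M g h : inSO3 g -> inSO3 h -> inSO3 (g *m h).
Proof.
move=> /inSO3P[dg gg] /inSO3P[dh hh]; apply/inSO3P.
by rewrite det_mulmx dg dh mulr1 trmx_mul -mulmxA (mulmxA g^T) gg mul1mx.
Qed.

Lemma inSO3V g : inSO3 g -> inSO3 (invmx g).
Proof.
move=> gS; have gU := inSO3_unit gS; have /inSO3P[dg gg] := gS.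
have -> : invmx g = g^T by rewrite -[LHS]mul1mx -gg -mulmxA mulmxV // mulmx1.
by apply/inSO3P; rewrite det_tr trmxK; split=> //; exact: mulmx1C.
Qed.

Lemma inSO3_invM g h : inSO3 g -> inSO3 h ->
  invmx (g *m h) = invmx h *m invmx g.
Proof. by move=> gS hS; apply: invrM; exact: inSO3_unit. Qed.

Definition SO3mul (g h : SO3) : SO3 :=
  exist _ (val g *m val h) (inSO3M (valP g) (valP h)).

End Linear3.

Section Spaces.
Variable R : realType.
Notation C := R[i].

Lemma inSO3_cplx (g : 'M[R]_3) :
  inSO3 g -> inSO3 (map_mx (real_complex R) g : 'M[C]_3).
Proof.
case/inSO3P => dg gg; apply/inSO3P.
by rewrite det_map_mx dg rmorph1 map_trmx -map_mxM gg map_mx1.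
Qed.

(** The inclusion of SO(3) in SO(3,C). *)
Definition SO3incl (g : SO3 R) : SO3 C :=
  exist _ (map_mx (real_complex R) (val g)) (inSO3_cplx (valP g)).

(** The rotation through the angle [phi] about the axis [R e3]. *)
Definition rotz (phi : R) : 'M[R]_3 :=
  mx3 [:: [:: cos phi; - sin phi; 0]; [:: sin phi; cos phi; 0]; [:: 0; 0; 1]].

Definition expi (t : R) : C := cos t +i* sin t.

(** The isotropic vector [e1 + i e2]. *)
Definition n0 : 'cV[C]_3 := col3 [:: 1; 0 +i* 1; 0].

Definition n0_line : set 'cV[C]_3 := [set a *: n0 | a in [set: C]].

Definition inB (b : 'M[C]_3) : Prop :=
  inSO3 b /\ [set b *m z | z in n0_line] = n0_line.

(** As the first coordinate of [n0] is 1, this is the scalar by which [b] in B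
    acts on [n0]; see [rhoE]. *)
Definition rho (b : 'M[C]_3) : C := (b *m n0) 0 0.


Lemma bn0 (b : 'M[C]_3) : inB b -> exists a, b *m n0 = a *: n0.
Proof.
case=> _ bL; have : n0_line (b *m n0).
  by rewrite -bL; exists n0 => //; exists 1; rewrite ?scale1r.
by case=> a _ <-; exists a.
Qed.

Lemma rhoE (b : 'M[C]_3) : inB b -> b *m n0 = rho b *: n0.
Proof. by case/bn0 => a ba; rewrite /rho ba !mxE mulr1. Qed.

Lemma inBP (b : 'M[C]_3) a :
  inSO3 b -> a != 0 -> b *m n0 = a *: n0 -> inB b.
Proof.
move=> bS a0 ba; split=> //; apply/seteqP; split=> z /=.
  move=> [w [c _ <-] <-]; rewrite -scalemxAr ba scalerA.
  by exists (c * a).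
move=> [c _ <-]; exists ((c / a) *: n0); first by exists (c / a).
by rewrite -scalemxAr ba scalerA divfK.
Qed.

Lemma n0_neq0 : n0 != 0.
Proof.
by apply/eqP => /matrixP/(_ 0 0); rewrite !mxE => /eqP; rewrite oner_eq0.
Qed.

Lemma rho_neq0 (b : 'M[C]_3) : inB b -> rho b != 0.
Proof.
move=> bB; apply/eqP => r0; have := rhoE bB; rewrite r0 scale0r => bn.
have bU := inSO3_unit bB.1; have /eqP := n0_neq0; apply.
by rewrite -[n0]mul1mx -(mulVmx bU) -mulmxA bn mulmx0.
Qed.

Lemma inB1 : inB 1%:M.
Proof.
apply: (@inBP _ 1); rewrite ?oner_eq0 ?mul1mx ?scale1r //; exact: inSO31.
Qed.

Lemma rho1 : rho 1%:M = 1.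
Proof. by rewrite /rho mul1mx !mxE. Qed.

Lemma mulBn0 (b b' : 'M[C]_3) : inB b -> inB b' ->
  b *m b' *m n0 = (rho b * rho b') *: n0.
Proof.
by move=> bB b'B; rewrite -mulmxA rhoE // -scalemxAr rhoE // scalerA mulrC.
Qed.

Lemma inBM (b b' : 'M[C]_3) : inB b -> inB b' -> inB (b *m b').
Proof.
move=> bB b'B; apply: (@inBP _ (rho b * rho b')); last exact: mulBn0.
  exact: inSO3M bB.1 b'B.1.
by rewrite mulf_neq0 // rho_neq0.
Qed.

Lemma rhoM (b b' : 'M[C]_3) : inB b -> inB b' ->
  rho (b *m b') = rho b * rho b'.
Proof. by move=> bB b'B; rewrite {1}/rho mulBn0 // !mxE mulr1. Qed.

Lemma inBV (b : 'M[C]_3) : inB b -> inB (invmx b).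
Proof.
move=> bB; apply: (@inBP _ (rho b)^-1).
- exact: inSO3V bB.1.
- by rewrite invr_eq0 rho_neq0.
have bU := inSO3_unit bB.1.
rewrite -[in RHS](mul1mx n0) -(mulVmx bU) -mulmxA (rhoE bB) -scalemxAr scalerA.
by rewrite mulVf ?scale1r ?rho_neq0.
Qed.

Lemma rhoV (b : 'M[C]_3) : inB b -> rho (invmx b) = (rho b)^-1.
Proof.
move=> bB; have bU := inSO3_unit bB.1.
apply: (mulfI (rho_neq0 bB)); rewrite -rhoM ?mulmxV ?rho1 ?mulfV ?rho_neq0 //.
exact: inBV.
Qed.

Lemma expi0 : expi 0 = 1.
Proof. by rewrite /expi cos0 sin0. Qed.

Lemma expiD s t : expi (s + t) = expi s * expi t.
Proof.
by rewrite /expi cosD sinD; simpc; rewrite (addrC (sin s * _)).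
Qed.

Lemma rotz0 : rotz 0 = 1%:M.
Proof.
apply/matrixP => i j; rewrite !mxE cos0 sin0 oppr0.
by case: i j => [[|[|[|//]]] ?] [[|[|[|//]]] ?].
Qed.

Lemma rotzD s t : rotz (s + t) = rotz s *m rotz t.
Proof.
apply/matrixP => i j; rewrite !mxE !big_ord_recr big_ord0 /= !mxE cosD sinD.
by case: i j => [[|[|[|//]]] ?] [[|[|[|//]]] ?] /=;
  rewrite ?(mulr0, mul0r, addr0, add0r, mulr1, mulNr, mulrN, opprD) // addrC.
Qed.

Lemma rotzN t : rotz (- t) *m rotz t = 1%:M.
Proof. by rewrite -rotzD addNr rotz0. Qed.

Lemma rotz_unit t : rotz t \in unitmx.
Proof. by have /mulmx1_unit[] := rotzN t. Qed.

Lemma invmx_rotz t : invmx (rotz t) = rotz (- t).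
Proof.
by rewrite -[LHS]mul1mx -(rotzN t) -mulmxA mulmxV ?rotz_unit ?mulmx1.
Qed.

(** SO(3)/SO(2) *)
Definition homR_rel (g h : SO3 R) : bool :=
  `[< exists phi, val h = val g *m invmx (rotz phi) >].

Lemma homR_equiv : equiv_class_of homR_rel.
Proof.
split=> [g|g h|h g k].
- by apply/asboolP; exists 0; rewrite invmx_rotz oppr0 rotz0 mulmx1.
- by apply/asboolP/asboolP => -[t ->]; exists (- t);
    rewrite !invmx_rotz -mulmxA -rotzD ?opprK ?addNr ?subrr rotz0 mulmx1.
- move=> /asboolP[s hs] /asboolP[t ks]; apply/asboolP; exists (s + t).
  by rewrite ks hs !invmx_rotz -mulmxA -rotzD opprD.
Qed.

Canonical homR_equiv_rel := EquivRelPack homR_equiv.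
Definition homR := {eq_quot homR_rel}.

(** SO(3) x_SO(2) C *)
Definition assR_rel (x y : SO3 R * C) : bool :=
  `[< exists phi, val y.1 = val x.1 *m invmx (rotz phi) /\
                  y.2 = expi (2 * phi) * x.2 >].

Lemma assR_equiv : equiv_class_of assR_rel.
Proof.
have sym x y : assR_rel x y -> assR_rel y x.
  move=> /asboolP[t [xy1 xy2]]; apply/asboolP; exists (- t); split.
    by rewrite xy1 !invmx_rotz -mulmxA -rotzD opprK addNr rotz0 mulmx1.
  by rewrite xy2 mulrA -expiD mulrN addNr expi0 mul1r.
split=> [x|x y|y x z].
- apply/asboolP; exists 0.
  by rewrite invmx_rotz oppr0 rotz0 mulmx1 mulr0 expi0 mul1r.
- by apply/idP/idP => /sym.
- move=> /asboolP[s [xy1 xy2]] /asboolP[t [yz1 yz2]]; apply/asboolP.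
  exists (s + t); split.
    by rewrite yz1 xy1 !invmx_rotz -mulmxA -rotzD opprD.
  by rewrite yz2 xy2 mulrA -expiD -mulrDr addrC.
Qed.

Canonical assR_equiv_rel := EquivRelPack assR_equiv.
Definition assR := {eq_quot assR_rel}.

(** SO(3,C)/B *)
Definition homC_rel (g h : SO3 C) : bool :=
  `[< exists b, inB b /\ val h = val g *m invmx b >].

Lemma homC_equiv : equiv_class_of homC_rel.
Proof.
have sym g h : homC_rel g h -> homC_rel h g.
  move=> /asboolP[b [bB gh]]; apply/asboolP; exists (invmx b).
  split; first exact: inBV.
  by rewrite gh invmxK -mulmxA mulVmx ?mulmx1 // (inSO3_unit bB.1).
split=> [g|g h|h g k].
- apply/asboolP; exists 1%:M; split; first exact: inB1.
  by rewrite invmx1 mulmx1.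
- by apply/idP/idP => /sym.
- move=> /asboolP[b [bB gh]] /asboolP[b' [b'B hk]]; apply/asboolP.
  exists (b' *m b); split; first exact: inBM.
  by rewrite hk gh (inSO3_invM b'B.1 bB.1) mulmxA.
Qed.

Canonical homC_equiv_rel := EquivRelPack homC_equiv.
Definition homC := {eq_quot homC_rel}.

(** SO(3,C) x_B C *)
Definition assC_rel (x y : SO3 C * C) : bool :=
  `[< exists b, [/\ inB b, val y.1 = val x.1 *m invmx b
                  & y.2 = rho b ^- 2 * x.2] >].

Lemma assC_equiv : equiv_class_of assC_rel.
Proof.
have sym x y : assC_rel x y -> assC_rel y x.
  move=> /asboolP[b [bB xy1 xy2]]; apply/asboolP; exists (invmx b).
  split; first exact: inBV.
    by rewrite xy1 invmxK -mulmxA mulVmx ?mulmx1 // (inSO3_unit bB.1).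
  rewrite xy2 rhoV // exprVn invrK mulrA divff ?mul1r //.
  by rewrite expf_neq0 // rho_neq0.
split=> [x|x y|y x z].
- apply/asboolP; exists 1%:M; split; first exact: inB1.
    by rewrite invmx1 mulmx1.
  by rewrite rho1 expr1n invr1 mul1r.
- by apply/idP/idP => /sym.
- move=> /asboolP[b [bB xy1 xy2]] /asboolP[b' [b'B yz1 yz2]]; apply/asboolP.
  exists (b' *m b); split; first exact: inBM.
    by rewrite yz1 xy1 (inSO3_invM b'B.1 bB.1) mulmxA.
  by rewrite yz2 xy2 rhoM // exprMn [in RHS]invfM mulrA.
Qed.

Canonical assC_equiv_rel := EquivRelPack assC_equiv.
Definition assC := {eq_quot assC_rel}.

Definition pi_homR (g : SO3 R) : homR := \pi_homR g.
Definition pi_assR (x : SO3 R * C) : assR := \pi_assR x.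
Definition pi_homC (g : SO3 C) : homC := \pi_homC g.
Definition pi_assC (x : SO3 C * C) : assC := \pi_assC x.

(** The bundle projections and the left action [L_h]; they are defined through
    representatives, and the next three lemmas show that they are the maps
    induced on the quotients. *)
Definition proj_assR (x : assR) : homR := pi_homR (repr x).1.
Definition proj_assC (x : assC) : homC := pi_homC (repr x).1.
Definition Lmul (h : SO3 C) (x : assC) : assC :=
  pi_assC (SO3mul h (repr x).1, (repr x).2).

Lemma proj_assRE x : proj_assR (pi_assR x) = pi_homR x.1.
Proof.
rewrite /proj_assR /pi_assR; case: piP => y /eqmodP /= /asboolP[t [xy _]].
by apply/esym/eqmodP/asboolP; exists t.
Qed.

Lemma proj_assCE x : proj_assC (pi_assC x) = pi_homC x.1.
Proof.
rewrite /proj_assC /pi_assC; case: piP => y /eqmodP /= /asboolP[b [bB xy _]].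
by apply/esym/eqmodP/asboolP; exists b.
Qed.

Lemma LmulE h x : Lmul h (pi_assC x) = pi_assC (SO3mul h x.1, x.2).
Proof.
rewrite /Lmul /pi_assC; case: piP => y /eqmodP /= /asboolP[b [bB xy1 xy2]].
by apply/esym/eqmodP/asboolP; exists b; split=> //=; rewrite xy1 mulmxA.
Qed.

(** [a x1 + x2 = x3] in a common fibre. *)
Definition lin_assR (a : C) (x1 x2 x3 : assR) : Prop :=
  exists g q1 q2, [/\ x1 = pi_assR (g, q1), x2 = pi_assR (g, q2)
                    & x3 = pi_assR (g, a * q1 + q2)].

Definition lin_assC (a : C) (x1 x2 x3 : assC) : Prop :=
  exists g q1 q2, [/\ x1 = pi_assC (g, q1), x2 = pi_assC (g, q2)
                    & x3 = pi_assC (g, a * q1 + q2)].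

Definition sphere := {s : 'cV[R]_3 | bil s s == 1}.

(** A linear map [T_s S -> T_s S] is encoded by its extension by zero to the
    normal line [R s]. It is symmetric and trace-free iff the extension, an
    endomorphism of R^3 vanishing at [s], is. *)
Definition inQ : pred ('cV[R]_3 * 'M[R]_3) := fun x =>
  [&& bil x.1 x.1 == 1, x.2^T == x.2, \tr x.2 == 0 & x.2 *m x.1 == 0].

Definition Q := {x : 'cV[R]_3 * 'M[R]_3 | inQ x}.

Lemma inQ_sphere x : inQ x -> bil x.1 x.1 == 1.
Proof. by case/and4P. Qed.

Definition proj_Q (x : Q) : sphere := exist _ (val x).1 (inQ_sphere (valP x)).

Definition lin_Q (a : R) (x1 x2 x3 : Q) : Prop :=
  [/\ (val x2).1 = (val x1).1, (val x3).1 = (val x1).1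
    & (val x3).2 = a *: (val x1).2 + (val x2).2].

(** The element of [Q_(e3)] identified with [q = a + i b]. *)
Definition Qe3 (q : C) : 'M[R]_3 :=
  mx3 [:: [:: complex.Re q; complex.Im q; 0];
          [:: complex.Im q; - complex.Re q; 0]; [:: 0; 0; 0]].

Definition vecC (q : C) : 'rV[C]_1 := \row_j q.
Definition vecR (q : C) : 'rV[R]_2 := \row_j [:: complex.Re q; complex.Im q]`_j.

Definition emb_SO3R (g : SO3 R) : 'M[R]_3 := val g.
Definition emb_SO3RxC (x : SO3 R * C) : ('M[R]_3 * 'rV[R]_2)%type :=
  (val x.1, vecR x.2).
Definition emb_SO3C (g : SO3 C) : 'M[C]_3 := val g.
Definition emb_SO3CxC (x : SO3 C * C) : ('M[C]_3 * 'rV[C]_1)%type :=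
  (val x.1, vecC x.2).
Definition emb_sphere (s : sphere) : 'cV[R]_3 := val s.
Definition emb_Q (x : Q) : ('cV[R]_3 * 'M[R]_3)%type := val x.

Definition sphere_atlas : set (chart R 2 sphere) :=
  quot_atlas (@smooth R) emb_sphere id.
Definition Q_atlas : set (chart R (2 + 2) Q) :=
  quot_atlas (@smooth R) emb_Q id.
Definition homR_atlas : set (chart R 2 homR) :=
  quot_atlas (@smooth R) emb_SO3R pi_homR.
Definition assR_atlas : set (chart R (2 + 2) assR) :=
  quot_atlas (@smooth R) emb_SO3RxC pi_assR.
Definition homC_atlas : set (chart C 1 homC) :=
  quot_atlas (@holomorphic R) emb_SO3C pi_homC.
Definition assC_atlas : set (chart C (1 + 1) assC) :=
  quot_atlas (@holomorphic R) emb_SO3CxC pi_assC.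
Definition SO3CxC_atlas : set (chart C 4 (SO3 C * C)%type) :=
  quot_atlas (@holomorphic R) emb_SO3CxC id.

Definition Q_nz : set Q := [set x | (val x).2 != 0].
Definition SO3CxC_nz : set (SO3 C * C) := [set x | x.2 != 0].
Definition assC_nz : set assC := pi_assC @` SO3CxC_nz.

(** For [(s, q)] outside the zero section, [q] is invertible on [T_s S] and
    this is the inverse image of [u] in [T_s S] under [q]. *)
Definition Q_inv (x : Q) (u : 'cV[R]_3) : 'cV[R]_3 :=
  xget 0 [set w | bil (val x).1 w = 0 /\ (val x).2 *m w = u].

Definition omega : oneform (2 + 2) Q 'cV[R]_3 :=
  ambient_form emb_Q (fun x v => Q_inv x v.1).

Definition Omega_tilde : oneform 4 (SO3 C * C)%type 'cV[C]_3 :=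
  ambient_form emb_SO3CxC (fun x delta =>
    (x.2^-1 * bil (invmx (val x.1) *m (delta.1 *m e3 C)) n0)
      *: (val x.1 *m n0)).

End Spaces.

(* Main.v *)
Require Import Defs.
From HB Require Import structures.
From mathcomp Require Import all_boot all_order all_algebra.
From mathcomp Require Import generic_quotient complex.
From mathcomp Require Import ring lra.
From mathcomp Require Import all_classical all_reals all_analysis.
Import numFieldNormedType.Exports.

Set Implicit Arguments.
Unset Strict Implicit.
Unset Printing Implicit Defensive.

Import Order.TTheory GRing.Theory Num.Theory.
Local Open Scope classical_set_scope.
Local Open Scope quotient_scope.
Local Open Scope complex_scope.
Local Open Scope ring_scope.

(** The sphere is the conic of isotropic lines of C^3. For [g] in SO(3,C) the
    vector [n = g n0] is isotropic; the class of [g] modulo B is the line of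
    [n], and the class of [(g, q)] is the pair [(n, q)] up to
    [(n, q) -> (a n, a^2 q)] with [a != 0] ([homC_eqP], [assC_eqP]). The real
    quotients have the same description, because a rotation that preserves the
    line of [n0] is a rotation about [e3] ([stab_line], [homR_eqP], [assR_eqP])
    and every isotropic line contains some [g n0] with [g] real ([real_repr]).
    So the inclusions induce bijections. The affine parameter [tf n] of the
    conic and the invariant [lf n q = q / af n ^+ 2] are coordinates in which
    these bijections are the identity; their translates by the cyclic
    permutations of the coordinates give atlases in which any two points lie in
    a common chart. The sphere and [Q] get their charts from the real quotients
    ([quot_transport]), and SO(3,C) x C has Cayley charts.

    If [g^-1 dg] is antisymmetric, the given form equals
    [(i / q) (n x dn)] ([Omega_tilde_gam]). Let [(n1, q1)] and
    [(n2, q2) = (a n1, a^2 q1)] be two lifts of the same curve. Differentiating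
    [n1 x n2 = 0] gives [n1 x dn2 = n2 x dn1 = a (n1 x dn1)], hence
    [(1 / q2) (n2 x dn2) = (1 / q1) (n1 x dn1)] ([gam_indep]). So the form can
    be computed from any local lift of a chart ([Omega_lift]): it descends to
    [Omega], and it is equivariant because rotations commute with the cross
    product. It is holomorphic because the derivatives of a holomorphic lift
    are ([holomorphic_diff]), which rests on Goursat's theorem and Cauchy's
    formula.

    Over the real points take [g] real and let [z] be [g^-1 ds], a vector of
    the plane [e3^perp = C]. The form takes the value [(z / q) g n0], whose real
    part is [g] applied to [conj (z / q)]; and [conj (z / q)] is the vector
    that the symmetric matrix of [q] maps to [z] ([Q_invE], [Re_gam]). *)

(** * Regularity classes *)

Section Differentials.
Variable K : numFieldType.
Implicit Types V W : normedModType K.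

(** The form of differentiability in which estimates are verified. *)
Lemma is_diff_eps V W (f : V -> W) (L : {linear V -> W}) x :
  continuous L ->
  (forall e : K, 0 < e -> \forall h \near 0, `|f (h + x) - f x - L h| <= e * `|h|) ->
  is_diff x f L.
Proof.
move=> Lc fL.
have eqf : f \o shift x = cst (f x) + L +o_ 0 id.
  apply/eqaddoP => e e0; have := fL e e0; apply: filterS => h.
  by rewrite /= !fctE /= opprD addrA.
have dE : 'd f x = L :> (V -> W) by exact: diff_unique.
by apply: DiffDef => //; apply/diff_locallyP; rewrite dE.
Qed.

Lemma diff_eps V W (f : V -> W) x : differentiable f x ->
  forall e : K, 0 < e ->
  \forall h \near 0, `|f (h + x) - f x - 'd f x h| <= e * `|h|.
Proof.
move=> /diff_locallyP[_ /eqaddoP fx] e e0; have := fx e e0.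
by apply: filterS => h; rewrite /= !fctE /= opprD addrA.
Qed.

Lemma near_eq_diff V W (f g : V -> W) x :
  (\forall y \near x, f y = g y) -> differentiable f x ->
  differentiable g x /\ 'd g x = 'd f x :> (V -> W).
Proof.
move=> fg df.
have [? ?] : is_diff x g ('d f x).
  apply: is_diff_eps; first exact: diff_continuous.
  move=> e e0; have fgx : f x = g x by exact: nbhs_singleton fg.
  have fg0 : \forall h \near 0, f (h + x) = g (h + x).
    by move: fg; rewrite (near_shift 0 x); apply: filterS => h; rewrite /= subr0.
  near=> h.
  have <- : f (h + x) = g (h + x) by near: h.
  by rewrite -fgx; near: h; exact: diff_eps.
by split.
Unshelve. all: by end_near. Qed.

Lemma near_eq_differentiable V W (f g : V -> W) x :
  (\forall y \near x, f y = g y) -> differentiable f x -> differentiable g x.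
Proof. by move=> fg /(near_eq_diff fg)[]. Qed.

Lemma open_near V (O : set V) (P : V -> Prop) x : open O -> O x ->
  (forall y, O y -> P y) -> \forall y \near x, P y.
Proof. by move=> oO Ox OP; apply: filterS OP _; exact: open_nbhs_nbhs. Qed.

End Differentials.

Section Ck.
Variable K : numFieldType.
Implicit Types V W U : normedModType K.

(** Directional derivatives do not refer to the set, so being C^k on it is a
    pointwise condition. *)
Lemma Ck_pointwise V W k (O : set V) (f : V -> W) :
  Ck k O f <-> forall x, O x -> Ck k [set x] f.
Proof.
elim: k f => [|k IH] f /=.
  by split=> [fO x Ox y -> //|fO x Ox]; [exact: fO|exact: (fO x Ox x)].
split=> [[df fO] x Ox|fO]; split.
- by move=> y ->; exact: df.
- by move=> v; apply: (IH _).1.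
- by move=> x Ox; have [+ _] := fO x Ox; apply.
- by move=> v; apply/IH => x Ox; have [_] := fO x Ox; apply.
Qed.

Lemma Ck_eq V W k (O : set V) (f g : V -> W) : open O ->
  (forall x, O x -> f x = g x) -> Ck k O f -> Ck k O g.
Proof.
move=> oO; elim: k f g => [|k IH] f g fg /=.
  move=> fO x Ox; have := fO x Ox.
  have -> : {for x, continuous g} = (g @ x --> f x) by rewrite fg.
  apply: cvg_trans; apply: near_eq_cvg; exact: (open_near oO Ox).
move=> [df fO]; split.
  move=> x Ox; apply: near_eq_differentiable (df x Ox).
  exact: (open_near oO Ox).
move=> v; apply: IH (fO v) => x Ox.
apply: near_eq_derive; exact: (open_near oO Ox).
Qed.

Lemma Ck_pred V W k (O : set V) (f : V -> W) : Ck k.+1 O f -> Ck k O f.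
Proof.
elim: k f => [|k IH] f /= [df fO].
  by move=> x Ox; exact: differentiable_continuous (df x Ox).
by split=> // v; apply: IH.
Qed.

Lemma Ck_differentiable V W k (O : set V) (f : V -> W) x :
  Ck k.+1 O f -> O x -> differentiable f x.
Proof. by case=> df _; exact: df. Qed.

Lemma Ck_cst V W k (O : set V) (c : W) : Ck k O (cst c : V -> W).
Proof.
elim: k c => [|k IH] c /=; first by move=> x _; exact: cst_continuous.
split=> [x _ //|v].
rewrite (_ : (fun _ => _) = cst 0) //.
by apply/funext => x; exact: derive_cst.
Qed.

Lemma Ck_lin V W k (O : set V) (L : {linear V -> W}) :
  continuous L -> Ck k O L.
Proof.
move=> Lc; case: k => [|k] /=; first by move=> x _; exact: Lc.
split=> [x _|v]; first exact: linear_differentiable.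
rewrite (_ : (fun _ => _) = cst (L v)); first exact: Ck_cst.
apply/funext => x /=; rewrite deriveE; last exact: linear_differentiable.
by rewrite diff_lin.
Qed.

Lemma Ck_add V W k (O : set V) (f g : V -> W) : open O ->
  Ck k O f -> Ck k O g -> Ck k O (fun x => f x + g x).
Proof.
move=> oO; elim: k f g => [|k IH] f g /=.
  by move=> fO gO x Ox; apply: continuousD; [exact: fO|exact: gO].
move=> [df fO] [dg gO]; split=> [x Ox|v].
  by apply: differentiableD; [exact: df|exact: dg].
apply: Ck_eq (IH _ _ (fO v) (gO v)) => // x Ox.
rewrite -[RHS]/('D_v (f + g) x) deriveD //; apply: diff_derivable;
  [exact: df|exact: dg].
Qed.

(** Scaling as a function of two arguments that carries a bilinear structure;
    the product rule is the derivative of a bilinear map. *)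
Definition scl (V : normedModType K) (a : K) (y : V) : V := a *: y.

Lemma scl_is_bilinear V :
  bilinear_for
    (GRing.Scale.Law.clone _ _ *:%R _)
    (GRing.Scale.Law.clone _ _ *:%R _) (@scl V).
Proof.
split=> [u'|u] a x y /=; rewrite /scl.
- by rewrite scalerDl scalerA.
- by rewrite scalerDr !scalerA mulrC.
Qed.

HB.instance Definition _ V :=
  bilinear_isBilinear.Build K K V V _ _ (@scl V) (@scl_is_bilinear V).

Lemma is_diff_scale V W (a : V -> K) (f : V -> W) x :
  differentiable a x -> differentiable f x ->
  is_diff x (fun y => a y *: f y) (fun h => 'd a x h *: f x + a x *: 'd f x h).
Proof.
move=> da df.
pose B := (fun p : K * W => scl p.1 p.2).
have Bc : continuous B by move=> p; exact: scale_continuous.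
pose af := fun y => (a y, f y).
have daf : differentiable af x by exact: differentiable_pair.
have dB p : differentiable B p by exact: differentiable_bilin.
split; first exact: (@differentiable_comp _ _ _ _ af B).
rewrite [LHS](diff_comp daf (dB _)) diff_bilin // diff_pair //.
by apply/funext => h /=; rewrite /scl addrC.
Qed.

Lemma derive_scale V W (a : V -> K) (f : V -> W) x v :
  differentiable a x -> differentiable f x ->
  'D_v (fun y => a y *: f y) x = 'D_v a x *: f x + a x *: 'D_v f x.
Proof.
move=> da df; have [dp dE] := is_diff_scale da df.
by rewrite !deriveE // dE.
Qed.

Lemma Ck_scale V W k (O : set V) (a : V -> K) (f : V -> W) : open O ->
  Ck k O a -> Ck k O f -> Ck k O (fun x => a x *: f x).
Proof.
move=> oO; elim: k a f => [|k IH] a f.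
  by move=> aO fO x Ox; apply: cvgZ; [exact: aO|exact: fO].
move=> aO1 fO1; have [aO fO] := (Ck_pred aO1, Ck_pred fO1).
move: aO1 fO1 => [da aO'] [df fO']; split=> [x Ox|v].
  by have [] := is_diff_scale (da x Ox) (df x Ox).
have := Ck_add oO (IH _ _ (aO' v) fO) (IH _ _ aO (fO' v)).
apply: Ck_eq => // x Ox.
by rewrite derive_scale //; [exact: da|exact: df].
Qed.

Lemma Ck_inv V k (O : set V) (a : V -> K) : open O ->
  (forall x, O x -> a x != 0) -> Ck k O a -> Ck k O (fun x => (a x)^-1).
Proof.
move=> oO a0; elim: k => [|k IH].
  by move=> aO x Ox; apply: cvgV; [exact: a0|exact: aO].
move=> aO1; have aO := IH (Ck_pred aO1); move: aO1 => [da aO'].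
split=> [x Ox|v]; first by apply: differentiableV; [exact: da|exact: a0].
have := Ck_scale (W := K) oO (Ck_scale (W := K) oO (@Ck_cst V K k O (-1 : K)) aO)
  (Ck_scale (W := K) oO aO (aO' v)).
apply: Ck_eq => // x Ox.
rewrite deriveV ?a0 //; last by apply: diff_derivable; exact: da.
rewrite scalerA; congr (_ *: _).
by rewrite -[X in X * _]/(-1 * (a x)^-1) mulN1r mulNr expr2 invfM.
Qed.

(** A finite family of vectors with continuous linear coordinates; this is how
    finite dimension enters the chain rule for iterated derivatives. *)
Definition framed V := exists (I : finType) (e : I -> V) (l : I -> {linear V -> K}),
  (forall i, continuous (l i)) /\ forall w, w = \sum_i l i w *: e i.

Lemma framed_mx m n : framed 'M[K]_(m, n).
Proof.
pose co (p : 'I_m * 'I_n) (A : 'M[K]_(m, n)) : K := A p.1 p.2.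
have coL p : linear (co p) by move=> a A B; rewrite /co !mxE.
pose l p : {linear 'M[K]_(m, n) -> K} :=
  HB.pack (co p) (GRing.isLinear.Build _ _ _ _ _ (coL p)).
exists ('I_m * 'I_n)%type, (fun p => delta_mx p.1 p.2), l; split.
  by move=> p; exact: coord_continuous.
by move=> w; rewrite {1}(matrix_sum_delta w) pair_bigA.
Qed.

Lemma framed_prod V W : framed V -> framed W -> framed (V * W)%type.
Proof.
move=> [I [e [l [lc lE]]]] [I' [e' [l' [lc' lE']]]].
pose co (i : I + I') (p : V * W) : K :=
  match i with inl j => l j p.1 | inr j => l' j p.2 end.
have coL i : linear (co i).
  by case: i => j a p q; rewrite /co /= linearP.
pose c i : {linear (V * W)%type -> K} :=
  HB.pack (co i) (GRing.isLinear.Build _ _ _ _ _ (coL i)).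
exists (I + I')%type.
exists (fun i => match i with inl j => (e j, 0) | inr j => (0, e' j) end), c.
split.
  case=> j p.
    by apply: (@continuous_comp _ _ _ fst (l j)); [exact: cvg_fst|exact: lc].
  by apply: (@continuous_comp _ _ _ snd (l' j)); [exact: cvg_snd|exact: lc'].
move=> [v w]; rewrite big_sumType /=.
have fstE (s : seq I) : (\sum_(i <- s) l i v *: e i, 0) =
    \sum_(i <- s) l i v *: ((e i, 0) : V * W).
  elim: s => [|i s IH]; first by rewrite !big_nil.
  rewrite !big_cons -IH; apply: injective_projections => //=.
  by rewrite scaler0 addr0.
have sndE (s : seq I') : (0, \sum_(i <- s) l' i w *: e' i) =
    \sum_(i <- s) l' i w *: ((0, e' i) : V * W).
  elim: s => [|i s IH]; first by rewrite !big_nil.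
  rewrite !big_cons -IH; apply: injective_projections => //=.
  by rewrite scaler0 addr0.
rewrite -fstE -sndE -lE -lE'.
by apply: injective_projections; rewrite /= ?addr0 ?add0r.
Qed.

Lemma Ck_sum V W k (O : set V) (I : Type) (r : seq I) (F : I -> V -> W) :
  open O -> (forall i, Ck k O (F i)) -> Ck k O (fun x => \sum_(i <- r) F i x).
Proof.
move=> oO FO; elim: r => [|i r IH].
  by rewrite (_ : (fun _ => _) = cst 0); [exact: Ck_cst|apply/funext => x; rewrite big_nil].
rewrite (_ : (fun _ => _) = fun x => F i x + \sum_(j <- r) F j x).
  exact: Ck_add.
by apply/funext => x; rewrite big_cons.
Qed.

(** The derivative of [f \o g] along [v] is the sum over a frame [e i] of
    [l i ('D_v g) *: ('D_(e i) f \o g)], to which the induction hypothesis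
    applies. *)
Lemma Ck_comp U V k : framed V -> forall W (O : set V) (O' : set U) (f : V -> W) (g : U -> V),
  open O -> open O' -> Ck k O f -> Ck k O' g -> (forall x, O' x -> O (g x)) ->
  Ck k O' (f \o g).
Proof.
move=> frV; elim: k => [|k IH] W O O' f g oO oO' fO gO gOO.
  move=> x Ox; apply: continuous_comp; [exact: gO|exact/fO/gOO].
have gO1 := Ck_pred gO.
move: fO gO => [df fO] [dg dg']; split=> [x Ox|v].
  by apply: differentiable_comp; [exact: dg|exact/df/gOO].
have [I [e [l [lc lE]]]] := frV.
have Cl i : Ck k O' (fun x => l i ('D_v g x)).
  by apply: (IH _ setT O' (l i) ('D_v g) openT oO' _ (dg' v)) => //; exact: Ck_lin.
have Cs i := Ck_scale oO' (Cl i) (IH _ _ _ _ _ oO oO' (fO (e i)) gO1 gOO).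
have := Ck_sum (index_enum I) oO' Cs.
apply: Ck_eq => // x Ox; have dgx := dg x Ox; have dfx := df _ (gOO x Ox).
rewrite [RHS]deriveE; last exact: differentiable_comp.
rewrite diff_comp //= -[X in _ = _ X]deriveE //.
rewrite [X in _ = _ X]lE linear_sum; apply: eq_bigr => i _.
by rewrite linearZ /=; congr (_ *: _); rewrite deriveE.
Qed.

End Ck.

(** The closure properties of a regularity class on which the construction of
    manifolds as quotients rests. *)
Record good_reg (K : numFieldType) (reg : regularity K) : Prop := GoodReg {
  reg_pointwise : forall (V W : normedModType K) (O : set V) (f : V -> W),
    reg V W O f <-> forall x, O x -> reg V W [set x] f;
  reg_eq : forall (V W : normedModType K) (O : set V) (f g : V -> W), open O ->
    (forall x, O x -> f x = g x) -> reg V W O f -> reg V W O g;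
  reg_diff : forall (V W : normedModType K) (O : set V) (f : V -> W) x,
    reg V W O f -> O x -> differentiable f x;
  reg_cst : forall (V W : normedModType K) (O : set V) (c : W),
    reg V W O (fun=> c);
  reg_lin : forall (V W : normedModType K) (O : set V) (L : {linear V -> W}),
    continuous L -> reg V W O L;
  reg_add : forall (V W : normedModType K) (O : set V) (f g : V -> W), open O ->
    reg V W O f -> reg V W O g -> reg V W O (fun x => f x + g x);
  reg_scale : forall (V W : normedModType K) (O : set V) (a : V -> K) (f : V -> W),
    open O -> reg V K O a -> reg V W O f -> reg V W O (fun x => a x *: f x);
  reg_inv : forall (V : normedModType K) (O : set V) (a : V -> K), open O ->
    (forall x, O x -> a x != 0) -> reg V K O a -> reg V K O (fun x => (a x)^-1);
  reg_comp : forall (U V W : normedModType K) (O : set V) (O' : set U)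
    (f : V -> W) (g : U -> V), framed V -> open O -> open O' ->
    reg V W O f -> reg U V O' g -> (forall x, O' x -> O (g x)) ->
    reg U W O' (f \o g)
}.

Lemma smooth_good (R : realType) : good_reg (@smooth R).
Proof.
split.
- move=> V W O f; split=> [fO x Ox k|fO k].
    by move: x Ox; apply/Ck_pointwise.
  by apply/Ck_pointwise => x Ox; exact: fO.
- by move=> V W O f g oO fg fO k; exact: Ck_eq (fO k).
- by move=> V W O f x fO Ox; exact: Ck_differentiable (fO 1%N) Ox.
- by move=> V W O c k; exact: Ck_cst.
- by move=> V W O L Lc k; exact: Ck_lin.
- by move=> V W O f g oO fO gO k; exact: Ck_add.
- by move=> V W O f g oO fO gO k; exact: Ck_scale.
- by move=> V O a oO a0 aO k; exact: Ck_inv.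
- by move=> U V W O O' f g frV oO oO' fO gO gOO k; apply: Ck_comp gOO.
Qed.

Lemma holomorphic_good (R : realType) : good_reg (@holomorphic R).
Proof.
split.
- by move=> V W O f; split=> [fO x Ox y ->|fO x Ox]; [exact: fO|exact: (fO x Ox x)].
- move=> V W O f g oO fg fO x Ox; apply: near_eq_differentiable (fO x Ox).
  exact: (open_near oO Ox).
- by move=> V W O f x fO Ox; exact: fO.
- by move=> V W O c x _; exact: differentiable_cst.
- by move=> V W O L Lc x _; exact: linear_differentiable.
- by move=> V W O f g oO fO gO x Ox; apply: differentiableD; [exact: fO|exact: gO].
- by move=> V W O f g oO fO gO x Ox; have [] := is_diff_scale (fO x Ox) (gO x Ox).
- by move=> V O a oO a0 aO x Ox; apply: differentiableV; [exact: aO|exact: a0].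
- move=> U V W O O' f g _ oO oO' fO gO gOO x Ox.
  by apply: differentiable_comp; [exact: gO|exact/fO/gOO].
Qed.

(** * Calculus in a regularity class *)

Lemma open_preim_in (K : numFieldType) (V W : normedModType K) (O : set V)
    (O' : set W) (f : V -> W) : open O -> open O' ->
  (forall x, O x -> {for x, continuous f}) -> open (O `&` f @^-1` O').
Proof.
move=> oO oO' fc; rewrite openE => x [Ox fx]; apply: filterI.
  exact: open_nbhs_nbhs.
by apply: (fc x Ox); exact: open_nbhs_nbhs.
Qed.

Section RegTheory.
Variables (K : numFieldType) (reg : regularity K) (rg : good_reg reg).
Implicit Types U V W : normedModType K.

Lemma reg_sub V W (O O' : set V) (f : V -> W) :
  O' `<=` O -> reg O f -> reg O' f.
Proof.
by move=> OO /(reg_pointwise rg) fO; apply/(reg_pointwise rg) => x /OO; exact: fO.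
Qed.

Lemma reg_locally V W (O : set V) (f : V -> W) :
  (forall x, O x -> exists N, N x /\ reg N f) -> reg O f.
Proof.
move=> fO; apply/(reg_pointwise rg) => x /fO[N [Nx /(reg_pointwise rg)]].
exact.
Qed.

Lemma reg_continuous V W (O : set V) (f : V -> W) x :
  reg O f -> O x -> {for x, continuous f}.
Proof. by move=> fO Ox; apply: differentiable_continuous; exact: (reg_diff rg fO). Qed.

Lemma reg_open_preim V W (O : set V) (O' : set W) (f : V -> W) :
  open O -> open O' -> reg O f -> open (O `&` f @^-1` O').
Proof.
by move=> oO oO' fO; apply: open_preim_in => // x; exact: reg_continuous.
Qed.

Lemma reg_id V (O : set V) : reg O (fun x => x).
Proof. by apply: (@reg_lin _ _ rg _ _ _ idfun) => x; exact: cvg_id. Qed.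

Lemma reg_linc V W U (O : set V) (L : {linear W -> U}) (f : V -> W) :
  framed W -> continuous L -> open O -> reg O f -> reg O (fun x => L (f x)).
Proof.
move=> frW Lc oO fO; apply: (reg_comp rg frW (@openT _) oO _ fO) => //.
exact: (reg_lin rg).
Qed.

Lemma reg_sum V W (O : set V) (I : Type) (r : seq I) (P : pred I) (F : I -> V -> W) :
  open O -> (forall i, reg O (F i)) ->
  reg O (fun x => \sum_(i <- r | P i) F i x).
Proof.
move=> oO FO; elim: r => [|i r IH].
  rewrite (_ : (fun _ => _) = fun=> 0); first exact: (reg_cst rg).
  by apply/funext => x; rewrite big_nil.
have [Pi|Pi] := boolP (P i).
  rewrite (_ : (fun _ => _) = fun x => F i x + \sum_(j <- r | P j) F j x).
    exact: (reg_add rg).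
  by apply/funext => x; rewrite big_cons Pi.
rewrite (_ : (fun _ => _) = fun x => \sum_(j <- r | P j) F j x) //.
by apply/funext => x; rewrite big_cons (negPf Pi).
Qed.

Lemma reg_mul V (O : set V) (f g : V -> K) : open O -> reg O f -> reg O g ->
  reg O (fun x => f x * g x).
Proof. exact: (reg_scale rg (W := K)). Qed.

Lemma reg_opp V W (O : set V) (f : V -> W) : open O -> reg O f ->
  reg O (fun x => - f x).
Proof.
move=> oO fO.
rewrite (_ : (fun _ => _) = fun x => (-1 : K) *: f x).
  by apply: (reg_scale rg) => //; exact: (reg_cst rg).
by apply/funext => x; rewrite scaleN1r.
Qed.

Lemma reg_subr V W (O : set V) (f g : V -> W) : open O -> reg O f -> reg O g ->
  reg O (fun x => f x - g x).
Proof. by move=> oO fO gO; apply: (reg_add rg) => //; exact: reg_opp. Qed.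

Lemma reg_exp V (O : set V) (f : V -> K) n : open O -> reg O f ->
  reg O (fun x => f x ^+ n).
Proof.
move=> oO fO; elim: n => [|n IH]; first exact: (reg_cst rg).
rewrite (_ : (fun _ => _) = fun x => f x * f x ^+ n); first exact: reg_mul.
by apply/funext => x; rewrite exprS.
Qed.

Lemma reg_prod V (O : set V) (I : Type) (r : seq I) (F : I -> V -> K) :
  open O -> (forall i, reg O (F i)) -> reg O (fun x => \prod_(i <- r) F i x).
Proof.
move=> oO FO; elim: r => [|i r IH].
  rewrite (_ : (fun _ => _) = fun=> 1); first exact: (reg_cst rg).
  by apply/funext => x; rewrite big_nil.
rewrite (_ : (fun _ => _) = fun x => F i x * \prod_(j <- r) F j x).
  exact: reg_mul.
by apply/funext => x; rewrite big_cons.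
Qed.

Lemma reg_mx V m n (O : set V) (f : V -> 'M[K]_(m, n)) : open O ->
  (forall i j, reg O (fun x => f x i j)) -> reg O f.
Proof.
move=> oO fO.
rewrite (_ : f = fun x => \sum_i \sum_j f x i j *: delta_mx i j).
  apply: reg_sum => // i; apply: reg_sum => // j; apply: (reg_scale rg) => //.
  exact: (reg_cst rg).
by apply/funext => x; exact: matrix_sum_delta.
Qed.

Lemma reg_coord V m n (O : set V) (f : V -> 'M[K]_(m, n)) i j : open O ->
  reg O f -> reg O (fun x => f x i j).
Proof.
move=> oO fO.
pose co (A : 'M[K]_(m, n)) : K := A i j.
have coL : linear co by move=> a A B; rewrite /co !mxE.
pose l : {linear 'M[K]_(m, n) -> K} :=
  HB.pack co (GRing.isLinear.Build _ _ _ _ _ coL).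
apply: (reg_linc (L := l)) => //; first exact: framed_mx.
exact: coord_continuous.
Qed.

Lemma reg_fst V W U (O : set V) (f : V -> W * U) : framed W -> framed U ->
  open O -> reg O f -> reg O (fun x => (f x).1).
Proof.
move=> frW frU oO fO.
have fL : linear (fst : W * U -> W) by [].
pose l : {linear (W * U)%type -> W} :=
  HB.pack (fst : W * U -> W) (GRing.isLinear.Build _ _ _ _ _ fL).
apply: (reg_linc (L := l)) => //; first exact: framed_prod.
by move=> p; exact: cvg_fst.
Qed.

Lemma reg_snd V W U (O : set V) (f : V -> W * U) : framed W -> framed U ->
  open O -> reg O f -> reg O (fun x => (f x).2).
Proof.
move=> frW frU oO fO.
have fL : linear (snd : W * U -> U) by [].
pose l : {linear (W * U)%type -> U} :=
  HB.pack (snd : W * U -> U) (GRing.isLinear.Build _ _ _ _ _ fL).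
apply: (reg_linc (L := l)) => //; first exact: framed_prod.
by move=> p; exact: cvg_snd.
Qed.

Lemma reg_pair V W U (O : set V) (f : V -> W) (g : V -> U) :
  framed W -> framed U -> open O ->
  reg O f -> reg O g -> reg O (fun x => (f x, g x)).
Proof.
move=> frW frU oO fO gO.
pose i1 (w : W) : W * U := (w, 0); pose i2 (u : U) : W * U := (0, u).
have l1 : linear i1.
  by move=> a u v; apply: injective_projections; rewrite //= scaler0 addr0.
have l2 : linear i2.
  by move=> a u v; apply: injective_projections; rewrite //= scaler0 addr0.
pose L1 : {linear W -> (W * U)%type} := HB.pack i1 (GRing.isLinear.Build _ _ _ _ _ l1).
pose L2 : {linear U -> (W * U)%type} := HB.pack i2 (GRing.isLinear.Build _ _ _ _ _ l2).
rewrite (_ : (fun _ => _) = fun x => L1 (f x) + L2 (g x)).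
  apply: (reg_add rg) => //; apply: reg_linc => //.
    by move=> w; apply: cvg_pair; [exact: cvg_id|exact: cvg_cst].
  by move=> w; apply: cvg_pair; [exact: cvg_cst|exact: cvg_id].
by apply/funext => x; apply: injective_projections; rewrite /= ?addr0 ?add0r.
Qed.

Lemma reg_mulmx V m n l (O : set V) (f : V -> 'M[K]_(m, n)) (g : V -> 'M[K]_(n, l)) :
  open O -> reg O f -> reg O g -> reg O (fun x => f x *m g x).
Proof.
move=> oO fO gO; apply: reg_mx => // i j.
rewrite (_ : (fun _ => _) = fun x => \sum_k f x i k * g x k j).
  by apply: reg_sum => // k; apply: reg_mul => //; exact: reg_coord.
by apply/funext => x; rewrite mxE.
Qed.

Lemma reg_trmx V m n (O : set V) (f : V -> 'M[K]_(m, n)) :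
  open O -> reg O f -> reg O (fun x => (f x)^T).
Proof.
move=> oO fO; apply: reg_mx => // i j.
rewrite (_ : (fun _ => _) = fun x => f x j i); first exact: reg_coord.
by apply/funext => x; rewrite mxE.
Qed.

Lemma reg_det V n (O : set V) (f : V -> 'M[K]_n) :
  open O -> reg O f -> reg O (fun x => \det (f x)).
Proof.
move=> oO fO; rewrite /determinant; apply: reg_sum => // s.
apply: reg_mul => //; first exact: (reg_cst rg).
by apply: reg_prod => // i; exact: reg_coord.
Qed.

(** Cramer's rule. *)
Lemma reg_invmx V n (O : set V) (f : V -> 'M[K]_n) : open O ->
  (forall x, O x -> \det (f x) != 0) -> reg O f -> reg O (fun x => invmx (f x)).
Proof.
move=> oO f0 fO.
apply: (@reg_eq _ _ rg _ _ _ (fun x => (\det (f x))^-1 *: \adj (f x))) => //.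
  by move=> x Ox; rewrite /invmx unitmxE unitfE f0.
apply: (reg_scale rg) => //; first by apply: (reg_inv rg) => //; exact: reg_det.
apply: reg_mx => // i j.
rewrite (_ : (fun _ => _) =
  fun x => (-1) ^+ (j + i) * \det (\matrix_(k, l) f x (lift j k) (lift i l))).
  apply: reg_mul => //; first exact: (reg_cst rg).
  apply: reg_det => //; apply: reg_mx => // k l.
  rewrite (_ : (fun _ => _) = fun x => f x (lift j k) (lift i l)).
    exact: reg_coord.
  by apply/funext => x; rewrite mxE.
apply/funext => x; rewrite mxE /cofactor; congr (_ * \det _).
by apply/matrixP => k l; rewrite !mxE.
Qed.

Lemma reg_mx3 V (O : set V) (a b c d e f g h i : V -> K) : open O ->
  reg O a -> reg O b -> reg O c -> reg O d -> reg O e -> reg O f ->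
  reg O g -> reg O h -> reg O i ->
  reg O (fun x => mx3 [:: [:: a x; b x; c x]; [:: d x; e x; f x]; [:: g x; h x; i x]]).
Proof.
move=> oO *; apply: reg_mx => // k l.
by case: k l => [[|[|[|//]]] ?] [[|[|[|//]]] ?];
  under [X in reg O X]eq_fun do rewrite mxE /=.
Qed.

End RegTheory.

(** * Quotients of embedded submanifolds *)

Section QuotientManifolds.
Variables (K : numFieldType) (reg : regularity K) (rg : good_reg reg).

Section OneQuotient.
Variables (n : nat) (V : normedModType K) (P X : Type) (i : P -> V) (p : P -> X).
Hypotheses (frV : framed V) (psurj : forall x, exists m, p m = x).
Notation A := (quot_atlas (n := n) reg i p).

Lemma quot_ok c : A c -> chart_ok c. Proof. by case. Qed.

Lemma cinv_cimg (c : chart K n X) y : chart_ok c -> cimg c y ->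
  cdom c (cinv c y) /\ cmap c (cinv c y) = y.
Proof. by case=> _ cK [x cx <-]; rewrite cK. Qed.

(** A saturated subset of [X] is open for the quotient topology iff its
    preimage is relatively open in [V]. *)
Definition sat_open (D : set X) := forall m, D (p m) ->
  exists U : set V, [/\ open U, U (i m) & forall m', U (i m') -> D (p m')].

Lemma sat_open_cdom c : A c -> sat_open (cdom c).
Proof.
move=> [ ok Ac] m /Ac[ [ O [F [ oO Om _ OF]]] _]; exists O; split=> // m' /OF [] //.
Qed.

(** Near each point of its image, the inverse of a chart lifts to [P] inside a
    prescribed open set. *)
Lemma local_section c m (U : set V) : A c -> cdom c (p m) -> open U -> U (i m) ->
  exists (N : set 'rV[K]_n) (s : 'rV[K]_n -> P),
    [/\ open N, N (cmap c (p m)), reg N (i \o s), s (cmap c (p m)) = m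
      & forall y, N y -> [/\ cimg c y, p (s y) = cinv c y & U (i (s y))]].
Proof.
move=> [ ok Ac] cm oU Um; have [_ [ O [s [ oO Om sO sm Os]]]] := Ac m cm.
exists (O `&` (i \o s) @^-1` U), s; split=> //.
- exact: (reg_open_preim rg oO oU sO).
- by split=> //=; rewrite sm.
- by apply: (reg_sub rg) sO => y [].
- by move=> y [Oy Uy]; have [? ?] := Os y Oy; split.
Qed.

(** The local sections of a chart show that its image contains a neighbourhood
    of each of its points. *)
Lemma quot_image_open c (D : set X) : A c -> sat_open D ->
  open (cmap c @` (cdom c `&` D)).
Proof.
move=> Ac oD; rewrite openE => _ [x [cx Dx] <-].
have [m mx] := psurj x; subst x.
have [U [ oU Um UD]] := oD m Dx.
have [N [s [ oN Nm _ _ Ns]]] := local_section Ac cx oU Um.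
have [] : nbhs (cmap c (p m)) N by exact: open_nbhs_nbhs.
move=> e e0 eN; exists e => // y /eN Ny.
have [cy sy Usy] := Ns y Ny.
have [cdy cyK] := cinv_cimg (quot_ok Ac) cy.
by exists (cinv c y) => //; split => //; rewrite -sy; exact: UD.
Qed.

(** A change of charts is an extension of one coordinate map composed with a
    local section of the other. *)
Lemma quot_compat c c' : A c -> A c' ->
  open (cmap c @` (cdom c `&` cdom c')) /\
  reg (cmap c @` (cdom c `&` cdom c')) (cmap c' \o cinv c).
Proof.
move=> Ac Ac'; split; first exact: quot_image_open Ac (sat_open_cdom Ac').
apply: (reg_locally rg) => _ [x [cx c'x] <-].
have [m mx] := psurj x; subst x.
have [ [ O [F [ oO Om FO OF]]] _] := Ac'.2 m c'x.
have [N [s [ oN Nm sN _ Ns]]] := local_section Ac cx oO Om.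
exists N; split=> //.
apply: (@reg_eq _ _ rg _ _ _ (F \o (i \o s))) => //.
  by move=> y Ny; have [cy sy Oy] := Ns y Ny; rewrite /= -sy (OF _ Oy).2.
by apply: (reg_comp rg frV oO oN FO sN) => y /Ns[].
Qed.

(** The restrictions of charts to open sets supply the disjoint chart domains
    of the Hausdorff condition. *)
Definition crestr (c : chart K n X) (D : set X) : chart K n X :=
  Chart (cdom c `&` D) (cmap c) (cinv c).

Lemma quot_restrict c D : A c -> sat_open D -> A (crestr c D).
Proof.
move=> Ac oD; split.
  split; first exact: quot_image_open.
  by move=> x [cx _]; exact: (quot_ok Ac).2.
move=> m [cm Dm]; have [U [ oU Um UD]] := oD m Dm; split.
  have [ [ O [F [ oO Om FO OF]]] _] := Ac.2 m cm.
  exists (O `&` U), F; split=> //; first exact: openI.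
    by apply: (reg_sub rg) FO => x [].
  by move=> m' [Om' Um']; have [cm' cE] := OF m' Om'; do !split=> //; exact: UD.
have [N [s [ oN Nm sN sm Ns]]] := local_section Ac cm oU Um.
exists N, s; split=> // y Ny; have [cy sy Uy] := Ns y Ny; split=> //.
have [cdy cyK] := cinv_cimg (quot_ok Ac) cy.
by exists (cinv c y) => //; split=> //; rewrite -sy; exact: UD.
Qed.

Lemma sat_open_cmap c (B : set 'rV[K]_n) : A c -> open B ->
  sat_open (cdom c `&` cmap c @^-1` B).
Proof.
move=> Ac oB m [cm Bm]; have [ [ O [F [ oO Om FO OF]]] _] := Ac.2 m cm.
exists (O `&` F @^-1` B); split.
- exact: (reg_open_preim rg).
- by split=> //=; rewrite -(OF m Om).2.
- by move=> m' [Om' Bm']; have [cm' cE] := OF m' Om'; split=> //=; rewrite cE.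
Qed.

Lemma separate (W : normedModType K) (x y : W) : x <> y ->
  exists B B' : set W, [/\ open B, open B', B x, B' y & B `&` B' = set0].
Proof.
move=> /eqP xy; have := @norm_hausdorff _ W; rewrite open_hausdorff => /(_ x y xy).
move=> [ [B B'] /= [/set_mem Bx /set_mem By] [ oB oB' BB]].
by exists B, B'; split=> //; exact/eqP.
Qed.

Lemma quot_separate c c' (D D' : set X) x x' : A c -> A c' -> cdom c x -> cdom c' x' ->
  sat_open D -> sat_open D' -> D x -> D' x' -> D `&` D' = set0 ->
  exists c c', [/\ A c, A c', cdom c x, cdom c' x' & cdom c `&` cdom c' = set0].
Proof.
move=> Ac Ac' cx cx' oD oD' Dx Dx' DD.
exists (crestr c D), (crestr c' D'); split; [exact: quot_restrict|exact: quot_restrict|by split|by split|].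
rewrite -subset0 => z [ [_ Dz] [_ D'z]].
by rewrite -DD.
Qed.

(** Points in a common chart domain can be separated there. *)
Lemma quot_manifold (u : nat -> chart K n X) : (forall k, A (u k)) ->
  (forall x x', exists k, cdom (u k) x /\ cdom (u k) x') -> is_manifold reg A.
Proof.
move=> Au cover; split.
- by move=> c /quot_ok.
- by exists u; split=> // x; have [k []] := cover x x; exists k.
- by move=> c c'; exact: quot_compat.
move=> x x' xx'; have [k [kx kx']] := cover x x'.
have ne : cmap (u k) x <> cmap (u k) x'.
  move=> e; apply: xx'.
  by rewrite -((quot_ok (Au k)).2 x kx) -((quot_ok (Au k)).2 x' kx') e.
have [B [B' [ oB oB' Bx Bx' BB]]] := separate ne.
apply: (quot_separate (Au k) (Au k) kx kx' (sat_open_cmap (Au k) oB)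
  (sat_open_cmap (Au k) oB')) => //.
rewrite -subset0 => z [ [_ Bz] [_ B'z]].
have : (B `&` B') (cmap (u k) z) by [].
by rewrite BB.
Qed.

End OneQuotient.

(** A submanifold is Hausdorff because its ambient space is. *)
Lemma sub_manifold (n : nat) (V : normedModType K) (P : Type) (i : P -> V)
    (u : nat -> chart K n P) : framed V -> injective i ->
  (forall k, quot_atlas reg i id (u k)) ->
  (forall x, exists k, cdom (u k) x) -> is_manifold reg (quot_atlas (n := n) reg i id).
Proof.
move=> frV iI Au cover.
have psurj (x : P) : exists m, id m = x by exists x.
split.
- by move=> c /quot_ok.
- by exists u.
- by move=> c c'; exact: quot_compat.
move=> x x' xx'; have [ [k kx] [k' kx']] := (cover x, cover x').
have [B [B' [ oB oB' Bx Bx' BB]]] := separate (fun e => xx' (iI _ _ e)).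
have so (C : set V) : open C -> sat_open i id (i @^-1` C).
  by move=> oC m Cm; exists C.
apply: (quot_separate _ (Au k) (Au k') kx kx' (so _ oB) (so _ oB')) => //.
rewrite -subset0 => z [Bz B'z].
have : (B `&` B') (i z) by [].
by rewrite BB.
Qed.

(** For [p = id] the local sections of a chart are its inverse. *)
Lemma cinv_reg (n : nat) (V : normedModType K) (P : Type) (i : P -> V)
    (c : chart K n P) :
  quot_atlas reg i id c -> open (cimg c) /\ reg (cimg c) (i \o cinv c).
Proof.
move=> Ac; have [ oc cK] := quot_ok Ac; split=> //.
apply: (reg_locally rg) => _ [m cm <-].
have [N [s [ oN Nm sN _ Ns]]] := local_section Ac cm (@openT V) I.
exists N; split; first exact: Nm.
by apply: (@reg_eq _ _ rg _ _ _ _ _ oN _ sN) => z /Ns[_ /= -> _].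
Qed.

Section Transport.
Variables (V V' : normedModType K) (P P' X X' : Type).
Variables (i : P -> V) (p : P -> X) (i' : P' -> V') (p' : P' -> X').

(** [f] is covered, near [i m], by a map [phi : P -> P'] sending [m] to [m'],
    which extends to a regular map of the ambient spaces. *)
Definition local_lift (f : X -> X') m m' :=
  exists (phi : P -> P') (U : set V) (Phi : V -> V'),
    [/\ open U, U (i m), reg U Phi, phi m = m'
      & forall m1, U (i m1) ->
          i' (phi m1) = Phi (i m1) /\ p' (phi m1) = f (p m1)].

End Transport.

(** Composition with the local lifts of [g] and [f] turns the extensions and
    the sections of a chart of [X] into those of a chart of [X']. *)
Lemma quot_transport (n : nat) (V V' : normedModType K) (P P' X X' : Type)
    (i : P -> V) (p : P -> X) (i' : P' -> V') (p' : P' -> X')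
    (f : X -> X') (g : X' -> X) (c : chart K n X) :
  framed V -> (forall x, exists m, p m = x) ->
  cancel f g -> cancel g f ->
  (forall m', exists m, local_lift i p i' p' f m m') ->
  (forall m', exists m, local_lift i' p' i p g m' m) ->
  quot_atlas reg i p c ->
  quot_atlas reg i' p' (Chart (g @^-1` cdom c) (cmap c \o g) (f \o cinv c)).
Proof.
move=> frV psurj fK gK fL gL Ac; set c' := Chart _ _ _.
have imgE : cimg c' = cimg c.
  apply/seteqP; split=> [_ [x' cx' <-]|_ [x cx <-]].
    by exists (g x').
  by exists (f x); rewrite /= fK.
split.
  split; first by rewrite imgE; exact: (quot_ok Ac).1.
  by move=> x' cx' /=; rewrite (quot_ok Ac).2 // gK.
move=> m' cm'; split.
  have [m [phi [U [Phi [ oU Um PhiU phim UP]]]]] := gL m'.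
  have [_ pm] := UP _ Um; rewrite phim in pm.
  have cm : cdom c (p m) by rewrite pm.
  have [ [ O [F [ oO Om FO OF]]] _] := Ac.2 m cm.
  exists (U `&` Phi @^-1` O), (F \o Phi); split.
  - exact: (reg_open_preim rg).
  - by split=> //=; rewrite -(UP _ Um).1 phim.
  - apply: (reg_comp rg frV oO _ FO _) => [||x []//].
      exact: (reg_open_preim rg).
    by apply: (reg_sub rg) PhiU => x [].
  - move=> m1 [U1 O1]; have [iE pE] := UP _ U1.
    rewrite /= -iE in O1; have [cE FE] := OF _ O1.
    by rewrite /= -pE -iE.
have [m [phi [U [Phi [ oU Um PhiU phim UP]]]]] := fL m'.
have [_ pm] := UP _ Um; rewrite phim in pm.
have gm : g (p' m') = p m by rewrite pm fK.
have cm : cdom c (p m) by rewrite -gm.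
have [N [s [ oN Nm sN sm Ns]]] := local_section Ac cm oU Um.
exists N, (phi \o s); rewrite /= gm; split=> //.
- apply: (@reg_eq _ _ rg _ _ _ (Phi \o (i \o s))) => //.
    by move=> y /Ns[_ _ /UP[iE _]] /=.
  by apply: (reg_comp rg frV oU oN PhiU sN) => y /Ns[].
- by rewrite sm.
- by move=> y /Ns[cy sy /UP[_ pE]]; rewrite imgE /= pE sy.
Qed.

(** In a chart and its transport the map [f] is the identity. *)
Lemma transport_diffeo (n : nat) (X X' : Type) (A : set (chart K n X))
    (A' : set (chart K n X')) (f : X -> X') (g : X' -> X) :
  cancel f g -> cancel g f ->
  (forall x, exists c, [/\ A c, cdom c x, chart_ok c
     & A' (Chart (g @^-1` cdom c) (cmap c \o g) (f \o cinv c))]) ->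
  diffeo reg A A' f.
Proof.
move=> fK gK cover; exists g; split=> //.
  move=> x; have [c [Ac cx [ oc cK] Ac']] := cover x.
  exists c, (Chart (g @^-1` cdom c) (cmap c \o g) (f \o cinv c)).
  split=> //; first by move=> y cy; rewrite /= fK.
  apply: (@reg_eq _ _ rg _ _ _ (fun y => y)) => //; last exact: reg_id.
  by move=> y [x' cx' <-] /=; rewrite fK cK.
move=> x; have [c [Ac cx [ oc cK] Ac']] := cover (g x).
exists (Chart (g @^-1` cdom c) (cmap c \o g) (f \o cinv c)), c.
have imgE : cimg (Chart (g @^-1` cdom c) (cmap c \o g) (f \o cinv c)) = cimg c.
  apply/seteqP; split=> [_ [x' cx' <-]|_ [x1 cx1 <-]].
    by exists (g x').
  by exists (f x1); rewrite /= fK.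
split=> //=.
rewrite imgE; apply: (@reg_eq _ _ rg _ _ _ (fun y => y)) => //; last exact: reg_id.
by move=> y [x' cx' <-] /=; rewrite fK cK.
Qed.

End QuotientManifolds.

(** * Complex-valued integrals over segments *)

(** The base fields may differ, so this covers maps between real and complex
    spaces. *)
Lemma uniform_continuous (K K' : numFieldType) (V : normedModType K)
    (W : normedModType K') (f : V -> W) :
  (forall e : K', 0 < e -> exists2 d : K, 0 < d &
     forall x y, `|x - y| < d -> `|f x - f y| < e) -> continuous f.
Proof.
move=> fe x; apply/cvgrPdist_lt => e /fe[d d0 fd].
apply/nbhs_ballP; exists d => // y; rewrite -ball_normE /=; exact: fd.
Qed.

Section Continuous.
Variables (K : numFieldType) (T : topologicalType).
Implicit Types f g : T -> K.

Lemma cont_mul f g : continuous f -> continuous g -> continuous (fun x => f x * g x).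
Proof. by move=> fc gc x; apply: continuousM; [exact: fc|exact: gc]. Qed.

Lemma cont_add f g : continuous f -> continuous g -> continuous (fun x => f x + g x).
Proof. by move=> fc gc x; apply: continuousD; [exact: fc|exact: gc]. Qed.

Lemma cont_sub f g : continuous f -> continuous g -> continuous (fun x => f x - g x).
Proof. by move=> fc gc x; apply: continuousB; [exact: fc|exact: gc]. Qed.

Lemma cont_cst (c : K) : continuous (fun _ : T => c).
Proof. exact: cst_continuous. Qed.
End Continuous.

Section Integral.
Variable R : realType.
Notation C := (Num.NumField.sort R[i]).
Implicit Types (u v : R -> R) (f g : R -> C).

Lemma derive0_const (u : R -> R) (a b : R) :
  (forall x : R, a < x < b -> is_derive x 1 u 0) ->
  forall x y : R, a < x < b -> a < y < b -> u x = u y.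
Proof.
move=> du.
have main (x y : R) : x <= y -> a < x < b -> a < y < b -> u x = u y.
  move=> xy /andP[ax xb] /andP[ay yb].
  have dux (z : R) : z \in `[x, y]%R -> is_derive z 1 u 0.
    rewrite in_itv /= => /andP[xz zy]; apply: du.
    by rewrite (lt_le_trans ax xz) (le_lt_trans zy yb).
  have uc : {within `[x, y], continuous u}.
    by apply: derivable_within_continuous => z zxy; have [] := dux z zxy.
  have duo : forall z : R, z \in `]x, y[%R -> is_derive z (1 : R) u ((fun=> 0) z).
    move=> z; rewrite in_itv /= => /andP[xz zy].
    by apply: dux; rewrite in_itv /= !ltW.
  have [c _] := MVT_segment xy duo uc.
  by rewrite mul0r => /eqP; rewrite subr_eq0 => /eqP.
by move=> x y xab yab; case: (leP x y) => [|/ltW] xy; [|apply/esym]; exact: main.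
Qed.

(** The primitives given by the fundamental theorem of calculus on the half-lines
    [- m, +oo[ differ by constants where they overlap, so they glue. *)
Lemma primitive_exists (u : R -> R) : continuous u ->
  exists U : R -> R, forall x : R, is_derive x 1 U (u x).
Proof.
move=> uc.
pose F (m x : R) : R := (\int[lebesgue_measure]_(t in `[(- m)%R, x]) u t)%R.
have dF (m x : R) : - m < x -> is_derive x (1 : R) (F m) (u x).
  move=> mx.
  have int : lebesgue_measure.-integrable `[- m, x + 1] (EFin \o u).
    apply: continuous_compact_integrable; first exact: segment_compact.
    exact: continuous_subspaceT.
  have xx1 : x < x + 1 by rewrite ltrDl.
  have [dFx Fx] := continuous_FTC1_closed xx1 int mx (uc x).
  by apply: (DeriveDef dFx); rewrite -derive1E Fx.
have Fm (m N x : R) : `|x| < m -> `|x| < N -> F m x - F m 0 = F N x - F N 0.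
  move=> xm xN; set k := Num.min m N.
  have kx : `|x| < k by rewrite lt_min xm.
  have k0 : 0 < k by apply: le_lt_trans kx.
  have := @derive0_const (fun y => F m y - F N y) (- k) (`|x| + 1) _ x 0.
  have c1 : - k < x < `|x| + 1.
    by rewrite ltrNl (le_lt_trans (ler_norm _)) ?normrN // (le_lt_trans (ler_norm _)) // ltrDl.
  have c2 : - k < 0 < `|x| + 1 by rewrite oppr_lt0 k0 ltr_wpDl.
  move=> /(_ _ c1 c2) FF.
  have {}FF : F m x - F N x = F m 0 - F N 0.
    apply: FF => y /andP[ky _]; rewrite -[0](subrr (u y)).
    apply: is_deriveB; apply: dF; apply: le_lt_trans ky; rewrite lerN2 ge_min lexx ?orbT //.
  by move: (F m x) (F N x) (F m 0) (F N 0) FF => a b c d FF; lra.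
exists (fun x => F (`|x| + 1) x - F (`|x| + 1) 0) => x.
pose N := `|x| + 2.
have dN : is_derive x 1 (fun y => F N y - F N 0) (u x).
  rewrite -[u x]subr0; apply: is_deriveB; apply: dF.
  rewrite /N ltrNl; apply: le_lt_trans (ler_norm _) _.
  by rewrite normrN ltrDl.
apply: near_eq_is_derive dN.
near=> y; apply: Fm; last by rewrite ltrDl.
have : `|x - y| < 1 by near: y; apply: cvgr_dist_lt => //; exact: cvg_id.
move=> xy; rewrite /N; have : `|y| <= `|x| + `|x - y|.
  by rewrite -{1}(subKr x y) -opprB opprB; apply: ler_normB.
move=> /le_lt_trans; apply; rewrite ltrD2l (lt_trans xy) // ltr1n.
Unshelve. all: by end_near. Qed.

Lemma Re_le_norm (z : C) : (`|complex.Re z|)%:C <= `|z|.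
Proof. by rewrite normc_def lecR -sqrtr_sqr ler_wsqrtr // lerDl sqr_ge0. Qed.

Lemma Im_le_norm (z : C) : (`|complex.Im z|)%:C <= `|z|.
Proof. by rewrite normc_def lecR -sqrtr_sqr ler_wsqrtr // lerDr sqr_ge0. Qed.

Lemma normc_real (x : R) : `|x%:C| = `|x|%:C.
Proof. by rewrite normc_def /= expr0n /= addr0 sqrtr_sqr. Qed.

Lemma normc_le_ReIm (x y : R) : `|x +i* y| <= (`|x| + `|y|)%:C.
Proof.
have -> : x +i* y = x%:C + 'i * y%:C by rewrite [LHS]complexE.
apply: le_trans (ler_normD _ _) _.
rewrite normrM !normc_real rmorphD lerD2l /=.
by rewrite (_ : `|'i| = 1) ?mul1r // normc_def /= expr0n expr1n add0r sqrtr1.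
Qed.

Lemma pos_cplx (e : C) : 0 < e -> exists2 r : R, 0 < r & e = r%:C.
Proof.
move=> e0; exists (complex.Re e); first by move: e0; rewrite ltcE => /andP[].
by rewrite RRe_real // gtr0_real.
Qed.

Lemma ge0_cplx (e : C) : 0 <= e -> exists2 r : R, 0 <= r & e = r%:C.
Proof.
move=> e0; exists (complex.Re e); first by move: e0; rewrite lecE => /andP[].
by rewrite RRe_real // ger0_real.
Qed.

Lemma continuous_Re : continuous (fun z : C => complex.Re z).
Proof.
apply: (@uniform_continuous R[i] R) => e e0; exists e%:C; first by rewrite ltcR.
move=> z w zw; rewrite -ltcR -raddfB; apply: le_lt_trans zw.
exact: Re_le_norm.
Qed.

Lemma continuous_Im : continuous (fun z : C => complex.Im z).
Proof.
apply: (@uniform_continuous R[i] R) => e e0; exists e%:C; first by rewrite ltcR.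
move=> z w zw; rewrite -ltcR -raddfB; apply: le_lt_trans zw.
exact: Im_le_norm.
Qed.

Lemma continuous_real_complex : continuous (fun x : R => x%:C : C).
Proof.
apply: (@uniform_continuous R R[i] R^o R[i]^o) => _ /pos_cplx[e e0 ->]; exists e => // z w zw.
by rewrite -rmorphB /= normc_real ltcR.
Qed.

(** A chosen primitive, if there is one. *)
Definition prim (u : R -> R) : R -> R :=
  xget u [set U | forall x : R, is_derive x (1 : R) U (u x)].

Lemma primE (u U : R -> R) a b : (forall x : R, is_derive x (1 : R) U (u x)) ->
  prim u b - prim u a = U b - U a.
Proof.
move=> dU; rewrite /prim; case: xgetP => [W _ dW|/(_ U)]; last by [].
suff E : W b - U b = W a - U a.
  by move: (W b) (W a) (U b) (U a) E => ? ? ? ? ?; lra.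
apply: (is_derive_0_is_cst (f := fun y => W y - U y)) => x.
by rewrite -[0](subrr (u x)); apply: is_deriveB.
Qed.

(** The integral of a continuous function over a segment, with values in the
    complex numbers, as an increment of primitives; this form makes additivity
    in the segment and the substitution of explicit primitives immediate. *)
Definition integ (a b : R) (f : R -> C) : C :=
  (prim (fun x => complex.Re (f x)) b - prim (fun x => complex.Re (f x)) a) +i*
  (prim (fun x => complex.Im (f x)) b - prim (fun x => complex.Im (f x)) a).

Lemma integ_prim f (U W : R -> R) a b :
  (forall x : R, is_derive x (1 : R) U (complex.Re (f x))) ->
  (forall x : R, is_derive x (1 : R) W (complex.Im (f x))) ->
  integ a b f = (U b - U a) +i* (W b - W a).
Proof. by move=> dU dW; rewrite /integ (primE _ _ dU) (primE _ _ dW). Qed.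

Lemma integ_prim_exists f : continuous f -> exists U W : R -> R,
  (forall x : R, is_derive x (1 : R) U (complex.Re (f x))) /\
  (forall x : R, is_derive x (1 : R) W (complex.Im (f x))).
Proof.
move=> fc.
have [|U dU] := @primitive_exists (fun x => complex.Re (f x)).
  by move=> x; apply: continuous_comp; [exact: fc|exact: continuous_Re].
have [|W dW] := @primitive_exists (fun x => complex.Im (f x)).
  by move=> x; apply: continuous_comp; [exact: fc|exact: continuous_Im].
by exists U, W.
Qed.

Lemma integ_chasles a b c f : integ a c f = integ a b f + integ b c f.
Proof. by rewrite /integ; simpc; congr (_ +i* _); ring. Qed.

Lemma integ_add a b f g : continuous f -> continuous g ->
  integ a b (fun x => f x + g x) = integ a b f + integ a b g.
Proof.
move=> /integ_prim_exists[U [W [dU dW]]] /integ_prim_exists[U' [W' [dU' dW']]].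
rewrite (integ_prim _ _ dU dW) (integ_prim _ _ dU' dW').
have d1 (x : R) : is_derive x (1 : R) (fun x => U x + U' x) (complex.Re (f x + g x)).
  by rewrite raddfD; apply: is_deriveD.
have d2 (x : R) : is_derive x (1 : R) (fun x => W x + W' x) (complex.Im (f x + g x)).
  by rewrite raddfD; apply: is_deriveD.
rewrite (integ_prim (f := fun x => f x + g x) _ _ d1 d2).
by simpc; congr (_ +i* _); ring.
Qed.

Lemma integ_scale a b c f : continuous f ->
  integ a b (fun x => c * f x) = c * integ a b f.
Proof.
move=> /integ_prim_exists[U [W [dU dW]]]; rewrite (integ_prim _ _ dU dW).
case: c => c1 c2.
have d1 (x : R) : is_derive x (1 : R) (fun x => c1 * U x - c2 * W x)
    (complex.Re ((c1 +i* c2) * f x)).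
  rewrite (_ : complex.Re _ = c1 * complex.Re (f x) - c2 * complex.Im (f x)).
    by apply: is_deriveB; apply: is_deriveZ.
  by case: (f x) => ? ?; simpc.
have d2 (x : R) : is_derive x (1 : R) (fun x => c1 * W x + c2 * U x)
    (complex.Im ((c1 +i* c2) * f x)).
  rewrite (_ : complex.Im _ = c1 * complex.Im (f x) + c2 * complex.Re (f x)).
    by apply: is_deriveD; apply: is_deriveZ.
  by case: (f x) => ? ?; simpc.
rewrite (integ_prim (f := fun x => (c1 +i* c2) * f x) _ _ d1 d2).
by simpc; congr (_ +i* _); ring.
Qed.

Lemma integ_sub a b f g : continuous f -> continuous g ->
  integ a b (fun x => f x - g x) = integ a b f - integ a b g.
Proof.
move=> fc gc; have mgc : continuous (fun x => -1 * g x).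
  by apply: cont_mul gc; exact: cont_cst.
have E : (fun x => f x - g x) = fun x => f x + (-1) * g x.
  by apply/funext => x; rewrite mulN1r.
by rewrite E (integ_add a b fc mgc) (integ_scale a b (-1) gc) mulN1r.
Qed.

Lemma integ_cst a b c : integ a b (fun=> c) = c * (b - a)%:C.
Proof.
case: c => c1 c2.
have d (k x : R) : is_derive x (1 : R) (fun x => k * x) k.
  by rewrite -[X in is_derive _ _ _ X]mulr1; apply: is_deriveZ.
rewrite (integ_prim (f := fun=> c1 +i* c2) _ _ (d c1) (d c2)).
by simpc; congr (_ +i* _); ring.
Qed.

Lemma integ_id a b : integ a b (fun x => x%:C : C) = ((b ^+ 2 - a ^+ 2) / 2)%:C.
Proof.
have d1 (x : R) : is_derive x (1 : R) (fun x => 2^-1 * (x * x)) x.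
  rewrite (_ : is_derive _ _ _ _ =
    is_derive x (1 : R) (fun x => 2^-1 * (x * x)) (2^-1 * (x * 1 + x * 1))).
    by apply: is_deriveZ; apply: is_deriveM.
  by congr is_derive; field.
have d2 (x : R) : is_derive x (1 : R) (fun=> 0 : R) 0 by exact: is_derive_cst.
rewrite (integ_prim (f := fun x => x%:C : C) _ _ d1 d2).
by apply/eqP; rewrite eq_complex /=; apply/andP; split; apply/eqP; [field|ring].
Qed.

(** The real and the imaginary part are bounded separately, whence the factor 2. *)
Lemma integ_bound a b f (M : C) : a <= b -> continuous f ->
  (forall x, a <= x <= b -> `|f x| <= M) ->
  `|integ a b f| <= 2 * M * (b - a)%:C.
Proof.
move=> ab fc fM.
have /ge0_cplx[m m0 ME] : 0 <= M.
  by apply: le_trans (fM a _); rewrite ?lexx.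
have [U [W [dU dW]]] := integ_prim_exists fc; rewrite (integ_prim _ _ dU dW).
have bnd (u V : R -> R) : (forall x : R, is_derive x (1 : R) V (u x)) ->
    (forall x, a <= x <= b -> `|u x| <= m) -> `|V b - V a| <= m * (b - a).
  move=> dV um.
  have Vc : {within `[a, b], continuous V}.
    by apply: derivable_within_continuous => z _; have [] := dV z.
  have [c] := MVT_segment ab (fun z _ => dV z) Vc.
  rewrite in_itv /= => cab ->; rewrite normrM (ger0_norm (x := b - a)) ?subr_ge0 //.
  by rewrite ler_wpM2r ?subr_ge0 // um.
apply: le_trans (normc_le_ReIm _ _) _.
have bU : `|U b - U a| <= m * (b - a).
  apply: bnd dU _ => x xab; rewrite -lecR -ME.
  by apply: le_trans (fM x xab); exact: Re_le_norm.
have bW : `|W b - W a| <= m * (b - a).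
  apply: bnd dW _ => x xab; rewrite -lecR -ME.
  by apply: le_trans (fM x xab); exact: Im_le_norm.
rewrite ME -(rmorph_nat (real_complex R)) -!rmorphM lecR.
by rewrite -mulrA mulr_natl mulr2n; apply: lerD.
Qed.

End Integral.

(** * Goursat's theorem for rectangles *)

Section Bisection.
Variable R : realType.

Lemma exp2_large (L d : R) : 0 < d -> exists n, L / 2 ^+ n < d.
Proof.
move=> d0; pose n := Num.bound `|L / d|; exists n.
rewrite ltr_pdivrMr ?exprn_gt0 // mulrC -ltr_pdivrMr //.
apply: le_lt_trans (ler_norm _) _.
apply: lt_le_trans (archi_boundP (normr_ge0 _)) _.
have -> : Num.bound `|L / d| = n by [].
by rewrite -natrX ler_nat ltnW // ltn_expl.
Qed.

(** Iterating the choice of a bad quarter gives nested rectangles that shrink to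
    a point. *)
Lemma bisection (Bad : R -> R -> R -> R -> Prop) x0 x1 y0 y1 :
  (forall a b c d, a <= b -> c <= d -> Bad a b c d ->
    let m := (a + b) / 2 in let n := (c + d) / 2 in
    [\/ Bad a m c n, Bad m b c n, Bad a m n d | Bad m b n d]) ->
  x0 <= x1 -> y0 <= y1 -> Bad x0 x1 y0 y1 ->
  exists px py, [/\ x0 <= px <= x1, y0 <= py <= y1 &
    forall del, 0 < del -> exists a b c d,
      [/\ a <= px <= b, c <= py <= d, b - a + (d - c) < del & Bad a b c d]].
Proof.
move=> quarter x01 y01 bad.
pose rect := (R * R * (R * R))%type.
pose P (r : rect) := [/\ r.1.1 <= r.1.2, r.2.1 <= r.2.2 & Bad r.1.1 r.1.2 r.2.1 r.2.2].
pose Q (r r' : rect) := [/\ P r', r.1.1 <= r'.1.1 /\ r'.1.2 <= r.1.2,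
  r.2.1 <= r'.2.1 /\ r'.2.2 <= r.2.2, r'.1.2 - r'.1.1 = (r.1.2 - r.1.1) / 2
  & r'.2.2 - r'.2.1 = (r.2.2 - r.2.1) / 2].
have step (r : rect) : exists r', P r -> Q r r'.
  have [Pr|nPr] := pselect (P r); last by exists r.
  move: r Pr => [[a b] [c d]] [/= ab cd badr].
  have mid (u v : R) : u <= v -> [/\ u <= (u + v) / 2, (u + v) / 2 <= v,
      (u + v) / 2 - u = (v - u) / 2 & v - (u + v) / 2 = (v - u) / 2].
    by move=> uv; split; lra.
  have [am mb am2 mb2] := mid _ _ ab; have [cn nd cn2 nd2] := mid _ _ cd.
  by case: (quarter a b c d ab cd badr) => bq;
    [exists ((a, (a + b) / 2), (c, (c + d) / 2))
    |exists (((a + b) / 2, b), (c, (c + d) / 2))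
    |exists ((a, (a + b) / 2), ((c + d) / 2, d))
    |exists (((a + b) / 2, b), ((c + d) / 2, d))] => _; split.
have [nxt nxtP] := choice step.
pose r n := iter n nxt ((x0, x1), (y0, y1)).
have rP n : P (r n) by elim: n => [|n IH]; [split|have [] := nxtP _ IH].
have rQ n : Q (r n) (r n.+1) by exact: nxtP (rP n).
have nest m n : [/\ (r n).1.1 <= (r (m + n)%N).1.1, (r (m + n)%N).1.2 <= (r n).1.2,
    (r n).2.1 <= (r (m + n)%N).2.1 & (r (m + n)%N).2.2 <= (r n).2.2].
  elim: m => [|m [l1 l2 l3 l4]]; first by [].
  have [_ [q1 q2] [q3 q4] _ _] := rQ (m + n)%N; rewrite addSn.
  by split; [apply: le_trans q1|apply: le_trans l2|apply: le_trans q3|apply: le_trans l4].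
have size n : (r n).1.2 - (r n).1.1 + ((r n).2.2 - (r n).2.1) =
    (x1 - x0 + (y1 - y0)) / 2 ^+ n.
  elim: n => [|n IH]; first by rewrite expr0 divr1.
  have [_ _ _ -> ->] := rQ n.
  by rewrite -mulrDl IH exprS invfM mulrA mulrAC.
have cross (f g : rect -> R) :
    (forall m n, f (r n) <= f (r (m + n)%N)) ->
    (forall m n, g (r (m + n)%N) <= g (r n)) -> (forall n, f (r n) <= g (r n)) ->
    exists p, forall n, f (r n) <= p <= g (r n).
  move=> fm gm fg; pose S := range (fun n => f (r n)).
  have ub n : ubound S (g (r n)).
    move=> _ [m _ <-]; apply: le_trans (fm n m) _; apply: le_trans (fg _) _.
    by rewrite addnC.
  have S0 : S !=set0 by exists (f (r 0%N)); exists 0%N.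
  exists (sup S) => n; apply/andP; split; last exact: ge_sup.
  by apply: ub_le_sup; [exists (g (r 0%N)); exact: ub|exists n].
have [px pxP] := cross (fun r => r.1.1) (fun r => r.1.2)
  (fun m n => let: And4 a _ _ _ := nest m n in a)
  (fun m n => let: And4 _ a _ _ := nest m n in a)
  (fun n => let: And3 a _ _ := rP n in a).
have [py pyP] := cross (fun r => r.2.1) (fun r => r.2.2)
  (fun m n => let: And4 _ _ a _ := nest m n in a)
  (fun m n => let: And4 _ _ _ a := nest m n in a)
  (fun n => let: And3 _ a _ := rP n in a).
exists px, py; split; [exact: (pxP 0%N)|exact: (pyP 0%N)|] => del del0.
have [n nd] := exp2_large (x1 - x0 + (y1 - y0)) del0.
exists (r n).1.1, (r n).1.2, (r n).2.1, (r n).2.2; split => //.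
  by rewrite size.
by have [] := rP n.
Qed.

End Bisection.

Lemma cont_comp (T U V : topologicalType) (f : T -> U) (g : U -> V) :
  continuous f -> continuous g -> continuous (fun x => g (f x)).
Proof.
by move=> fc gc x; apply: (@continuous_comp _ _ _ f g); [exact: fc|exact: gc].
Qed.

Section Goursat.
Variable R : realType.
Notation C := (Num.NumField.sort R[i]).
Implicit Types G : C -> C.

Lemma cont_hline (y : R) : continuous (fun s : R => s +i* y : C).
Proof.
apply: (@uniform_continuous R R[i] R^o R[i]^o) => _ /pos_cplx[e e0 ->]; exists e => // z w zw.
rewrite (_ : _ - _ = (z - w)%:C) ?normc_real ?ltcR //.
by apply/eqP; rewrite eq_complex /= subrr !eqxx.
Qed.

Lemma cont_vline (x : R) : continuous (fun t : R => x +i* t : C).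
Proof.
apply: (@uniform_continuous R R[i] R^o R[i]^o) => _ /pos_cplx[e e0 ->]; exists e => // z w zw.
apply: le_lt_trans (_ : (`|0 : R| + `|z - w|)%:C < _); last by rewrite normr0 add0r ltcR.
rewrite (_ : _ - _ = 0 +i* (z - w)); first exact: normc_le_ReIm.
by apply/eqP; rewrite eq_complex /= subrr !eqxx.
Qed.

Definition im : C := 0 +i* 1.

(** The integral of [G] along the boundary of [x0, x1] x [y0, y1]. *)
Definition rint G (x0 x1 y0 y1 : R) : C :=
  integ x0 x1 (fun s => G (s +i* y0)) + im * integ y0 y1 (fun t => G (x1 +i* t)) -
  integ x0 x1 (fun s => G (s +i* y1)) - im * integ y0 y1 (fun t => G (x0 +i* t)).

Lemma rint_quarter G a b c d m n :
  rint G a b c d = rint G a m c n + rint G m b c n + rint G a m n d + rint G m b n d.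
Proof.
rewrite /rint (integ_chasles a m b (fun s => G (s +i* c))).
rewrite (integ_chasles a m b (fun s => G (s +i* d))).
rewrite (integ_chasles c n d (fun t => G (a +i* t))).
rewrite (integ_chasles c n d (fun t => G (b +i* t))).
ring.
Qed.

Lemma rint_add G H x0 x1 y0 y1 : continuous G -> continuous H ->
  rint (fun z => G z + H z) x0 x1 y0 y1 = rint G x0 x1 y0 y1 + rint H x0 x1 y0 y1.
Proof.
move=> Gc Hc.
have ch (F : C -> C) y : continuous F -> continuous (fun s : R => F (s +i* y)).
  by move=> Fc; exact: (cont_comp (@cont_hline y) Fc).
have cv (F : C -> C) x : continuous F -> continuous (fun t : R => F (x +i* t)).
  by move=> Fc; exact: (cont_comp (@cont_vline x) Fc).
rewrite /rint (integ_add _ _ (ch _ y0 Gc) (ch _ y0 Hc)).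
rewrite (integ_add _ _ (ch _ y1 Gc) (ch _ y1 Hc)).
rewrite (integ_add _ _ (cv _ x0 Gc) (cv _ x0 Hc)).
rewrite (integ_add _ _ (cv _ x1 Gc) (cv _ x1 Hc)).
ring.
Qed.

Lemma rint_affine (al be : C) x0 x1 y0 y1 :
  rint (fun z => al + be * z) x0 x1 y0 y1 = 0.
Proof.
have cid : continuous (fun x : R => x%:C : C) by exact: continuous_real_complex.
have aff (p q : C) a b : integ a b (fun s => p + q * s%:C) =
    p * (b - a)%:C + q * ((b ^+ 2 - a ^+ 2) / 2)%:C.
  rewrite (integ_add _ _ (f := fun=> p) (g := fun s => q * s%:C)).
  - by rewrite integ_cst integ_scale // integ_id.
  - exact: cont_cst.
  - exact: (cont_mul (@cont_cst _ _ q) cid).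
have h y : (fun s : R => al + be * (s +i* y)) =
    fun s => (al + be * (im * y%:C)) + be * s%:C.
  apply/funext => s; rewrite [s +i* y]complexE /= -/im; ring.
have v x : (fun t : R => al + be * (x +i* t)) =
    fun t => (al + be * x%:C) + (be * im) * t%:C.
  apply/funext => t; rewrite [x +i* t]complexE /= -/im; ring.
rewrite /rint !h !v !aff !rmorphB /=; ring.
Qed.

Lemma rint_bound G x0 x1 y0 y1 (M : C) : continuous G -> x0 <= x1 -> y0 <= y1 ->
  (forall x y, x0 <= x <= x1 -> y0 <= y <= y1 -> `|G (x +i* y)| <= M) ->
  `|rint G x0 x1 y0 y1| <= 4 * M * (x1 - x0 + (y1 - y0))%:C.
Proof.
move=> Gc x01 y01 GM.
have h y : y0 <= y <= y1 ->
    `|integ x0 x1 (fun s => G (s +i* y))| <= 2 * M * (x1 - x0)%:C.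
  move=> yy; apply: integ_bound => //.
    exact: (cont_comp (@cont_hline y) Gc).
  by move=> x xx; exact: GM.
have v x : x0 <= x <= x1 ->
    `|im * integ y0 y1 (fun t => G (x +i* t))| <= 2 * M * (y1 - y0)%:C.
  move=> xx; rewrite normrM (_ : `|im| = 1) ?mul1r.
    apply: integ_bound => //.
      exact: (cont_comp (@cont_vline x) Gc).
    by move=> y yy; exact: GM.
  by rewrite normc_def /= expr0n expr1n add0r sqrtr1.
have -> : 4 * M * (x1 - x0 + (y1 - y0))%:C =
    2 * M * (x1 - x0)%:C + 2 * M * (y1 - y0)%:C + 2 * M * (x1 - x0)%:C +
    2 * M * (y1 - y0)%:C by rewrite rmorphD /=; ring.
rewrite /rint; apply: le_trans (ler_normB _ _) _; apply: lerD.
  apply: le_trans (ler_normB _ _) _; apply: lerD.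
    apply: le_trans (ler_normD _ _) _; apply: lerD.
      by apply: h; rewrite lexx.
    by apply: v; rewrite lexx andbT.
  by apply: h; rewrite lexx andbT.
by apply: v; rewrite lexx.
Qed.

(** On a small rectangle around a point of differentiability the affine part
    contributes nothing, and the error is small compared with the square of the
    size; the latter is exactly additive under bisection. *)
Lemma goursat G (x0 x1 y0 y1 : R) : continuous G -> x0 <= x1 -> y0 <= y1 ->
  (forall x y : R, x0 <= x <= x1 -> y0 <= y <= y1 ->
     differentiable G (x +i* y : C)) ->
  rint G x0 x1 y0 y1 = 0.
Proof.
move=> Gc x01 y01 dG; apply/eqP; rewrite -normr_le0.
have /ge0_cplx[r r0 rE] : 0 <= `|rint G x0 x1 y0 y1| by [].
rewrite rE (_ : 0 = 0%:C) // lecR leNgt; apply/negP => rpos.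
pose sz (a b c d : R) := b - a + (d - c).
pose L := sz x0 x1 y0 y1.
(* This [e] makes the initial rectangle bad: [e * L ^+ 2 < r]. *)
pose e := r / (2 * (L ^+ 2 + 1)).
have L2 : 0 < L ^+ 2 + 1 by rewrite ltr_wpDl ?sqr_ge0.
have e0 : 0 < e by rewrite divr_gt0 // mulr_gt0.
pose Bad a b c d := (e * sz a b c d ^+ 2)%:C < `|rint G a b c d|.
have bad0 : Bad x0 x1 y0 y1.
  rewrite /Bad -/L rE ltcR /e mulrAC ltr_pdivrMr ?mulr_gt0 //.
  by rewrite ltr_pM2l //; lra.
have quarter a b c d : a <= b -> c <= d -> Bad a b c d ->
    let m := (a + b) / 2 in let n := (c + d) / 2 in
    [\/ Bad a m c n, Bad m b c n, Bad a m n d | Bad m b n d].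
  move=> ab cd badr m n.
  apply: contrapT => nb.
  have sq : sz a b c d / 2 = sz a m c n /\ sz a b c d / 2 = sz m b c n /\
      sz a b c d / 2 = sz a m n d /\ sz a b c d / 2 = sz m b n d.
    by rewrite /sz /m /n; split; [|split; [|split]]; lra.
  have le a' b' c' d' : sz a b c d / 2 = sz a' b' c' d' ->
      ~ Bad a' b' c' d' -> `|rint G a' b' c' d'| <= (e * (sz a b c d / 2) ^+ 2)%:C.
    move=> ->; rewrite /Bad; have /ge0_cplx[q _ ->] : 0 <= `|rint G a' b' c' d'| by [].
    by rewrite ltcR lecR => /negP; rewrite -leNgt.
  have [q1 [q2 [q3 q4]]] := sq.
  have l1 : `|rint G a m c n| <= (e * (sz a b c d / 2) ^+ 2)%:C.
    by apply: le q1 _ => h; apply: nb; apply: Or41.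
  have l2 : `|rint G m b c n| <= (e * (sz a b c d / 2) ^+ 2)%:C.
    by apply: le q2 _ => h; apply: nb; apply: Or42.
  have l3 : `|rint G a m n d| <= (e * (sz a b c d / 2) ^+ 2)%:C.
    by apply: le q3 _ => h; apply: nb; apply: Or43.
  have l4 : `|rint G m b n d| <= (e * (sz a b c d / 2) ^+ 2)%:C.
    by apply: le q4 _ => h; apply: nb; apply: Or44.
  have := lt_le_trans badr (_ : _ <= (e * sz a b c d ^+ 2)%:C).
  rewrite ltxx => /(_ _) H; apply: (notF (H _)).
  rewrite (rint_quarter G a b c d m n).
  have -> : e * sz a b c d ^+ 2 = e * (sz a b c d / 2) ^+ 2 + e * (sz a b c d / 2) ^+ 2 +
    e * (sz a b c d / 2) ^+ 2 + e * (sz a b c d / 2) ^+ 2 by field.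
  rewrite !rmorphD /=; do 3 (apply: le_trans (ler_normD _ _) _; apply: lerD => //).
have [px [py [pxP pyP small]]] := bisection quarter x01 y01 bad0.
have dGp := dG _ _ pxP pyP; set p : C := px +i* py in dGp.
pose A := 'd G p 1.
have dGE z : 'd G p z = z * A by rewrite -[z in LHS]mulr1 linearZ.
(* [rint_bound] costs a factor 4 < 5. *)
have e5 : 0 < (e / 5)%:C :> C by rewrite ltcR divr_gt0.
have /nbhs_ballP[_ /pos_cplx[del del0 ->] Gdel] := diff_eps dGp e5.
have [a [b [c [d [abp cdp szd bad]]]]] := small _ del0.
have ab : a <= b by case/andP: abp => /le_trans h /h.
have cd : c <= d by case/andP: cdp => /le_trans h /h.
have affc : continuous (fun z : C => (G p - p * A) + A * z).
  apply: (cont_add (@cont_cst _ _ (G p - p * A))).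
  apply: (cont_mul (@cont_cst _ _ A)) => z; exact: cvg_id.
pose E z := G z - ((G p - p * A) + A * z).
have Ec : continuous E.
  exact: (cont_sub Gc affc).
have GE : rint G a b c d = rint E a b c d.
  rewrite -[RHS]addr0 -(rint_affine (G p - p * A) A a b c d) -(rint_add _ _ _ _ Ec affc).
  suff -> : (fun z => E z + (G p - p * A + A * z)) = G by [].
  by apply/funext => z; exact: subrK.
have S0 : 0 <= sz a b c d by rewrite /sz addr_ge0 // subr_ge0.
have : `|rint E a b c d| <= 4 * (e / 5 * sz a b c d)%:C * (sz a b c d)%:C.
  apply: rint_bound => // x y xx yy.
  have np : `|(x +i* y) - p| <= (sz a b c d)%:C.
    rewrite /p (_ : _ - _ = (x - px) +i* (y - py)); last by simpc.
    apply: le_trans (normc_le_ReIm _ _) _; rewrite lecR /sz.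
    move: abp cdp xx yy => /andP[? ?] /andP[? ?] /andP[? ?] /andP[? ?].
    by apply: lerD; rewrite ler_norml lerNl opprB; apply/andP; split; apply: lerB.
  have := Gdel ((x +i* y) - p); rewrite -ball_normE /= sub0r normrN subrK dGE.
  move=> /(_ _) H; rewrite /E (_ : _ - _ = G (x +i* y) - G p - (x +i* y - p) * A); last by ring.
  apply: le_trans (H _) _; first by apply: le_lt_trans np _; rewrite ltcR.
  by rewrite (rmorphM (real_complex R) (e / 5)) /=; apply: ler_wpM2l np; exact: ltW.
rewrite -GE => /(lt_le_trans bad).
rewrite -(rmorph_nat (real_complex R)) -!rmorphM ltcR.
have : 0 <= e * sz a b c d ^+ 2 by rewrite mulr_ge0 ?sqr_ge0 // ltW.
by move=> ? ?; lra.
Qed.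

End Goursat.

(** * Complex and real differentiability *)

Section Bridge.
Variable R : realType.
Notation C := (Num.NumField.sort R[i]).

(** The base fields of the two spaces differ, so linearity is stated through the
    inclusion of the reals, and continuity by a bound. *)
Definition real_linear (V : normedModType R) (V' : normedModType R[i]) (j : V -> V') :=
  (forall (a : R) u v, j (a *: u + v) = (a%:C : C) *: j u + j v) /\
  exists2 k : R, 0 < k & forall h, `|j h| <= (k * `|h|)%:C.

Definition real_form (W : normedModType R[i]) (W' : normedModType R) (r : W -> W') :=
  (forall (a : R) u v, r ((a%:C : C) *: u + v) = a *: r u + r v) /\
  exists2 k : R, 0 < k & forall w, `|r w|%:C <= k%:C * `|w|.

Lemma real_form_Re : real_form (fun z : C => complex.Re z : R).
Proof.
split; first by move=> a [u1 u2] [v1 v2]; rewrite /GRing.scale /=; simpc.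
by exists 1 => // w; rewrite mul1r; exact: Re_le_norm.
Qed.

Lemma real_form_Im : real_form (fun z : C => complex.Im z : R).
Proof.
split; first by move=> a [u1 u2] [v1 v2]; rewrite /GRing.scale /=; simpc.
by exists 1 => // w; rewrite mul1r; exact: Im_le_norm.
Qed.

(** The bounds of [j] and [r] change the error term by a constant factor only. *)
Lemma diff_real (V : normedModType R) (V' W : normedModType R[i])
    (W' : normedModType R) (j : V -> V') (r : W -> W') (F : V' -> W) p x :
  real_linear j -> real_form r -> differentiable F (p + j x) ->
  is_diff x (fun y => r (F (p + j y))) (fun h => r ('d F (p + j x) (j h))).
Proof.
move=> [jL [k k0 jk]] [rL [k' k'0 rk]] dF; set q := p + j x.
have [c c0 dFc] := linear_lipschitz (diff_continuous dF).
have [c' c'0 cE] := pos_cplx c0.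
pose Lf h := r ('d F q (j h)).
have LL : linear Lf by move=> a u v; rewrite /Lf jL linearPZ rL.
pose L : {linear V -> W'} := HB.pack Lf (GRing.isLinear.Build _ _ _ _ _ LL).
have Lk h : `|L h| <= k' * c' * k * `|h|.
  rewrite -lecR; apply: le_trans (rk _) _.
  rewrite -!mulrA rmorphM /= ler_wpM2l ?lecR ?(ltW k'0) //.
  apply: le_trans (dFc _) _; rewrite cE rmorphM /= ler_wpM2l ?lecR ?(ltW c'0) //.
have K0 : 0 < k' * c' * k by rewrite !mulr_gt0.
have Lc : continuous L.
  apply: uniform_continuous => e e0; exists (e / (k' * c' * k)).
    exact: divr_gt0.
  move=> u v uv; rewrite -linearB; apply: le_lt_trans (Lk _) _.
  by rewrite mulrC -ltr_pdivlMr.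
suff H : is_diff x (fun y => r (F (p + j y))) L by exact: H.
have jB u v : j (u + v) = j u + j v by rewrite -[u]scale1r jL !scale1r.
have rB u v : r (u - v) = r u - r v.
  have r0 : r 0 = 0.
    have := rL 1 0 0; rewrite !scale1r addr0 => /eqP.
    by rewrite addrC -subr_eq subrr => /eqP.
  have := rL (-1) v u; rewrite rmorphN1 !scaleN1r addrC => ->.
  by rewrite addrC.
apply: is_diff_eps => // e e0.
have eC : 0 < (e / (k' * k))%:C :> C by rewrite ltcR divr_gt0 ?mulr_gt0.
have /nbhs_ballP[_ /pos_cplx[del del0 ->] Fdel] := diff_eps dF eC.
apply/nbhs_ballP; exists (del / k); first exact: divr_gt0.
move=> h; rewrite -ball_normE /= sub0r normrN => hdel.
have jh : ball 0 del%:C (j h).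
  rewrite -ball_normE /= sub0r normrN; apply: le_lt_trans (jk _) _.
  by rewrite ltcR mulrC -ltr_pdivlMr.
have := Fdel _ jh; rewrite -/q => Fh.
have -> : p + j (h + x) = j h + q by rewrite /q jB addrCA.
rewrite -rB /L /= /Lf -rB -lecR; apply: le_trans (rk _) _.
apply: le_trans (_ : k'%:C * ((e / (k' * k))%:C * `|j h|) <= _).
  by rewrite ler_wpM2l // lecR ltW.
apply: le_trans (_ : k'%:C * ((e / (k' * k))%:C * (k * `|h|)%:C) <= _).
  rewrite ler_wpM2l ?lecR ?(ltW k'0) // ler_wpM2l ?jk // ?lecR.
  by rewrite ltW // divr_gt0 ?mulr_gt0.
rewrite -!rmorphM lecR le_eqVlt; apply/orP; left; apply/eqP.
by field; rewrite !gt_eqF.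
Qed.

(** The mean value theorem for the real and the imaginary part; they may take
    their mean values at different points, whence the factor 2. *)
Lemma complex_mvt (V : normedModType R[i]) (f : V -> C) z k (c B : C) :
  (forall t : R, 0 <= t <= 1 -> differentiable f (z + (t%:C : C) *: k)) ->
  (forall t : R, 0 <= t <= 1 -> `|'d f (z + (t%:C : C) *: k) k - c| <= B) ->
  `|f (z + k) - f z - c| <= 2 * B.
Proof.
move=> df dB.
pose j (t : R) : V := (t%:C : C) *: k.
have jL : real_linear j.
  split; first by move=> a u v; rewrite /j rmorphD rmorphM /= scalerDl scalerA.
  have /ge0_cplx[n n0 nE] : 0 <= `|k| by [].
  exists (n + 1); first by rewrite ltr_wpDl.
  move=> h; rewrite normrZ normc_real nE -rmorphM lecR mulrC.
  by rewrite ler_wpM2r // lerDl.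
have B0 : 0 <= B by apply: le_trans (dB 0 _); rewrite ?lexx ?ler01.
have [b b0 bE] := ge0_cplx B0.
have part (r : C -> R) : real_form r ->
    (forall w, `|r w|%:C <= `|w|) -> `|r (f (z + k) - f z - c)| <= b.
  move=> rf r1.
  have rD (u v : C) (a : R) : r (u - a%:C * v) = r u - a * r v.
    by rewrite addrC -mulNr -rmorphN rf.1 addrC; congr (_ + _); exact: mulNr.
  have rB (u v : C) : r (u - v) = r u - r v.
    by have := rD u v 1; rewrite !mul1r.
  have du (t : R) : 0 <= t <= 1 -> is_derive t (1 : R)
      (fun t => r (f (z + j t)) - t * r c) (r ('d f (z + j t) k - c)).
    move=> t01.
    have [d1 d2] := diff_real jL rf (df t t01).
    have -> : r ('d f (z + j t) k - c) = r ('d f (z + j t) (j 1)) - 1 * r c.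
      by rewrite rB /j scale1r mul1r.
    apply: is_deriveB.
      apply: DeriveDef; first exact: diff_derivable.
      by rewrite deriveE // d2.
    have -> : 1 * r c = t *: (0 : R) + r c *: (1 : R).
      by rewrite scaler0 add0r mul1r; exact/esym/mulr1.
    exact: (@is_deriveM _ _ (fun t : R => t) (fun=> r c)).
  have uc : {within `[0, 1], continuous (fun t => r (f (z + j t)) - t * r c)}.
    apply: derivable_within_continuous => t; rewrite in_itv /= => t01.
    by have [] := du t t01.
  have duo : forall t : R, t \in `]0, 1[%R -> is_derive t (1 : R)
      (fun t => r (f (z + j t)) - t * r c) ((fun t => r ('d f (z + j t) k - c)) t).
    move=> t; rewrite in_itv /= => /andP[t0 t1]; apply: du.
    by rewrite !ltW.
  have [t] := MVT_segment ler01 duo uc; rewrite in_itv /= => t01.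
  rewrite subr0 mulr1 mul1r mul0r subr0 /j scale1r scale0r addr0 => E.
  rewrite rB rB addrAC E -lecR -bE; apply: le_trans (dB t t01); exact: r1.
set w := f (z + k) - f z - c.
have := normc_le_ReIm (complex.Re w) (complex.Im w).
rewrite (_ : _ +i* _ = w); last by case: (w).
move=> /le_trans; apply; rewrite bE -(rmorph_nat (real_complex R)) -rmorphM lecR.
rewrite mulr_natl mulr2n; apply: lerD; apply: part.
- exact: real_form_Re.
- exact: Re_le_norm.
- exact: real_form_Im.
- exact: Im_le_norm.
Qed.

End Bridge.

(** * Cauchy's formula and derivatives of holomorphic maps *)

Lemma continuous_at_eps (K K' : numFieldType) (V : normedModType K)
    (W : normedModType K') (f : V -> W) x :
  (forall e : K', 0 < e -> exists2 d : K, 0 < d &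
     forall y, `|x - y| < d -> `|f x - f y| <= e) -> {for x, continuous f}.
Proof.
move=> fe; apply/cvgrPdist_le => e /fe[d d0 fd].
by apply/nbhs_ballP; exists d => // y; rewrite -ball_normE; exact: fd.
Qed.

Section ComplexExponential.
Variable R : realType.
Notation C := (Num.NumField.sort R[i]).

Definition cexp (z : C) : C := (expR (complex.Re z))%:C * expi (complex.Im z).

Lemma cexpD z w : cexp (z + w) = cexp z * cexp w.
Proof. by rewrite /cexp !raddfD /= expRD expiD rmorphM /=; ring. Qed.

Lemma norm_expi (t : R) : `|expi t| = 1.
Proof. by rewrite normc_def /= cos2Dsin2 sqrtr1. Qed.

Lemma expi_neq0 (t : R) : expi t != 0.
Proof. by rewrite -normr_eq0 norm_expi oner_neq0. Qed.

Lemma norm_cexp z : `|cexp z| = (expR (complex.Re z))%:C.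
Proof. by rewrite normrM norm_expi mulr1 normc_real ger0_norm // expR_ge0. Qed.

Lemma cexp_neq0 z : cexp z != 0.
Proof. by rewrite -normr_eq0 norm_cexp eq_complex /= eqxx andbT gt_eqF // expR_gt0. Qed.

Lemma derive_eps (F : R -> R) d : is_derive (0 : R) (1 : R) F d ->
  forall e, 0 < e -> \forall t \near (0 : R), `|F t - F 0 - t * d| <= e * `|t|.
Proof.
move=> [dF <-] e e0; have dF' : differentiable F 0 by exact/derivable1_diffP.
have := diff_eps dF' e0; apply: filterS => t; rewrite addr0.
rewrite deriveE // (_ : 'd F 0 t = t * 'd F 0 1) //.
by rewrite -[t in LHS]mulr1 linearZ.
Qed.

(** The error is [e] for the real exponential, [e] for the mixed term, and
    [2 * (e + e)] for the cosine and the sine multiplied by [exp (Re h) <= 2]. *)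
Lemma cexp_near0 (e : R) : 0 < e <= 1 -> exists2 del : R, 0 < del &
  forall h : C, `|h| < del%:C -> `|cexp h - 1 - h| <= (6 * e)%:C * `|h|.
Proof.
move=> /andP[e0 e1].
have E := derive_eps (is_derive_expR 0) e0.
have S := derive_eps (is_derive_sin 0) e0.
have Co := derive_eps (is_derive_cos 0) e0.
have /nbhs_ballP[r /= r0 rP] : \forall t \near (0 : R), [/\ `|expR t - 1 - t| <= e * `|t|,
   `|sin t - t| <= e * `|t| & `|cos t - 1| <= e * `|t|].
  near=> t; split.
  - have : `|expR t - expR 0 - t * expR 0| <= e * `|t| by near: t; exact: E.
    by rewrite expR0 mulr1.
  - have : `|sin t - sin 0 - t * cos 0| <= e * `|t| by near: t; exact: S.
    by rewrite sin0 cos0 mulr1 subr0.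
  - have : `|cos t - cos 0 - t * - sin 0| <= e * `|t| by near: t; exact: Co.
    by rewrite sin0 cos0 oppr0 mulr0 subr0.
exists (Num.min r (e / 2)).
  by rewrite lt_min r0 divr_gt0.
move=> h; have /ge0_cplx[n n0 nE] : 0 <= `|h| by [].
rewrite nE ltcR lt_min => /andP[nr ne].
case: h nE => s t nE.
have sn : `|s| <= n by rewrite -lecR -nE; exact: (Re_le_norm (s +i* t)).
have tn : `|t| <= n by rewrite -lecR -nE; exact: (Im_le_norm (s +i* t)).
have [|Es _ _] := rP s.
  by rewrite -ball_normE /= sub0r normrN (le_lt_trans sn).
have [|_ St Ct] := rP t.
  by rewrite -ball_normE /= sub0r normrN (le_lt_trans tn).
have -> : cexp (s +i* t) - 1 - (s +i* t) =
    (expR s)%:C * ((cos t - 1) +i* (sin t - t)) + (expR s - 1 - s)%:C +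
    (0 +i* ((expR s - 1) * t)).
  by rewrite /cexp /expi; simpc; congr (_ +i* _); ring.
have Es1 : `|expR s - 1| <= 2 * n.
  have -> : expR s - 1 = (expR s - 1 - s) + s by ring.
  apply: le_trans (ler_normD _ _) _.
  have : e * `|s| <= n by apply: le_trans sn; rewrite ler_piMl.
  by move: Es sn; lra.
have Es2 : `|expR s| <= 2.
  have -> : expR s = (expR s - 1) + 1 by ring.
  apply: le_trans (ler_normD _ _) _; rewrite normr1.
  by move: Es1 ne e1; lra.
have p1 : `|(expR s)%:C * ((cos t - 1) +i* (sin t - t))| <= (2 * (e * n + e * n))%:C.
  rewrite normrM normc_real rmorphM; apply: ler_pM; [by rewrite lecR|exact: normr_ge0|by rewrite lecR|].
  apply: le_trans (normc_le_ReIm _ _) _; rewrite lecR; apply: lerD.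
    by apply: le_trans Ct _; rewrite ler_wpM2l // ltW.
  by apply: le_trans St _; rewrite ler_wpM2l // ltW.
have p2 : `|(expR s - 1 - s)%:C| <= (e * n)%:C.
  by rewrite normc_real lecR; apply: le_trans Es _; rewrite ler_wpM2l // ltW.
have p3 : `|0 +i* ((expR s - 1) * t)| <= (e * n)%:C.
  apply: le_trans (normc_le_ReIm _ _) _; rewrite normr0 add0r lecR normrM.
  apply: ler_pM => //; apply: le_trans Es1 _; move: ne; lra.
rewrite -rmorphM; apply: le_trans (ler_normD _ _) _.
apply: le_trans (lerD (ler_normD _ _) (lexx _)) _.
apply: le_trans (lerD (lerD p1 p2) p3) _.
by rewrite -!rmorphD lecR; lra.
Unshelve. all: by end_near. Qed.

Lemma differentiable_cexp z : differentiable cexp z.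
Proof.
pose Lf (h : C) : C := cexp z * h.
have LL : linear Lf by move=> a u v; rewrite /Lf mulrDr !scalerAr.
pose L : {linear C -> C} := HB.pack Lf (GRing.isLinear.Build _ _ _ _ _ LL).
have Lc : continuous L.
  apply: (cont_mul (@cont_cst _ _ (cexp z))) => x; exact: cvg_id.
suff [] : is_diff z cexp L by [].
apply: (@is_diff_eps _ _ _ cexp L z Lc) => _ /pos_cplx[e e0 ->].
set m := expR (complex.Re z); have m0 : 0 < m by exact: expR_gt0.
pose e' := Num.min 1 (e / (6 * m)).
have e'0 : 0 < e' <= 1.
  by rewrite lt_min ltr01 ge_min lexx /= divr_gt0 ?mulr_gt0.
have [del del0 cdel] := cexp_near0 e'0.
apply/nbhs_ballP; exists del%:C; first by rewrite /= ltcR.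
move=> h; rewrite -ball_normE /= sub0r normrN => /cdel hdel.
rewrite (_ : _ - _ = cexp z * (cexp h - 1 - h)); last first.
  transitivity (cexp (h + z) - cexp z - cexp z * h); first by [].
  by rewrite [h + z]addrC cexpD; ring.
rewrite normrM norm_cexp -/m; apply: le_trans (ler_wpM2l _ hdel) _.
  by rewrite lecR ltW.
rewrite mulrA -rmorphM ler_wpM2r // lecR.
have : e' <= e / (6 * m) by rewrite ge_min lexx orbT.
rewrite ler_pdivlMr ?mulr_gt0 // (_ : e' * (6 * m) = m * (6 * e')) //; ring.
Qed.

End ComplexExponential.
Arguments cexp {R} z.

Section MeanValue.
Variable R : realType.
Notation C := (Num.NumField.sort R[i]).

(** Cutting off the real part extends a function on a half-plane to a continuous
    function on the plane, for which line integrals are defined. *)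
Lemma cont_clamp (a : R) :
  continuous (fun z : C => (Num.min (complex.Re z) a) +i* (complex.Im z) : C).
Proof.
apply: (@uniform_continuous R[i] R[i] R[i]^o R[i]^o) => _ /pos_cplx[e e0 ->].
exists (e / 2)%:C; first by rewrite ltcR divr_gt0.
move=> z w zw; rewrite (_ : _ - _ =
  (Num.min (complex.Re z) a - Num.min (complex.Re w) a) +i* (complex.Im z - complex.Im w)) //.
have zr : `|complex.Re z - complex.Re w| < e / 2.
  by rewrite -ltcR -raddfB; apply: le_lt_trans zw; exact: Re_le_norm.
have zi : `|complex.Im z - complex.Im w| < e / 2.
  by rewrite -ltcR -raddfB; apply: le_lt_trans zw; exact: Im_le_norm.
apply: le_lt_trans (normc_le_ReIm _ _) _; rewrite ltcR [ltRHS]splitr.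
apply: ltrD => //; apply: le_lt_trans zr.
move: (complex.Re z) (complex.Re w) => x y.
by case: (leP x a); case: (leP y a) => ? ?; case: (ger0P (x - y)) => ?;
  (try (rewrite ler_norml; apply/andP; split)); lra.
Qed.

(** Goursat's theorem for [phi \o cexp] on a rectangle of height 2 pi: the
    horizontal sides cancel by periodicity, so the mean over a circle does not
    depend on its radius, and it tends to [phi 0] with the radius. *)
Lemma mean_value (phi : C -> C) : {for 0, continuous phi} ->
  (forall w, w != 0 -> `|w| <= 2 -> differentiable phi w) ->
  integ 0 (pi *+ 2) (fun t => phi (expi t)) = phi 0 * (pi *+ 2)%:C.
Proof.
move=> phi0 dphi.
pose clamp (z : C) : C := (Num.min (complex.Re z) (ln 2)) +i* (complex.Im z).
pose G z := phi (cexp (clamp z)).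
have P0 : 0 <= (pi *+ 2 : R) by rewrite mulrn_wge0 // pi_ge0.
have ln2 : 0 < ln (2 : R) by rewrite ln_gt0 // ltr1n.
have le2 z : `|cexp (clamp z)| <= 2.
  rewrite norm_cexp /= -(rmorph_nat (real_complex R)) lecR.
  by rewrite -[leRHS]lnK ?posrE // ler_expR ge_min lexx orbT.
have phic w : w != 0 -> `|w| <= 2 -> {for w, continuous phi}.
  by move=> w0 w2; apply: differentiable_continuous; exact: dphi.
have Gc : continuous G.
  have cexpc : continuous (@cexp R).
    by move=> z; apply: differentiable_continuous; exact: differentiable_cexp.
  have ec := cont_comp (@cont_clamp (ln 2)) cexpc.
  move=> z; apply: (continuous_comp (ec z)).
  exact: phic (cexp_neq0 _) (le2 z).
have clampE (s t : R) : s <= 0 -> clamp (s +i* t) = s +i* t.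
  by move=> s0; rewrite /clamp /= min_l // ltW // (le_lt_trans s0).
have V (s : R) : s <= 0 -> integ 0 (pi *+ 2) (fun t => phi (expi t)) =
    integ 0 (pi *+ 2) (fun t => phi ((expR s)%:C * expi t)).
  move=> s0.
  have dG (x y : R) : s <= x <= 0 -> 0 <= y <= pi *+ 2 -> differentiable G (x +i* y : C).
    move=> /andP[_ x0] _; set z : C := x +i* y.
    have near_z : \forall w \near z, (phi \o cexp) w = G w.
      have zl : complex.Re z < ln 2 by apply: le_lt_trans ln2.
      have wln : \forall w \near z, complex.Re (w : C) < ln 2.
        exact: (cvgr_lt _ (@continuous_Re R z)).
      apply: filterS wln => -[w1 w2] /= /ltW wl.
      by rewrite /G /clamp /= min_l.
    apply: near_eq_differentiable near_z _.
    apply: differentiable_comp; first exact: differentiable_cexp.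
    apply: dphi; first exact: cexp_neq0.
    by have := le2 z; rewrite clampE.
  have := goursat Gc s0 P0 dG; rewrite /rint.
  have -> : (fun x : R => G (x +i* 0)) = (fun x => G (x +i* (pi *+ 2))).
    apply/funext => x; rewrite /G; congr phi; rewrite /cexp /clamp /= /expi.
    by rewrite cos2pi sin2pi cos0 sin0.
  set A := integ s 0 _; set B0 := integ 0 _ (fun t => G (0 +i* t)).
  set Bs := integ 0 _ (fun t => G (s +i* t)) => E.
  have {E} : im R * (B0 - Bs) = 0 by rewrite -[RHS]E; ring.
  rewrite /B0 /Bs => /eqP; rewrite mulf_eq0 => /orP[|].
    by rewrite eq_complex /= oner_eq0 andbF.
  rewrite subr_eq0 => /eqP.
  have GE (x : R) : x <= 0 -> (fun t : R => G (x +i* t)) =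
      (fun t => phi ((expR x)%:C * expi t)).
    by move=> x0; apply/funext => t; rewrite /G clampE.
  rewrite (GE 0 (lexx _)) (GE s s0) => <-.
  suff -> : (fun t => phi ((expR 0)%:C * expi t)) = (fun t => phi (expi t)) by [].
  by apply/funext => t; rewrite expR0 mul1r.
apply/eqP; rewrite -subr_eq0 -normr_le0.
have /ge0_cplx[r r0 rE] : 0 <= `|integ 0 (pi *+ 2) (fun t => phi (expi t)) - phi 0 * (pi *+ 2)%:C| by [].
rewrite rE (_ : 0 = 0%:C) // lecR leNgt; apply/negP => rpos.
set P := (pi *+ 2 : R) in P0 V rE *.
pose e := r / (4 * (P + 1)).
have P1 : 0 < P + 1 by rewrite ltr_wpDl.
have e0 : 0 < e by rewrite divr_gt0 // mulr_gt0.
have eC : 0 < e%:C :> C by rewrite ltcR.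
have /cvgrPdist_lt /(_ _ eC) /nbhs_ballP[_ /pos_cplx[del del0 ->] phidel] := phi0.
pose s := Num.min 0 (ln (del / 2)).
have s0 : s <= 0 by rewrite ge_min lexx.
have sdel : expR s < del.
  apply: le_lt_trans (_ : del / 2 < _); last by lra.
  have d2 : 0 < del / 2 by rewrite divr_gt0.
  by rewrite -[leRHS]lnK ?posrE // ler_expR ge_min lexx orbT.
have fc : continuous (fun t : R => phi ((expR s)%:C * expi t)).
  move=> t; have := cont_comp (@cont_vline R s) Gc.
  by move=> /(_ t); rewrite /G; under eq_fun do rewrite clampE //.
have := integ_bound P0 (cont_sub fc (@cont_cst _ _ (phi 0))) (M := e%:C).
rewrite (integ_sub _ _ fc (@cont_cst _ _ (phi 0))) integ_cst subr0 -V // rE.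
have bnd (x : R) : 0 <= x <= P -> `|phi ((expR s)%:C * expi x) - phi 0| <= e%:C.
  move=> _; rewrite distrC; apply/ltW; apply: phidel.
  rewrite -ball_normE /= sub0r normrN normrM norm_expi mulr1 normc_real.
  by rewrite ger0_norm ?expR_ge0 // ltcR.
move=> /(_ bnd); rewrite -(rmorph_nat (real_complex R)) -!rmorphM lecR.
apply/negP; rewrite -ltNge /e mulrA mulrAC ltr_pdivrMr ?mulr_gt0 //.
have : 0 <= r * P by rewrite mulr_ge0.
lra.
Qed.

(** Cauchy's formula for the derivative, from the mean value property of the
    difference quotient. *)
Lemma cauchy_deriv (V : normedModType R[i]) (f : V -> C) z h :
  (forall w : C, `|w| <= 2 -> differentiable f (z + w *: h)) ->
  integ 0 (pi *+ 2) (fun t => (f (z + expi t *: h) - f z) * (expi t)^-1) =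
  'd f z h * (pi *+ 2)%:C.
Proof.
move=> df.
have df0 : differentiable f z by have := df 0; rewrite scale0r addr0 normr0; apply.
pose phi w := if w == 0 then 'd f z h else (f (z + w *: h) - f z) * w^-1.
have phi0 : phi 0 = 'd f z h by rewrite /phi eqxx.
rewrite -phi0 -mean_value.
- by congr integ; apply/funext => t; rewrite /phi (negPf (expi_neq0 t)).
- apply: (@continuous_at_eps R[i] R[i] R[i]^o R[i]^o) => e e0; rewrite phi0.
  have eh : 0 < e / (`|h| + 1) by rewrite divr_gt0 // ltr_wpDl.
  have /nbhs_ballP[d /= d0 fd] := diff_eps df0 eh.
  exists (d / (`|h| + 1)); first by rewrite divr_gt0 // ltr_wpDl.
  move=> w; rewrite sub0r normrN => wd.
  rewrite /phi; case: eqVneq => [_|w0]; first by rewrite subrr normr0 ltW.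
  have := fd (w *: h); rewrite -ball_normE /= sub0r normrN normrZ => /(_ _) H.
  rewrite distrC (_ : _ - _ = (f (w *: h + z) - f z - 'd f z (w *: h)) * w^-1); last first.
    have -> : 'd f z (w *: h) = w * 'd f z h by exact: linearZ.
    by rewrite [w *: h + z]addrC [RHS]mulrBl [w * _]mulrC mulfK.
  rewrite normrM normfV ler_pdivrMr ?normr_gt0 //; apply: le_trans (H _) _.
    apply: le_lt_trans (_ : `|w| * (`|h| + 1) < _); first by rewrite ler_wpM2l // lerDl.
    by rewrite -ltr_pdivlMr // ltr_wpDl.
  rewrite mulrCA mulrC ler_wpM2r // mulrAC ler_pdivrMr ?ltr_wpDl //.
  by rewrite ler_wpM2l ?(ltW e0) // lerDl.
- move=> w w0 w2.
  have nw : \forall y \near w, (y : C) != 0.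
    apply/nbhs_ballP; exists `|w|; first by rewrite /= normr_gt0.
    move=> y; rewrite -ball_normE /=; apply: contraTneq => ->.
    by rewrite subr0 ltxx.
  have E : \forall y \near w, (f (z + y *: h) - f z) * y^-1 = phi y.
    by apply: filterS nw => y y0; rewrite /phi (negPf y0).
  apply: near_eq_differentiable E _.
  apply: differentiableM; last exact: differentiable_Rinv.
  apply: differentiableB => //.
  apply: (@differentiable_comp _ _ _ _ (fun y : C => z + y *: h) f); last exact: df.
  apply: (@differentiableD _ _ _ (fun=> z) (fun y : C => y *: h)) => //.
Qed.

End MeanValue.

(** The estimates below hold on balls of decreasing radii, from [8 * d] down to
    [d], as each of them uses the previous one on circles or segments of radius
    [d]. *)
Section Analytic.
Variable R : realType.
Notation C := (Num.NumField.sort R[i]).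
Variables (V : normedModType R[i]) (f : V -> C) (x0 : V) (d M : C).
Hypotheses (d0 : 0 < d)
  (df : forall y, `|y - x0| < 8 * d -> differentiable f y)
  (fM : forall y, `|y - x0| < 8 * d -> `|f y| <= M).

Let P : C := (pi *+ 2)%:C.

Lemma P_gt0 : 0 < P.
Proof. by rewrite ltcR mulrn_wgt0 // pi_gt0. Qed.

Let M0 : 0 <= M.
Proof. by apply: le_trans (fM (y := x0) _); rewrite ?subrr ?normr0 ?mulr_gt0. Qed.

Lemma scale_bound (T : V -> C) (B : C) : (forall a h, T (a *: h) = a * T h) ->
  (forall h, `|h| <= d -> `|T h| <= B) -> forall h, `|T h| <= B / d * `|h|.
Proof.
move=> TZ TB h; have [->|h0] := eqVneq h 0.
  by have := TZ 0 0; rewrite scale0r mul0r => ->; rewrite !normr0 mulr0.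
have nh : 0 < `|h| by rewrite normr_gt0.
have := TB ((d / `|h|) *: h).
have nd : `|d / `|h| | = d / `|h| by rewrite ger0_norm // divr_ge0 // ltW.
rewrite normrZ TZ (normrM (d / `|h|)) nd divfK ?gt_eqF //.
move=> /(_ (lexx _)); rewrite mulrC mulrA ler_pdivrMr // => H.
by rewrite mulrAC ler_pdivlMr.
Qed.

Lemma near_point z h (r s : C) (w : C) : `|z - x0| < r * d -> `|h| <= s * d ->
  `|w| <= 1 -> `|z + w *: h - x0| < (r + s) * d.
Proof.
move=> zr hs w1; rewrite addrAC mulrDl; apply: le_lt_trans (ler_normD _ _) _.
apply: ltr_leD => //; rewrite normrZ; apply: le_trans hs.
by rewrite ler_piMl.
Qed.

Let C0 z h := fun t : R => (f (z + expi t *: h) - f z) * (expi t)^-1.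

Lemma expi_norm1 (t : R) : `|(expi t : C)| <= 1.
Proof. by rewrite norm_expi. Qed.

Lemma continuous_expi : continuous (fun t : R => expi t : C).
Proof.
have c : continuous (fun t : R => t *i : C) by exact: cont_vline.
have cexpc : continuous (@cexp R).
  by move=> z; apply: differentiable_continuous; exact: differentiable_cexp.
have := cont_comp c cexpc.
suff -> : (fun t : R => cexp (t *i)) = (fun t : R => expi t : C) by [].
by apply/funext => t; rewrite /cexp /= expR0 mul1r.
Qed.

Lemma continuous_expiV : continuous (fun t : R => (expi t : C)^-1).
Proof.
move=> t; apply: (@cvgV R[i]); first exact: expi_neq0.
exact: continuous_expi.
Qed.

Lemma continuous_circle (g : V -> C) z h :
  (forall t : R, {for z + (expi t : C) *: h, continuous g}) ->
  continuous (fun t : R => g (z + (expi t : C) *: h)).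
Proof.
move=> gc t; apply: (@continuous_comp _ _ _ (fun t => z + (expi t : C) *: h) g).
  apply: cvgD; first exact: cvg_cst.
  by apply: cvgZr_tmp; exact: continuous_expi.
exact: gc.
Qed.

Lemma circleE z h : `|z - x0| < 6 * d -> `|h| <= d ->
  'd f z h = integ 0 (pi *+ 2) (C0 z h) / P.
Proof.
move=> zd hd; rewrite /C0 cauchy_deriv ?mulfK ?gt_eqF ?P_gt0 // => w w2; apply: df.
have := @near_point z (2 *: h) 6 2 (w / 2) zd.
rewrite scalerA divfK // -natrD; apply.
  by rewrite normrZ normr_nat ler_wpM2l.
by rewrite normf_div normr_nat ler_pdivrMr // mul1r.
Qed.

Lemma circle_cont z h : `|z - x0| < 6 * d -> `|h| <= d -> continuous (C0 z h).
Proof.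
move=> zd hd; apply: cont_mul continuous_expiV.
apply: cont_sub (@cont_cst _ _ (f z)); apply: continuous_circle => t.
apply: differentiable_continuous; apply: df.
apply: lt_trans (near_point (s := 1) zd _ (expi_norm1 t)) _; first by rewrite mul1r.
by rewrite ltr_pM2r // -(natrD _ 6 1) ltr_nat.
Qed.

Let B := 4 * M / d.

Let B0 : 0 <= B.
Proof. by rewrite divr_ge0 ?mulr_ge0 // ltW. Qed.

Lemma integ_circle_bound (g : R -> C) (N : C) : continuous g ->
  (forall t, `|g t| <= N) -> `|integ 0 (pi *+ 2) g / P| <= 2 * N.
Proof.
move=> gc gN; rewrite normrM normfV (gtr0_norm P_gt0) ler_pdivrMr ?P_gt0 //.
have P0 : 0 <= (pi *+ 2 : R) by rewrite mulrn_wge0 // pi_ge0.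
by have := integ_bound P0 gc (fun t _ => gN t); rewrite subr0.
Qed.

Lemma in_disc (r s : C) y : `|y - x0| < r * d -> r <= s -> `|y - x0| < s * d.
Proof. by move=> yr rs; apply: lt_le_trans yr _; rewrite ler_pM2r. Qed.

Lemma circle_pt z h (r : C) (t : R) : `|z - x0| < r * d -> `|h| <= d ->
  `|z + (expi t : C) *: h - x0| < (r + 1) * d.
Proof. by move=> zr hd; apply: near_point => //; [rewrite mul1r|rewrite norm_expi]. Qed.

(** Cauchy's estimate on the circle [z + e^(it) h]. *)
Lemma deriv_bound z h : `|z - x0| < 6 * d -> `|'d f z h| <= B * `|h|.
Proof.
move=> zd; apply: scale_bound => [a k|{}h hd]; first exact: linearZ.
rewrite circleE //.
have -> : 4 * M = 2 * (M + M) by ring.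
apply: integ_circle_bound; first exact: circle_cont.
move=> t; rewrite normrM normfV norm_expi invr1 mulr1.
apply: le_trans (ler_normB _ _) _; apply: lerD; apply: fM.
  by apply: in_disc (circle_pt t zd hd) _; rewrite -(natrD _ 6 1) ler_nat.
by apply: in_disc zd _; rewrite ler_nat.
Qed.

Lemma segment_pt z k (r : C) (t : R) : `|z - x0| < r * d -> `|k| <= d ->
  0 <= t <= 1 -> `|z + (t%:C : C) *: k - x0| < (r + 1) * d.
Proof.
move=> zr kd /andP[t0 t1]; apply: near_point => //; first by rewrite mul1r.
by rewrite normc_real lecR ger0_norm.
Qed.

(** By [complex_mvt] and [deriv_bound]. *)
Lemma lip_bound z k : `|z - x0| < 5 * d -> `|k| <= d ->
  `|f (z + k) - f z| <= 2 * (B * `|k|).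
Proof.
move=> zd kd; rewrite -[X in `|X|]subr0; apply: complex_mvt => t t01.
  apply: df; apply: in_disc (segment_pt zd kd t01) _.
  by rewrite -(natrD _ 5 1) ler_nat.
rewrite subr0; apply: deriv_bound; apply: in_disc (segment_pt zd kd t01) _.
by rewrite -(natrD _ 5 1) ler_nat.
Qed.

Lemma shift_pt z k (r : C) : `|z - x0| < r * d -> `|k| <= d ->
  `|z + k - x0| < (r + 1) * d.
Proof.
move=> zr kd; have := @near_point z k r 1 1 zr; rewrite scale1r mul1r normr1.
exact.
Qed.

(** Cauchy's formula for the difference of the derivatives at two points, with the
    Lipschitz bound of [f] on the circles. *)
Lemma deriv_lip z k h : `|z - x0| < 3 * d -> `|k| <= d ->
  `|'d f (z + k) h - 'd f z h| <= 8 * (B * `|k|) / d * `|h|.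
Proof.
move=> zd kd.
apply: (@scale_bound (fun h => 'd f (z + k) h - 'd f z h)) => [a l|{}h hd].
  have E y : 'd f y (a *: l) = a * 'd f y l by exact: linearZ.
  by rewrite !E [RHS]mulrBr.
have zd6 : `|z - x0| < 6 * d by apply: in_disc zd _; rewrite ler_nat.
have zkd : `|z + k - x0| < 6 * d.
  by apply: in_disc (shift_pt zd kd) _; rewrite -(natrD _ 3 1) ler_nat.
rewrite !circleE // -mulrBl -(integ_sub _ _ (circle_cont zkd hd) (circle_cont zd6 hd)).
have -> : 8 * (B * `|k|) = 2 * (2 * (B * `|k|) + 2 * (B * `|k|)) by ring.
apply: integ_circle_bound.
  exact: (cont_sub (circle_cont zkd hd) (circle_cont zd6 hd)).
move=> t; rewrite /C0 -mulrBl normrM normfV norm_expi invr1 mulr1.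
rewrite (_ : _ - _ = (f (z + (expi t : C) *: h + k) - f (z + (expi t : C) *: h)) - (f (z + k) - f z)).
  apply: le_trans (ler_normB _ _) _; apply: lerD; apply: lip_bound => //.
    by apply: in_disc (circle_pt t zd hd) _; rewrite -(natrD _ 3 1) ler_nat.
  by apply: in_disc zd _; rewrite ler_nat.
by rewrite (addrAC z k); ring.
Qed.

(** The Lipschitz bound on the derivative along the segment from [z] to [z + k]. *)
Lemma taylor_bound z k : `|z - x0| < 2 * d -> `|k| <= d ->
  `|f (z + k) - f z - 'd f z k| <= 2 * (8 * (B * `|k|) / d * `|k|).
Proof.
move=> zd kd; apply: complex_mvt => t t01.
  apply: df; apply: in_disc (segment_pt zd kd t01) _.
  by rewrite -(natrD _ 2 1) ler_nat.
have tk : `|(t%:C : C) *: k| <= `|k|.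
  move/andP: t01 => [t0 t1].
  by rewrite normrZ normc_real ger0_norm // ler_piMl // lecR.
apply: le_trans (deriv_lip k _ (le_trans tk kd)) _.
  by apply: in_disc zd _; rewrite ler_nat.
rewrite ler_wpM2r // ler_pM2r ?invr_gt0 // ler_wpM2l // ler_wpM2l //.
Qed.

Lemma deriv_continuous z k : `|z - x0| < 3 * d -> {for z, continuous (fun y => 'd f y k)}.
Proof.
move=> zd; apply: (@continuous_at_eps R[i] R[i] V R[i]^o) => e e0.
pose K := 8 * B / d * `|k|.
have K0 : 0 <= K by rewrite !mulr_ge0 // invr_ge0 ltW.
exists (Num.min d (e / (K + 1))).
  by rewrite comparable_lt_min ?d0 ?divr_gt0 ?ltr_wpDl // real_comparable // gtr0_real // divr_gt0 // ltr_wpDl.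
move=> y.
rewrite comparable_lt_min; last by rewrite real_comparable // gtr0_real // divr_gt0 // ltr_wpDl.
move=> /andP[yd ye].
have yE : y = z + (y - z) by rewrite addrC subrK.
have nyz : `|y - z| = `|z - y| by rewrite distrC.
rewrite distrC yE; apply: le_trans (deriv_lip k zd _) _; first by rewrite nyz ltW.
rewrite nyz (_ : _ * _ = K * `|z - y|); last by rewrite /K; field; rewrite gt_eqF.
apply: le_trans (_ : K * (e / (K + 1)) <= _).
  by rewrite ler_wpM2l // ltW.
rewrite mulrCA ger_pMr // ler_pdivrMr ?ltr_wpDl // mul1r lerDl //.
Qed.

(** Cauchy's formula for ['d f y v] is differentiated under the integral: the
    Taylor estimate bounds the error uniformly on the circle. *)
Lemma deriv_differentiable_small v : `|v| <= d -> differentiable (fun y => 'd f y v) x0.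
Proof.
move=> vd.
have x00 (r : C) : 0 < r -> `|x0 - x0| < r * d.
  by move=> r0; rewrite subrr normr0 mulr_gt0.
have cp t : `|x0 + (expi t : C) *: v - x0| < 2 * d.
  by have := circle_pt t (x00 _ (ltr01 : 0 < (1 : C))) vd; rewrite -(natrD _ 1 1).
pose D k : R -> C := fun t : R => ('d f (x0 + (expi t : C) *: v) k - 'd f x0 k) * (expi t)^-1.
have Dc k : continuous (D k).
  apply: cont_mul continuous_expiV.
  apply: cont_sub (@cont_cst _ _ ('d f x0 k)); apply: (@continuous_circle (fun y => 'd f y k)) => t.
  by apply: deriv_continuous; apply: in_disc (cp t) _; rewrite ler_nat.
pose Lf k := integ 0 (pi *+ 2) (D k) / P.
have LL : linear Lf.
  move=> a u w; transitivity (a * Lf u + Lf w); last by [].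
  rewrite /Lf mulrA -mulrDl; congr (_ / _).
  have aDc : continuous (fun t : R => a * D u t : C) by exact: (cont_mul (@cont_cst _ _ a)).
  rewrite -(integ_scale _ _ a (Dc u)) -(integ_add _ _ aDc (Dc w)).
  congr integ; apply/funext => t; rewrite /D !linearP /= /GRing.scale /=; ring.
pose L : {linear V -> C} := HB.pack Lf (GRing.isLinear.Build _ _ _ _ _ LL).
have Lb k : `|Lf k| <= 4 * B * `|k|.
  have -> : 4 * B * `|k| = 2 * (B * `|k| + B * `|k|) by ring.
  apply: integ_circle_bound => // t; rewrite normrM normfV norm_expi invr1 mulr1.
  apply: le_trans (ler_normB _ _) _; apply: lerD; apply: deriv_bound.
    by apply: in_disc (cp t) _; rewrite ler_nat.
  exact: x00.
have B4 : 0 < 4 * B + 1 by rewrite ltr_wpDl // mulr_ge0.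
have Lc : continuous L.
  apply: (@uniform_continuous R[i] R[i] V R[i]^o) => e e0; exists (e / (4 * B + 1)).
    exact: divr_gt0.
  move=> u w uw; rewrite -linearB; apply: le_lt_trans (Lb _) _.
  apply: le_lt_trans (_ : (4 * B + 1) * `|u - w| < _).
    by rewrite ler_wpM2r // lerDl.
  by rewrite mulrC -ltr_pdivlMr.
suff [] : is_diff x0 (fun y => 'd f y v) L by [].
apply: (@is_diff_eps _ _ _ (fun y => 'd f y v) L x0 Lc) => e e0.
pose K := 64 * B / d.
have K0 : 0 <= K by rewrite !mulr_ge0 // invr_ge0 ltW.
have K1 : 0 < K + 1 by rewrite ltr_wpDl.
apply/nbhs_ballP; exists (Num.min d (e / (K + 1))).
  by rewrite /= comparable_lt_min ?d0 ?divr_gt0 // real_comparable // gtr0_real // divr_gt0.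
move=> k; rewrite -ball_normE /= sub0r normrN.
rewrite comparable_lt_min; last by rewrite real_comparable // gtr0_real // divr_gt0.
move=> /andP[/ltW kd ke].
have x6 : `|x0 - x0| < 6 * d by exact: x00.
have xk6 : `|x0 + k - x0| < 6 * d.
  apply: in_disc (shift_pt (x00 1 ltr01) kd) _.
  by rewrite -(natrD _ 1 1) ler_nat.
rewrite (addrC k) !circleE //.
rewrite (_ : _ - _ = integ 0 (pi *+ 2) (fun t => C0 (x0 + k) v t - C0 x0 v t - D k t) / P); last first.
  rewrite (integ_sub _ _ (cont_sub (circle_cont xk6 vd) (circle_cont x6 vd)) (Dc k)).
  by rewrite (integ_sub _ _ (circle_cont xk6 vd) (circle_cont x6 vd)) !mulrBl.
apply: le_trans (_ : K * `|k| * `|k| <= _); last first.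
  rewrite ler_wpM2r //; apply: le_trans (_ : (K + 1) * `|k| <= _).
    by rewrite ler_wpM2r // lerDl.
  by rewrite mulrC -ler_pdivlMr // ltW.
pose T := 2 * (8 * (B * `|k|) / d * `|k|).
have -> : K * `|k| * `|k| = 2 * (T + T) by rewrite /K /T; field; rewrite gt_eqF.
apply: integ_circle_bound.
  exact: (cont_sub (cont_sub (circle_cont xk6 vd) (circle_cont x6 vd)) (Dc k)).
move=> t; rewrite /C0 /D -!mulrBl normrM normfV norm_expi invr1 mulr1.
set z := x0 + (expi t : C) *: v.
rewrite (_ : _ - _ = (f (z + k) - f z - 'd f z k) - (f (x0 + k) - f x0 - 'd f x0 k)).
  apply: le_trans (ler_normB _ _) _; apply: lerD; apply: taylor_bound => //.
    exact: cp.
  by apply: x00; rewrite ltr0n.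
by rewrite (addrAC x0 k) -/z; ring.
Qed.

(** By homogeneity in [v]. *)
Lemma deriv_differentiable v : differentiable (fun y => 'd f y v) x0.
Proof.
have [->|v0] := eqVneq v 0.
  rewrite (_ : (fun _ => _) = fun=> 0); last by apply/funext => y; exact: linear0.
  exact: differentiable_cst.
have nv : 0 < `|v| by rewrite normr_gt0.
have a0 : d / `|v| != 0 by rewrite mulf_eq0 invr_eq0 negb_or !gt_eqF.
rewrite (_ : (fun _ => _) = (fun y => (d / `|v|)^-1 *: ('d f y ((d / `|v|) *: v) : C^o))).
  apply: (@differentiableZ _ _ _ (fun y => 'd f y ((d / `|v|) *: v))).
  apply: deriv_differentiable_small.
  have nd : `|d / `|v| | = d / `|v| by rewrite ger0_norm // divr_ge0 // ltW.
  by rewrite normrZ nd divfK ?gt_eqF.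
by apply/funext => y; rewrite linearZ scalerA mulVf // scale1r.
Qed.

End Analytic.

(** The coordinates of a holomorphic map are bounded near each point, so Cauchy's
    formula applies to them. *)
Lemma holomorphic_diff (R : realType) (V W : normedModType R[i]) (O : set V)
    (f : V -> W) (v : V) : framed W -> open O -> holomorphic O f ->
  holomorphic O (fun x => 'd f x v).
Proof.
move=> [I [e [l [lc lE]]]] oO fO x Ox.
have dl i : differentiable (fun y => 'd (l i \o f) y v) x.
  have dlf y : O y -> differentiable (l i \o f) y.
    move=> Oy; apply: differentiable_comp; first exact: fO.
    exact: linear_differentiable.
  have lfc : {for x, continuous (l i \o f)} by exact/differentiable_continuous/dlf.
  have lf1 : \forall y \near x, `|(l i \o f) y| <= `|(l i \o f) x| + 1.
    have := lfc => /cvgrPdist_le /(_ _ ltr01); apply: filterS => y xy.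
    rewrite -lerBlDl; apply: le_trans (lerB_dist _ _) _.
    by rewrite distrC.
  have nO : nbhs x O by exact: open_nbhs_nbhs.
  have nOl : nbhs x (O `&` [set y | `|(l i \o f) y| <= `|(l i \o f) x| + 1]).
    exact: filterI.
  have /nbhs_ballP[r /= r0 rP] := nOl.
  have d0 : 0 < r / 8 by rewrite divr_gt0.
  have inb y : `|y - x| < 8 * (r / 8) -> ball x r y.
    by rewrite mulrC divfK ?pnatr_eq0 // -ball_normE /= distrC.
  apply: (@deriv_differentiable R V (l i \o f) x (r / 8) (`|(l i \o f) x| + 1) d0).
    by move=> y /inb /rP[/dlf].
  by move=> y /inb /rP[_].
have E : \forall y \near x, \sum_i 'd (l i \o f) y v *: e i = 'd f y v.
  apply: (open_near oO Ox) => y Oy; rewrite [RHS]lE; apply: eq_bigr => i _.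
  congr (_ *: _); rewrite diff_comp /=; first by rewrite diff_lin.
    exact: fO.
  exact: linear_differentiable.
apply: near_eq_differentiable E _.
have hs : @holomorphic R V W [set x] (fun y => \sum_i 'd (l i \o f) y v *: e i).
  move=> _ ->.
  elim: (index_enum I) => [|i r IH].
    rewrite (_ : (fun _ => _) = fun=> 0) //.
    by apply/funext => y; rewrite big_nil.
  rewrite (_ : (fun _ => _) = (fun y => 'd (l i \o f) y v *: e i) + (fun y => \sum_(j <- r) 'd (l j \o f) y v *: e j)).
    apply: differentiableD => //.
    exact: (@differentiableZl _ _ _ (fun y => 'd (l i \o f) y v)).
  by apply/funext => y; rewrite big_cons.
exact: hs.
Qed.

(** * Isotropic vectors and rotations *)

Notation o0 := (@Ordinal 3 0 isT).
Notation o1 := (@Ordinal 3 1 isT).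
Notation o2 := (@Ordinal 3 2 isT).

Section ThreeByThree.
Variable K : numFieldType.

Lemma ord3P (i : 'I_3) : [\/ i = o0, i = o1 | i = o2].
Proof.
by case: i => [[|[|[|//]]] ?]; [apply: Or31|apply: Or32|apply: Or33]; exact: val_inj.
Qed.

Lemma sum3 (V : nmodType) (F : 'I_3 -> V) : \sum_i F i = F o0 + F o1 + F o2.
Proof.
rewrite !big_ord_recl big_ord0 addr0 addrA.
by congr (F _ + F _ + F _); exact: val_inj.
Qed.

Lemma cV3P (u v : 'cV[K]_3) :
  u o0 0 = v o0 0 -> u o1 0 = v o1 0 -> u o2 0 = v o2 0 -> u = v.
Proof.
by move=> e0 e1 e2; apply/colP => i; case: (ord3P i) => ->.
Qed.

Lemma mx3P (A B : 'M[K]_3) : (forall j, A o0 j = B o0 j) ->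
  (forall j, A o1 j = B o1 j) -> (forall j, A o2 j = B o2 j) -> A = B.
Proof. by move=> e0 e1 e2; apply/matrixP => i j; case: (ord3P i) => ->. Qed.

Lemma mulmx3E n (A : 'M[K]_3) (B : 'M[K]_(3, n)) i j :
  (A *m B) i j = A i o0 * B o0 j + A i o1 * B o1 j + A i o2 * B o2 j.
Proof. by rewrite mxE sum3. Qed.

Lemma bil3 (u v : 'cV[K]_3) :
  bil u v = u o0 0 * v o0 0 + u o1 0 * v o1 0 + u o2 0 * v o2 0.
Proof. by rewrite /bil sum3. Qed.

Lemma det3 (A : 'M[K]_3) : \det A =
  A o0 o0 * (A o1 o1 * A o2 o2 - A o1 o2 * A o2 o1) -
  A o0 o1 * (A o1 o0 * A o2 o2 - A o1 o2 * A o2 o0) +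
  A o0 o2 * (A o1 o0 * A o2 o1 - A o1 o1 * A o2 o0).
Proof.
pose a (i j : nat) := A (inord i) (inord j).
have AE i j : A i j = a i j by rewrite /a !inord_val.
rewrite (expand_det_row A o0) sum3 /cofactor !(expand_det_row _ ord0).
rewrite !big_ord_recl !big_ord0 /cofactor !det_mx11 !mxE !AE /=.
rewrite /bump /= ?(add0n, addn0, addn1, add1n) !exprS !expr0; ring.
Qed.

Definition cross (u v : 'cV[K]_3) : 'cV[K]_3 := col3
  [:: u o1 0 * v o2 0 - u o2 0 * v o1 0; u o2 0 * v o0 0 - u o0 0 * v o2 0;
      u o0 0 * v o1 0 - u o1 0 * v o0 0].

End ThreeByThree.

Section CrossSO3.
Variable K : numFieldType.

Lemma tr_mul_cross (g : 'M[K]_3) (u v : 'cV[K]_3) :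
  g^T *m cross (g *m u) (g *m v) = \det g *: cross u v.
Proof.
by apply: cV3P; rewrite mulmx3E det3 !mxE /= ?sum3; ring.
Qed.

Section Element.
Variable g : 'M[K]_3.
Hypothesis gS : inSO3 g.

Lemma SO3_trK : g^T *m g = 1%:M. Proof. by have /inSO3P[] := gS. Qed.
Lemma SO3_Ktr : g *m g^T = 1%:M. Proof. by apply: mulmx1C; exact: SO3_trK. Qed.
Lemma SO3_det : \det g = 1. Proof. by have /inSO3P[] := gS. Qed.

Lemma SO3_invmx : invmx g = g^T.
Proof.
by rewrite -[LHS]mul1mx -SO3_trK -mulmxA mulmxV ?mulmx1 // inSO3_unit.
Qed.

Lemma inSO3T : inSO3 g^T. Proof. by rewrite -SO3_invmx; exact: inSO3V. Qed.

Lemma SO3_trKm m (A : 'M[K]_(3, m)) : g^T *m (g *m A) = A.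
Proof. by rewrite mulmxA SO3_trK mul1mx. Qed.

Lemma SO3_Ktrm m (A : 'M[K]_(3, m)) : g *m (g^T *m A) = A.
Proof. by rewrite mulmxA SO3_Ktr mul1mx. Qed.

Lemma SO3_bil u v : bil (g *m u) (g *m v) = bil u v.
Proof. by have /andP[_ /asboolP] := gS. Qed.

Lemma SO3_cross u v : cross (g *m u) (g *m v) = g *m cross u v.
Proof. by rewrite -[LHS]SO3_Ktrm tr_mul_cross SO3_det scale1r. Qed.

End Element.

Lemma SO3_val (g : SO3 K) : inSO3 (val g). Proof. exact: valP. Qed.

Lemma SO3_ext (g h : SO3 K) : val g = val h -> g = h. Proof. exact: val_inj. Qed.

(** Cyclic permutation of the coordinates. *)
Definition cyc : 'M[K]_3 := mx3 [:: [:: 0; 1; 0]; [:: 0; 0; 1]; [:: 1; 0; 0]].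

Lemma inSO3_cyc : inSO3 cyc.
Proof.
apply/inSO3P; split; first by rewrite det3 !mxE /=; ring.
by apply: mx3P => j; case: (ord3P j) => ->; rewrite mulmx3E !mxE /=; ring.
Qed.

(** The translates of one affine chart of the conic by these rotations cover it. *)
Definition cycn (k : nat) : 'M[K]_3 :=
  match k with 0 => 1%:M | 1 => cyc | _ => cyc *m cyc end.

Lemma inSO3_cycn k : inSO3 (cycn k).
Proof.
by case: k => [|[|k]] /=; [exact: inSO31|exact: inSO3_cyc|apply: inSO3M; exact: inSO3_cyc].
Qed.

End CrossSO3.

Section Isotropic.
Variable R : realType.
Notation C := (Num.NumField.sort R[i]).
Implicit Types (n : 'cV[C]_3) (t q a : C).

Definition iC : C := 0 +i* 1.

Lemma iC2 : iC * iC = -1.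
Proof. by apply/eqP; rewrite eq_complex /=; apply/andP; split; apply/eqP; ring. Qed.

(** Coordinates on the isotropic cone: [n = af n *: nv (tf n)] where [af n != 0],
    see [isotropicE]. The values [tf n] and [lf n q] are unchanged under
    [(n, q) -> (a n, a^2 q)]. *)
Definition af n : C := (n o0 0 - iC * n o1 0) / 2.
Definition tf n : C := n o2 0 / (2 * af n).
Definition lf n q : C := q / af n ^+ 2.
Definition nv t : 'cV[C]_3 := col3 [:: 1 - t ^+ 2; iC * (1 + t ^+ 2); 2 * t].

Lemma two_neq0 : (2 : C) != 0. Proof. by rewrite pnatr_eq0. Qed.

Lemma afZ a n : af (a *: n) = a * af n.
Proof. by rewrite /af !mxE; field. Qed.

Lemma tfZ a n : a != 0 -> tf (a *: n) = tf n.
Proof.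
move=> a0; rewrite /tf afZ !mxE; have [->|n0] := eqVneq (af n) 0.
  by rewrite !(mulr0, invr0).
by field; rewrite a0 n0.
Qed.

Lemma lfZ a n q : a != 0 -> lf (a *: n) (a ^+ 2 * q) = lf n q.
Proof.
move=> a0; rewrite /lf afZ; have [->|n0] := eqVneq (af n) 0.
  by rewrite !(mulr0, expr0n, invr0).
by field; rewrite a0 n0.
Qed.

Lemma af_nv t : af (nv t) = 1.
Proof.
rewrite /af !mxE /=.
have -> : 1 - t ^+ 2 - iC * (iC * (1 + t ^+ 2)) = 1 - t ^+ 2 - (iC * iC) * (1 + t ^+ 2) by ring.
by rewrite iC2; field.
Qed.

Lemma tf_nv t : tf (nv t) = t.
Proof. by rewrite /tf af_nv !mxE /=; field. Qed.

Lemma bil_nv t : bil (nv t) (nv t) = 0.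
Proof.
rewrite bil3 !mxE /=.
have -> : iC * (1 + t ^+ 2) * (iC * (1 + t ^+ 2)) = (iC * iC) * (1 + t ^+ 2) ^+ 2 by ring.
by rewrite iC2; ring.
Qed.

Lemma nv0 : nv 0 = n0 R.
Proof. by apply: cV3P; rewrite !mxE /= ?expr0n /= ?(subr0, addr0, mulr1, mulr0). Qed.

Lemma isotropicE n : bil n n = 0 -> af n != 0 -> n = af n *: nv (tf n).
Proof.
rewrite bil3 => nn a0; set a := af n in a0 *.
have aE : n o0 0 = 2 * a + iC * n o1 0 by rewrite /a /af; field.
have t2 : 4 * a * (a * tf n ^+ 2) = n o2 0 ^+ 2 by rewrite /tf -/a; field.
have n1 : iC * n o1 0 = - a * (1 + tf n ^+ 2).
  apply: (mulfI a0); apply: (mulfI two_neq0); apply: (mulfI two_neq0).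
  have -> : 2 * (2 * (a * (- a * (1 + tf n ^+ 2)))) =
    - (4 * a * a) - 4 * a * (a * tf n ^+ 2) by ring.
  rewrite t2.
  have <- : - (n o0 0 * n o0 0 + n o1 0 * n o1 0) = n o2 0 ^+ 2.
    by apply/eqP; rewrite eq_sym -addr_eq0 expr2 addrC nn.
  rewrite aE.
  have -> : n o1 0 * n o1 0 = - ((iC * iC) * (n o1 0 * n o1 0)) by rewrite iC2; ring.
  ring.
apply: cV3P; rewrite !mxE /=.
- by rewrite aE n1; ring.
- have -> : n o1 0 = - iC * (iC * n o1 0) by rewrite mulrA mulNr iC2; ring.
  by rewrite n1; ring.
- by rewrite /tf -/a; field.
Qed.

(** A nonzero isotropic vector lies outside at most one of the three affine
    pieces of the conic. *)
Lemma cyc_cover n : bil n n = 0 -> n != 0 ->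
  (af n != 0 \/ af ((cyc C)^T *m n) != 0) /\
  (af n != 0 \/ af ((cyc C *m cyc C)^T *m n) != 0) /\
  (af ((cyc C)^T *m n) != 0 \/ af ((cyc C *m cyc C)^T *m n) != 0).
Proof.
rewrite bil3 => nn nz.
have key x y z : x * x + y * y + z * z = 0 :> C -> x - iC * y = 0 -> y - iC * z = 0 ->
    [/\ x = 0, y = 0 & z = 0].
  move=> xyz /eqP; rewrite subr_eq0 => /eqP xE /eqP; rewrite subr_eq0 => /eqP yE.
  have z0 : z = 0.
    apply/eqP; rewrite -sqrf_eq0 expr2.
    have : x * x + y * y = 0.
      rewrite xE; have -> : iC * y * (iC * y) + y * y = (iC * iC) * (y * y) + y * y by ring.
      by rewrite iC2; ring.
    by move=> xy; rewrite xy add0r in xyz; rewrite xyz.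
  by rewrite xE yE z0 !mulr0.
have E1 : af ((cyc C)^T *m n) = (n o2 0 - iC * n o0 0) / 2.
  by rewrite /af !mulmx3E !mxE /=; field.
have E2 : af ((cyc C *m cyc C)^T *m n) = (n o1 0 - iC * n o2 0) / 2.
  by rewrite /af trmx_mul !mulmx3E !mxE ?sum3 ?mxE /=; field.
have half x : x / 2 = 0 -> x = 0 :> C.
  by move=> /eqP; rewrite mulf_eq0 invr_eq0 (negPf two_neq0) orbF => /eqP.
have nz' : ~ [/\ n o0 0 = 0, n o1 0 = 0 & n o2 0 = 0].
  by move=> [e0 e1 e2]; move/eqP: nz; apply; apply: cV3P; rewrite mxE.
split; [|split]; apply/orP; rewrite -negb_and; apply/negP => /andP[/eqP + /eqP].
- rewrite E1 /af => /half h1 /half h2; apply: nz'.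
  by have [|a b c] := key (n o2 0) (n o0 0) (n o1 0) _ h2 h1; first by rewrite -nn; ring.
- rewrite E2 /af => /half h1 /half h2; apply: nz'.
  by have [a b c] := key (n o0 0) (n o1 0) (n o2 0) nn h1 h2.
- rewrite E1 E2 => /half h1 /half h2; apply: nz'.
  by have [|a b c] := key (n o1 0) (n o2 0) (n o0 0) _ h2 h1; first by rewrite -nn; ring.
Qed.

(** Each vector excludes at most one of the three charts, so two vectors leave one. *)
Lemma cyc_common n n' : bil n n = 0 -> n != 0 -> bil n' n' = 0 -> n' != 0 ->
  exists k : nat, af ((cycn C k)^T *m n) != 0 /\ af ((cycn C k)^T *m n') != 0.
Proof.
move=> nn nz nn' nz'.
have pick (b b' : nat -> bool) : (b 0%N || b 1%N) -> (b 0%N || b 2%N) -> (b 1%N || b 2%N) ->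
    (b' 0%N || b' 1%N) -> (b' 0%N || b' 2%N) -> (b' 1%N || b' 2%N) -> exists k, b k && b' k.
  move=> h1 h2 h3 h1' h2' h3'.
  have : [|| b 0%N && b' 0%N, b 1%N && b' 1%N | b 2%N && b' 2%N].
    move: h1 h2 h3 h1' h2' h3'.
    by case: (b 0%N); case: (b 1%N); case: (b 2%N);
      case: (b' 0%N); case: (b' 1%N); case: (b' 2%N).
  by case/or3P => h; [exists 0%N|exists 1%N|exists 2%N].
have E m : (cycn C 0%N)^T *m m = m :> 'cV_3 by rewrite /= trmx1 mul1mx.
pose b m k := af ((cycn C k)^T *m m) != 0.
have bc m : bil m m = 0 -> m != 0 -> [/\ b m 0%N || b m 1%N, b m 0%N || b m 2%N & b m 1%N || b m 2%N].
  move=> mm mz; have [c1 [c2 c3]] := cyc_cover mm mz.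
  by split; apply/orP; rewrite /b ?E /=; [exact: c1|exact: c2|exact: c3].
have [c1 c2 c3] := bc n nn nz; have [c1' c2' c3'] := bc n' nn' nz'.
have [k /andP[h h']] := pick _ _ c1 c2 c3 c1' c2' c3'.
by exists k; split; [exact: h|exact: h'].
Qed.

(** The unipotent one-parameter group that moves [nv 0] to [nv t]. *)
Definition kmx t : 'M[C]_3 := mx3
  [:: [:: 1 - t ^+ 2 / 2; iC * (t ^+ 2 / 2); - t];
      [:: iC * (t ^+ 2 / 2); 1 + t ^+ 2 / 2; iC * t]; [:: t; - (iC * t); 1]].

Lemma kmxD s t : kmx (s + t) = kmx s *m kmx t.
Proof.
have mod_iC (x y : C) X : x - y = (iC * iC + 1) * X -> x = y.
  by rewrite iC2 addNr mul0r => /eqP; rewrite subr_eq0 => /eqP.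
pose a := s ^+ 2 / 2; pose b := t ^+ 2 / 2.
by apply: mx3P => j; case: (ord3P j) => ->; rewrite mulmx3E !mxE /=;
  first [ field | apply: (mod_iC _ _ (- (a * b))); rewrite /a /b; field
    | apply: (mod_iC _ _ (- (a * t))); rewrite /a /b; field
    | apply: (mod_iC _ _ (s * t - a * b)); rewrite /a /b; field
    | apply: (mod_iC _ _ (s * b)); rewrite /a /b; field
    | apply: (mod_iC _ _ (s * t)); rewrite /a /b; field ].
Qed.

Lemma kmx0 : kmx 0 = 1%:M.
Proof.
by apply: mx3P => j; case: (ord3P j) => ->; rewrite !mxE /= ?expr0n /=;
  rewrite ?(mul0r, mulr0, subr0, addr0, oppr0).
Qed.

Lemma kmxT t : (kmx t)^T = kmx (- t).
Proof.
by apply: mx3P => j; case: (ord3P j) => ->; rewrite !mxE /=; ring.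
Qed.

Lemma inSO3_kmx t : inSO3 (kmx t).
Proof.
have kk s : (kmx s)^T *m kmx s = 1%:M by rewrite kmxT -kmxD addNr kmx0.
apply/inSO3P; split=> //.
have -> : t = t / 2 + t / 2 by field.
by rewrite kmxD det_mulmx -[X in X * _]det_tr -det_mulmx kk det1.
Qed.

Lemma kmx_nv s t : kmx s *m nv t = nv (s + t).
Proof.
have k0 u : kmx u *m nv 0 = nv u.
  apply: cV3P; rewrite mulmx3E !mxE /= ?expr0n /=.
  - have -> : (1 - u ^+ 2 / 2) * (1 - 0) + iC * (u ^+ 2 / 2) * (iC * (1 + 0)) + - u * (2 * 0) =
      1 - u ^+ 2 / 2 + (iC * iC) * (u ^+ 2 / 2) by ring.
    by rewrite iC2; field.
  - by field.
  - have -> : u * (1 - 0) + - (iC * u) * (iC * (1 + 0)) + 1 * (2 * 0) =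
      u - (iC * iC) * u by ring.
    by rewrite iC2; ring.
by rewrite -(k0 t) mulmxA -kmxD k0.
Qed.

End Isotropic.

Section Stereographic.
Variable R : realType.
Notation C := (Num.NumField.sort R[i]).

Definition cm m n (A : 'M[R]_(m, n)) : 'M[C]_(m, n) := map_mx (real_complex R) A.

Lemma cmM m n p (A : 'M[R]_(m, n)) (B : 'M[R]_(n, p)) : cm (A *m B) = cm A *m cm B.
Proof. exact: map_mxM. Qed.

Lemma cm_tr m n (A : 'M[R]_(m, n)) : cm A^T = (cm A)^T.
Proof. by rewrite /cm map_trmx. Qed.

Lemma cm_cycn k : cm (cycn R k) = cycn R[i] k.
Proof.
have c1 : cm (cyc R) = cyc R[i].
  by apply: mx3P => j; case: (ord3P j) => ->; rewrite !mxE.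
by case: k => [|[|k]] /=; rewrite ?cmM ?c1 // /cm map_mx1.
Qed.

Definition den (x y : R) : R := 1 + x ^+ 2 + y ^+ 2.

Lemma den_gt0 x y : 0 < den x y.
Proof. by rewrite /den -addrA ltr_wpDr // addr_ge0 // sqr_ge0. Qed.

(** The rotation that maps [n0] to the line of [nv (x +i* y)], see [rmx_n0]; its
    third column is the inverse stereographic projection of [(- x, - y)]. *)
Definition rmx (x y : R) : 'M[R]_3 := (den x y)^-1 *: mx3
  [:: [:: 1 - x ^+ 2 + y ^+ 2; - (2 * x * y); - (2 * x)];
      [:: - (2 * x * y); 1 + x ^+ 2 - y ^+ 2; - (2 * y)];
      [:: 2 * x; 2 * y; 1 - x ^+ 2 - y ^+ 2]].

Lemma inSO3_rmx x y : inSO3 (rmx x y).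
Proof.
have d0 : den x y != 0 by rewrite gt_eqF // den_gt0.
rewrite /den in d0.
apply/inSO3P; split; first by rewrite det3 !mxE /= /den; field.
by apply: mx3P => j; case: (ord3P j) => ->; rewrite mulmx3E !mxE /= /den; field.
Qed.

Lemma rmx_n0 x y : cm (rmx x y) *m n0 R = ((den x y)^-1)%:C *: nv (x +i* y).
Proof.
by apply: cV3P; rewrite mulmx3E !mxE /= /iC;
  apply/eqP; rewrite eq_complex; apply/andP; split; apply/eqP; rewrite /= ?mulr0; ring.
Qed.

Lemma rmx0 : rmx 0 0 = 1%:M.
Proof.
by apply: mx3P => j; case: (ord3P j) => ->; rewrite !mxE /= /den ?expr0n /=;
  rewrite ?(mul0r, mulr0, subr0, addr0, oppr0, invr1, mulr1).
Qed.

(** Stereographic coordinates of a point of the sphere. *)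
Definition tx (s : 'cV[R]_3) : R := - (s o0 0 / (1 + s o2 0)).
Definition ty (s : 'cV[R]_3) : R := - (s o1 0 / (1 + s o2 0)).

Lemma rmx_e3 s : bil s s = 1 -> 1 + s o2 0 != 0 -> rmx (tx s) (ty s) *m e3 R = s.
Proof.
rewrite bil3 => ss s0.
have dE : den (tx s) (ty s) = 2 / (1 + s o2 0).
  have -> : den (tx s) (ty s) = 1 + (s o0 0 * s o0 0 + s o1 0 * s o1 0) / (1 + s o2 0) ^+ 2.
    by rewrite /den /tx /ty; field.
  have -> : s o0 0 * s o0 0 + s o1 0 * s o1 0 = 1 - s o2 0 ^+ 2 by rewrite -ss; ring.
  by field.
have t2 : tx s ^+ 2 + ty s ^+ 2 = 2 / (1 + s o2 0) - 1 by rewrite -dE /den; ring.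
apply: cV3P; rewrite mulmx3E !mxE /= dE.
- by rewrite /tx; field.
- by rewrite /ty; field.
- have -> : 1 - tx s ^+ 2 - ty s ^+ 2 = 1 - (2 / (1 + s o2 0) - 1) by rewrite -t2; ring.
  by field.
Qed.

Lemma tx_e3 : tx (e3 R) = 0 /\ ty (e3 R) = 0.
Proof. by split; rewrite /tx /ty !mxE /= mul0r oppr0. Qed.

End Stereographic.

(** * Classes modulo B and SO(2) *)

Section Classes.
Variable R : realType.
Notation C := (Num.NumField.sort R[i]).

Lemma SO3_unit (K : numFieldType) (g : SO3 K) : val g \in unitmx.
Proof. exact: inSO3_unit (valP g). Qed.

Lemma invB_n0 (b : 'M[R[i]]_3) : inB b -> invmx b *m n0 R = (rho b)^-1 *: n0 R.
Proof. by move=> bB; rewrite (rhoE (inBV bB)) rhoV. Qed.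

(** The element [g'^-1 g] multiplies [n0] by [a^-1]; hence it lies in B. *)
Lemma in_B (g g' : SO3 R[i]) (a : C) : a != 0 ->
  val g' *m n0 R = a *: (val g *m n0 R) ->
  exists b, [/\ inB b, val g' = val g *m invmx b & rho b = a^-1].
Proof.
move=> a0 gg'; pose b := invmx (val g') *m val g.
have bS : inSO3 b by apply: inSO3M; [apply: inSO3V|]; exact: valP.
have bn : b *m n0 R = a^-1 *: n0 R.
  rewrite /b -mulmxA.
  have -> : val g *m n0 R = a^-1 *: (val g' *m n0 R) by rewrite gg' scalerA mulVf // scale1r.
  by rewrite -scalemxAr mulKmx // SO3_unit.
have bB : inB b by apply: (inBP bS _ bn); rewrite invr_eq0.
exists b; split=> //; last by rewrite /rho bn !mxE mulr1.
rewrite /b inSO3_invM; [|apply: inSO3V; exact: valP|exact: valP].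
by rewrite invmxK mulKVmx // SO3_unit.
Qed.

Lemma homC_eqP (g g' : SO3 R[i]) : pi_homC g = pi_homC g' <->
  exists2 a : C, a != 0 & val g' *m n0 R = a *: (val g *m n0 R).
Proof.
split=> [/eqmodP /asboolP[b [bB ->]]|[a a0 /(in_B a0)[b [bB gb _]]]].
  exists (rho b)^-1; first by rewrite invr_eq0 rho_neq0.
  by rewrite -mulmxA invB_n0 // scalemxAr.
by apply/eqmodP/asboolP; exists b.
Qed.

Lemma assC_eqP (x x' : SO3 R[i] * R[i]) : pi_assC x = pi_assC x' <->
  exists2 a : C, a != 0 &
    val x'.1 *m n0 R = a *: (val x.1 *m n0 R) /\ x'.2 = a ^+ 2 * x.2.
Proof.
split=> [/eqmodP /asboolP[b [bB E1 E2]]|[a a0 [/(in_B a0)[b [bB gb rb]] E2]]].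
  exists (rho b)^-1; first by rewrite invr_eq0 rho_neq0.
  split; first by rewrite E1 -mulmxA invB_n0 // scalemxAr.
  by rewrite E2 exprVn.
apply/eqmodP/asboolP; exists b; split=> //.
by rewrite E2 rb exprVn invrK.
Qed.

Lemma polar_angle (x y : R) : x ^+ 2 + y ^+ 2 = 1 -> exists phi, cos phi = x /\ sin phi = y.
Proof.
move=> xy; have x1 : -1 <= x <= 1.
  rewrite -ler_norml -(@ler_sqr _ _ 1) ?nnegrE // expr1n -normrX ger0_norm ?sqr_ge0 //.
  by rewrite -xy lerDl sqr_ge0.
have yE : `|y| = Num.sqrt (1 - x ^+ 2) by rewrite -xy addrC addKr sqrtr_sqr.
case: (leP 0 y) => y0.
  by exists (acos x); rewrite acosK ?in_itv //= sin_acos // -yE ger0_norm.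
exists (- acos x); rewrite cosN sinN acosK ?in_itv //= sin_acos // -yE ltr0_norm //.
by rewrite opprK.
Qed.

Lemma invmx_rotzE (phi : R) : invmx (rotz phi) = mx3
  [:: [:: cos phi; sin phi; 0]; [:: - sin phi; cos phi; 0]; [:: 0; 0; 1]].
Proof. by rewrite invmx_rotz /rotz cosN sinN opprK. Qed.

Lemma mx3_id (K : numFieldType) (A : 'M[K]_3) : A = mx3
  [:: [:: A o0 o0; A o0 o1; A o0 o2]; [:: A o1 o0; A o1 o1; A o1 o2];
      [:: A o2 o0; A o2 o1; A o2 o2]].
Proof. by apply: mx3P => j; case: (ord3P j) => ->; rewrite mxE. Qed.

Lemma rotz_n0 (phi : R) : cm (invmx (rotz phi)) *m n0 R = (expi phi : C) *: n0 R.
Proof.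
rewrite invmx_rotzE; apply: cV3P; rewrite mulmx3E !mxE /= /expi; simpc;
  by congr (_ +i* _); ring.
Qed.

Lemma rotz_e3 (phi : R) : invmx (rotz phi) *m e3 R = e3 R.
Proof. by rewrite invmx_rotzE; apply: cV3P; rewrite mulmx3E !mxE /=; ring. Qed.

Lemma orth3 (K : numFieldType) (b : 'M[K]_3) i j : inSO3 b ->
  b o0 i * b o0 j + b o1 i * b o1 j + b o2 i * b o2 j = (i == j)%:R.
Proof.
move=> /SO3_trK /matrixP /(_ i j); rewrite mulmx3E !mxE => <-.
by [].
Qed.

(** The real and the imaginary part of [n0] span the plane orthogonal to [e3]; [b]
    acts on it by a similarity, which is a rotation as [b] preserves lengths. *)
Lemma stab_line (b : 'M[R]_3) (a : C) : inSO3 b -> cm b *m n0 R = a *: n0 R ->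
  exists2 phi, b = invmx (rotz phi) & a = expi phi.
Proof.
move=> bS; case: a => x y.
move=> /colP bn; have := bn o0; have := bn o1; have := bn o2.
rewrite !mulmx3E !mxE /=; simpc.
move=> [b20 b21] [b10 b11] [b00 b01].
have := SO3_det bS; rewrite det3.
have := orth3 o0 o0 bS; have := orth3 o0 o2 bS; have := orth3 o1 o2 bS.
rewrite -!val_eqE /= b20 b21 b10 b11 b00 b01 => e12 e02 e00 dt.
have xy : x ^+ 2 + y ^+ 2 = 1 by rewrite -[RHS]e00; ring.
have [phi [cx sy]] := polar_angle xy.
exists phi; last by rewrite /expi cx sy.
rewrite invmx_rotzE cx sy [LHS]mx3_id b20 b21 b10 b11 b00 b01.
have -> : b o2 o2 = 1.
  transitivity ((x ^+ 2 + y ^+ 2) * b o2 o2); first by rewrite xy mul1r.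
  by rewrite -[RHS]dt; ring.
have -> : b o0 o2 = 0.
  rewrite -[LHS]mul1r -xy.
  transitivity (x * (x * b o0 o2 + - y * b o1 o2 + 0 * b o2 o2) + y * (y * b o0 o2 + x * b o1 o2 + 0 * b o2 o2)); first by ring.
  by rewrite e02 e12; ring.
have -> : b o1 o2 = 0; last by [].
rewrite -[LHS]mul1r -xy.
transitivity (x * (y * b o0 o2 + x * b o1 o2 + 0 * b o2 o2) - y * (x * b o0 o2 + - y * b o1 o2 + 0 * b o2 o2)); first by ring.
by rewrite e02 e12; ring.
Qed.

Lemma stab_e3 (b : 'M[R]_3) : inSO3 b -> b *m e3 R = e3 R -> exists phi, b = invmx (rotz phi).
Proof.
move=> bS be; have be' : b^T *m e3 R = e3 R by rewrite -{1}be SO3_trKm.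
move: be be' => /colP be /colP be'.
have := be o0; have := be o1; have := be o2; have := be' o0; have := be' o1.
rewrite !mulmx3E !mxE /= !(mulr0, mulr1, addr0, add0r).
move=> b21 b20 b22 b12 b02.
have := SO3_det bS; rewrite det3.
have := orth3 o0 o0 bS; have := orth3 o0 o1 bS; have := orth3 o1 o1 bS.
rewrite -!val_eqE /= b20 b21 b22 b12 b02 => e11 e01 e00 dt.
have xy : b o0 o0 ^+ 2 + b o1 o0 ^+ 2 = 1 by rewrite -[RHS]e00; ring.
have dt' : b o0 o0 * b o1 o1 - b o0 o1 * b o1 o0 = 1 by rewrite -[RHS]dt; ring.
have e01' : b o0 o0 * b o0 o1 + b o1 o0 * b o1 o1 = 0 by rewrite -[RHS]e01; ring.
have d1 : b o1 o1 = b o0 o0.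
  transitivity ((b o0 o0 ^+ 2 + b o1 o0 ^+ 2) * b o1 o1); first by rewrite xy mul1r.
  transitivity (b o0 o0 * (b o0 o0 * b o1 o1 - b o0 o1 * b o1 o0) +
    b o1 o0 * (b o0 o0 * b o0 o1 + b o1 o0 * b o1 o1)); first by ring.
  by rewrite dt' e01'; ring.
have d2 : b o0 o1 = - b o1 o0.
  transitivity ((b o0 o0 ^+ 2 + b o1 o0 ^+ 2) * b o0 o1); first by rewrite xy mul1r.
  transitivity (b o0 o0 * (b o0 o0 * b o0 o1 + b o1 o0 * b o1 o1) -
    b o1 o0 * (b o0 o0 * b o1 o1 - b o0 o1 * b o1 o0)); first by ring.
  by rewrite dt' e01'; ring.
have [phi [cx sy]] : exists phi, cos phi = b o0 o0 /\ sin phi = - b o1 o0.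
  by apply: polar_angle; rewrite sqrrN.
exists phi; rewrite invmx_rotzE cx sy [LHS]mx3_id b20 b21 b22 b12 b02 d1 d2.
by rewrite opprK.
Qed.

(** The element [g^-1 g'] satisfies the hypothesis of [stab_line]. *)
Lemma homR_eqP (g g' : SO3 R) : pi_homR g = pi_homR g' <->
  exists2 a : C, a != 0 & cm (val g') *m n0 R = a *: (cm (val g) *m n0 R).
Proof.
split=> [/eqmodP /asboolP[phi ->]|[a a0 gg']].
  exists (expi phi); first exact: expi_neq0.
  by rewrite cmM -mulmxA rotz_n0 scalemxAr.
pose b := (val g)^T *m val g'.
have bS : inSO3 b by apply: inSO3M; [apply: inSO3T|]; exact: valP.
have bn : cm b *m n0 R = a *: n0 R.
  by rewrite /b cmM -mulmxA gg' -scalemxAr mulmxA -cmM SO3_trK ?(valP g) // /cm map_mx1 mul1mx.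
have [phi bE _] := stab_line bS bn.
by apply/eqmodP/asboolP; exists phi; rewrite -bE /b SO3_Ktrm // (valP g).
Qed.

Lemma homR_eqP3 (g g' : SO3 R) : pi_homR g = pi_homR g' <->
  val g' *m e3 R = val g *m e3 R.
Proof.
split=> [/eqmodP /asboolP[phi ->]|gg']; first by rewrite -mulmxA rotz_e3.
pose b := (val g)^T *m val g'.
have bS : inSO3 b by apply: inSO3M; [apply: inSO3T|]; exact: valP.
have be : b *m e3 R = e3 R by rewrite /b -mulmxA gg' SO3_trKm // (valP g).
have [phi bE] := stab_e3 bS be.
by apply/eqmodP/asboolP; exists phi; rewrite -bE /b SO3_Ktrm // (valP g).
Qed.

Lemma expi2 (phi : R) : expi (2 * phi) = expi phi ^+ 2.
Proof. by rewrite mulr_natl mulr2n expiD expr2. Qed.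

Lemma assR_eqP (x x' : SO3 R * R[i]) : pi_assR x = pi_assR x' <->
  exists2 a : C, a != 0 &
    cm (val x'.1) *m n0 R = a *: (cm (val x.1) *m n0 R) /\ x'.2 = a ^+ 2 * x.2.
Proof.
split=> [/eqmodP /asboolP[phi [-> ->]]|[a a0 [gg' qq']]].
  exists (expi phi); first exact: expi_neq0.
  by rewrite cmM -mulmxA rotz_n0 scalemxAr expi2.
pose b := (val x.1)^T *m val x'.1.
have bS : inSO3 b by apply: inSO3M; [apply: inSO3T|]; exact: valP.
have bn : cm b *m n0 R = a *: n0 R.
  by rewrite /b cmM -mulmxA gg' -scalemxAr mulmxA -cmM SO3_trK ?(valP x.1) // /cm map_mx1 mul1mx.
have [phi bE aE] := stab_line bS bn.
apply/eqmodP/asboolP; exists phi.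
by rewrite -bE /b SO3_Ktrm ?(valP x.1) // qq' aE expi2.
Qed.

End Classes.

(** * Charts of the complex line bundle *)

(** Proves the regularity of an expression built from matrix operations. *)
Ltac regt rg oO := repeat first
  [ exact: (reg_cst rg) | exact: (reg_id rg) | assumption
  | apply: (reg_add rg oO) | apply: (reg_subr rg oO) | apply: (reg_opp rg oO)
  | apply: (reg_mul rg oO) | apply: (reg_exp rg _ oO) | apply: (reg_mulmx rg oO)
  | apply: (reg_trmx rg oO) | apply: (reg_coord rg _ _ oO)
  | apply: (reg_scale rg oO) ].

Lemma open_neq0 (K : numFieldType) : open [set z : K | z != 0].
Proof.
rewrite openE => z /= z0; apply/nbhs_ballP; exists `|z|; first by rewrite /= normr_gt0.
by move=> w; rewrite -ball_normE /=; apply: contraTneq => ->; rewrite subr0 ltxx.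
Qed.

Section RowMx.
Variables (K : numFieldType) (reg : regularity K) (rg : good_reg reg).

Lemma reg_row_mx (V : normedModType K) n1 n2 (O : set V) (f : V -> 'rV[K]_n1)
    (g : V -> 'rV[K]_n2) : open O -> reg O f -> reg O g ->
  reg O (fun x => row_mx (f x) (g x)).
Proof.
move=> oO fO gO; apply: (reg_mx rg) => // i j.
case: (split_ordP j) => j' ->.
  under [X in reg O X]eq_fun do rewrite row_mxEl.
  exact: (reg_coord rg).
under [X in reg O X]eq_fun do rewrite row_mxEr.
exact: (reg_coord rg).
Qed.

End RowMx.

(** The real and the complex quotients have the same description: a class is
    determined by the isotropic line of [nu g], resp. by the pair of [nu g] and
    the fibre coordinate up to [(n, q) -> (a n, a^2 q)]. *)
Section Model.
Variable R : realType.
Notation C := (Num.NumField.sort R[i]).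
Variables (G X E : Type) (nu : G -> 'cV[C]_3) (pX : G -> X) (pE : G * C -> E)
  (pr : E -> X) (rX : X -> G) (rE : E -> G * C).
Hypotheses (nu_iso : forall g, bil (nu g) (nu g) = 0) (nu_neq0 : forall g, nu g != 0)
  (rXK : forall x, pX (rX x) = x) (rEK : forall e, pE (rE e) = e)
  (pXP : forall g g', pX g = pX g' <-> exists2 a : C, a != 0 & nu g' = a *: nu g)
  (pEP : forall x x', pE x = pE x' <->
     exists2 a : C, a != 0 & nu x'.1 = a *: nu x.1 /\ x'.2 = a ^+ 2 * x.2)
  (prE : forall x, pr (pE x) = pX x.1).

Definition lcoord k (n : 'cV[C]_3) := (cycn C k)^T *m n.

Lemma lcoordZ k (a : C) n : lcoord k (a *: n) = a *: lcoord k n.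
Proof. by rewrite /lcoord scalemxAr. Qed.

Lemma lcoordK k n : cycn C k *m lcoord k n = n.
Proof. by rewrite /lcoord SO3_Ktrm //; exact: inSO3_cycn. Qed.

Lemma lcoord_cycn k n : lcoord k (cycn C k *m n) = n.
Proof. by rewrite /lcoord SO3_trKm //; exact: inSO3_cycn. Qed.

Definition domX k : set X := [set x | af (lcoord k (nu (rX x))) != 0].
Definition tX k x : C := tf (lcoord k (nu (rX x))).
Definition lE k e : C := lf (lcoord k (nu (rE e).1)) (rE e).2.

Lemma domX_pi k g : domX k (pX g) <-> af (lcoord k (nu g)) != 0.
Proof.
have [a a0 ->] := (pXP _ _).1 (rXK (pX g)); rewrite /domX /=.
rewrite lcoordZ afZ; split=> [h|]; first by rewrite mulf_neq0.
by apply: contraNneq => ->; rewrite mulr0.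
Qed.

Lemma tX_pi k g : tX k (pX g) = tf (lcoord k (nu g)).
Proof.
have [a a0 ->] := (pXP _ _).1 (rXK (pX g)); rewrite /tX.
by rewrite lcoordZ tfZ.
Qed.

Lemma lE_pi k x : lE k (pE x) = lf (lcoord k (nu x.1)) x.2.
Proof.
have [a a0 [-> ->]] := (pEP _ _).1 (rEK (pE x)); rewrite /lE.
by rewrite lcoordZ lfZ.
Qed.

Lemma lcoord_iso k g : bil (lcoord k (nu g)) (lcoord k (nu g)) = 0.
Proof. by rewrite SO3_bil ?nu_iso //; apply: inSO3T; exact: inSO3_cycn. Qed.

Lemma nuE k g : domX k (pX g) ->
  nu g = af (lcoord k (nu g)) *: (cycn C k *m nv (tX k (pX g))).
Proof.
move=> /domX_pi a0; rewrite tX_pi scalemxAr -isotropicE ?lcoordK //.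
exact: lcoord_iso.
Qed.

Lemma domX_common x x' : exists k, domX k x /\ domX k x'.
Proof. by have [k] := cyc_common (nu_iso (rX x)) (nu_neq0 (rX x)) (nu_iso (rX x')) (nu_neq0 (rX x')); exists k. Qed.

Lemma fibreE e g : pr e = pX g -> exists q, e = pE (g, q).
Proof.
rewrite -[e]rEK prE => /pXP[a a0 E1]; case: (rE e) E1 => g' q /= E1.
exists (a ^+ 2 * q); apply/pEP; exists a => //.
Qed.

Lemma lE_surj k x l : domX k x -> exists e, pr e = x /\ lE k e = l.
Proof.
rewrite -[x]rXK => /domX_pi; set n := lcoord _ _ => a0.
exists (pE (rX x, af n ^+ 2 * l)); split; first by rewrite prE.
by rewrite lE_pi /= /lf -/n; field.
Qed.

Definition linE (a : C) e1 e2 e3 := exists g q1 q2,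
  [/\ e1 = pE (g, q1), e2 = pE (g, q2) & e3 = pE (g, a * q1 + q2)].

Lemma linEP k a e1 e2 e3 : domX k (pr e1) -> linE a e1 e2 e3 <->
  [/\ pr e2 = pr e1, pr e3 = pr e1 & lE k e3 = a * lE k e1 + lE k e2].
Proof.
move=> d1; split=> [[g [q1 [q2 [-> -> ->]]]]|[p2 p3 l3]].
  by split; rewrite ?prE // !lE_pi /= /lf; ring.
pose g := rX (pr e1); have p1 : pr e1 = pX g by rewrite rXK.
have [q1 E1] := fibreE p1.
have [q2 E2] := fibreE (etrans p2 p1); have [q3 E3] := fibreE (etrans p3 p1).
exists g, q1, q2; split=> //; rewrite E3; congr pE; congr pair.
move: l3 d1; rewrite E1 E2 E3 prE !lE_pi /= => + /domX_pi; rewrite /lf.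
set b := af _ => l3 b0; apply: (mulIf (_ : (b ^+ 2)^-1 != 0)).
  by rewrite invr_eq0 expf_neq0.
by rewrite l3; ring.
Qed.

End Model.

Section ComplexCharts.
Variable R : realType.
Notation C := (Num.NumField.sort R[i]).
Let rg := holomorphic_good R.

Definition nuC (g : SO3 R[i]) : 'cV[C]_3 := val g *m n0 R.

Lemma bil_n0 : bil (n0 R) (n0 R) = 0.
Proof. by rewrite -nv0 bil_nv. Qed.

Lemma nuC_iso g : bil (nuC g) (nuC g) = 0.
Proof. by rewrite SO3_bil ?bil_n0 // (valP g). Qed.

Lemma nuC_neq0 g : nuC g != 0.
Proof.
apply/eqP => E; have /eqP := n0_neq0 R; apply.
by rewrite -[n0 R](SO3_trKm (valP g)) -/(nuC g) E mulmx0.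
Qed.

Definition rhomC (x : homC R) : SO3 R[i] := repr x.
Definition rassC (x : assC R) : SO3 R[i] * C := repr x.

Lemma rhomCK x : pi_homC (rhomC x) = x. Proof. exact: reprK. Qed.
Lemma rassCK x : pi_assC (rassC x) = x. Proof. exact: reprK. Qed.

Lemma pi_homC_surj x : exists g, @pi_homC R g = x. Proof. by exists (rhomC x); exact: rhomCK. Qed.
Lemma pi_assC_surj x : exists g, @pi_assC R g = x. Proof. by exists (rassC x); exact: rassCK. Qed.

Lemma homC_nu (g g' : SO3 R[i]) : pi_homC g = pi_homC g' <->
  exists2 a : C, a != 0 & nuC g' = a *: nuC g.
Proof. exact: homC_eqP. Qed.

Lemma assC_nu (x x' : SO3 R[i] * C) : pi_assC x = pi_assC x' <->
  exists2 a : C, a != 0 & nuC x'.1 = a *: nuC x.1 /\ x'.2 = a ^+ 2 * x.2.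
Proof. exact: assC_eqP. Qed.

Definition kel k (t : C) : SO3 R[i] :=
  exist _ (cycn C k *m kmx t) (inSO3M (inSO3_cycn _ k) (inSO3_kmx t)).

Lemma nuC_kel k t : nuC (kel k t) = cycn C k *m nv t.
Proof. by rewrite /nuC /= -mulmxA -nv0 kmx_nv addr0. Qed.

Definition hchart k : chart R[i] 1 (homC R) := Chart (domX nuC rhomC k)
  (fun x => vecC (tX nuC rhomC k x)) (fun y => pi_homC (kel k (y 0 0))).

Definition achart k : chart R[i] (1 + 1) (assC R) :=
  Chart [set e | cdom (hchart k) (proj_assC e)]
    (fun e => row_mx (cmap (hchart k) (proj_assC e)) (vecC (lE nuC rassC k e)))
    (fun y => pi_assC (kel k (lsubmx y 0 0), rsubmx y 0 0)).

Lemma vecCE (q : C) i j : vecC q i j = q. Proof. by rewrite mxE. Qed.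
Lemma vecC_eta (y : 'rV[C]_1) : vecC (y 0 0) = y.
Proof. by apply/rowP => i; rewrite mxE !ord1. Qed.

(** A section through [m]: the unipotent group translates the parameter. *)
Definition ksec k (m : SO3 R[i]) (t : C) : SO3 R[i] :=
  exist _ (cycn C k *m kmx (t - tf (lcoord k (nuC m))) *m ((cycn C k)^T *m val m))
   (inSO3M (inSO3M (inSO3_cycn _ k) (inSO3_kmx _))
      (inSO3M (inSO3T (inSO3_cycn _ k)) (valP m))).

Lemma ksec_id k m : ksec k m (tf (lcoord k (nuC m))) = m.
Proof.
apply: SO3_ext; rewrite /= subrr kmx0 mulmx1 SO3_Ktrm //; exact: inSO3_cycn.
Qed.

Lemma nuC_ksec k m t : af (lcoord k (nuC m)) != 0 ->
  nuC (ksec k m t) = af (lcoord k (nuC m)) *: (cycn C k *m nv t).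
Proof.
move=> a0; rewrite /nuC /= -!mulmxA -/(nuC m) -/(lcoord k _).
rewrite {2}(isotropicE (lcoord_iso nuC_iso k m) a0).
by rewrite -!scalemxAr kmx_nv subrK.
Qed.

Definition domA k : set 'M[C]_3 := [set A | af (lcoord k (A *m n0 R)) != 0].

Lemma hol_af k (O : set 'M[C]_3) : open O ->
  @holomorphic R _ _ O (fun A : 'M[C]_3 => af (lcoord k (A *m n0 R))).
Proof. move=> oO; rewrite /af /lcoord; regt rg oO. Qed.

Lemma open_domA k : open (domA k).
Proof.
have := reg_open_preim rg (@openT _) (@open_neq0 C) (hol_af k (@openT _)).
by rewrite setTI.
Qed.

Lemma hol_tf k : @holomorphic R _ _ (domA k) (fun A => tf (lcoord k (A *m n0 R))).
Proof.
have oO := @open_domA k; have ha := hol_af k oO.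
rewrite /tf; apply: (reg_mul rg oO); first by rewrite /lcoord; regt rg oO.
apply: (reg_inv rg oO); last by regt rg oO.
by move=> A dA; rewrite mulf_neq0 // two_neq0.
Qed.

Lemma hol_kmx (V : normedModType R[i]) (O : set V) (f : V -> C) : open O ->
  @holomorphic R _ _ O f -> @holomorphic R _ _ O (fun y => kmx (f y)).
Proof. by move=> oO fO; apply: (reg_mx3 rg oO); regt rg oO. Qed.

Lemma cimg_hchart k : cimg (hchart k) = setT.
Proof.
apply/seteqP; split=> // y _; exists (pi_homC (kel k (y 0 0))).
  by apply/(domX_pi rhomCK homC_nu); rewrite nuC_kel lcoord_cycn af_nv oner_neq0.
by rewrite /= (tX_pi rhomCK homC_nu) nuC_kel lcoord_cycn tf_nv vecC_eta.
Qed.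

Lemma hchart_atlas k : @homC_atlas R (hchart k).
Proof.
split.
  split; first by rewrite cimg_hchart; exact: openT.
  move=> x; rewrite -[x]rhomCK => dx /=; apply/homC_nu; exists (af (lcoord k (nuC (rhomC x)))).
    by have /(domX_pi rhomCK homC_nu) := dx.
  rewrite vecCE nuC_kel.
  exact: (nuE nuC_iso rhomCK homC_nu dx).
move=> m dm; have a0 := (domX_pi rhomCK homC_nu k m).1 dm; split.
  exists (domA k), (fun A => vecC (tf (lcoord k (A *m n0 R)))); split.
  - exact: open_domA.
  - exact: a0.
  - apply: (reg_mx rg (@open_domA k)) => i j.
    under [X in holomorphic _ X]eq_fun do rewrite vecCE.
    exact: hol_tf.
  - move=> m' dm'; split; first exact/(domX_pi rhomCK homC_nu).
    by rewrite /= (tX_pi rhomCK homC_nu).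
exists setT, (fun y => ksec k m (y 0 0)); split.
- exact: openT.
- by [].
- have oT := @openT 'rV[C]_1.
  rewrite /emb_SO3C /comp /=; apply: (reg_mulmx rg oT); last exact: (reg_cst rg).
  apply: (reg_mulmx rg oT); first exact: (reg_cst rg).
  by apply: (hol_kmx oT); regt rg oT.
- by rewrite /= vecCE (tX_pi rhomCK homC_nu) ksec_id.
- move=> y _; rewrite cimg_hchart; split; first by [].
  apply/homC_nu; exists (af (lcoord k (nuC m)))^-1; first by rewrite invr_eq0.
  by rewrite nuC_kel (nuC_ksec _ a0) scalerA mulVf // scale1r.
Qed.

End ComplexCharts.

Section SubMx.
Variables (K : numFieldType) (reg : regularity K) (rg : good_reg reg).

Lemma reg_lsubmx (V : normedModType K) n1 n2 (O : set V) (f : V -> 'rV[K]_(n1 + n2)) i j :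
  open O -> reg O f -> reg O (fun y => lsubmx (f y) i j).
Proof.
move=> oO fO; under [X in reg O X]eq_fun do rewrite mxE.
exact: (reg_coord rg).
Qed.

Lemma reg_rsubmx (V : normedModType K) n1 n2 (O : set V) (f : V -> 'rV[K]_(n1 + n2)) i j :
  open O -> reg O f -> reg O (fun y => rsubmx (f y) i j).
Proof.
move=> oO fO; under [X in reg O X]eq_fun do rewrite mxE.
exact: (reg_coord rg).
Qed.

End SubMx.

Section ComplexBundle.
Variable R : realType.
Notation C := (Num.NumField.sort R[i]).
Notation rg := (holomorphic_good R).
Notation VC := ('M[C]_3 * 'rV[C]_1)%type.

Lemma framedVC : framed VC. Proof. by apply: framed_prod; exact: framed_mx. Qed.

Lemma hol_vecC (V : normedModType R[i]) (O : set V) (f : V -> C) : open O ->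
  @holomorphic R _ _ O f -> @holomorphic R _ _ O (fun x => vecC (f x)).
Proof.
move=> oO fO; apply: (reg_mx rg oO) => i j.
by under [X in holomorphic _ X]eq_fun do rewrite vecCE.
Qed.

Definition domVC k : set VC := [set p | domA k p.1].

Lemma open_domVC k : open (domVC k).
Proof.
have h := reg_fst rg (framed_mx C 3 3) (framed_mx C 1 1) (@openT _) (reg_id rg (@setT VC)).
by have := reg_open_preim rg (@openT _) (@open_domA R k) h; rewrite setTI.
Qed.

Lemma hol_fst (O : set VC) : open O -> @holomorphic R _ _ O (fun p => p.1).
Proof. by move=> oO; apply: (reg_fst rg (framed_mx C 3 3) (framed_mx C 1 1) oO); exact: (reg_id rg). Qed.

Lemma hol_snd (O : set VC) : open O -> @holomorphic R _ _ O (fun p => p.2).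
Proof. by move=> oO; apply: (reg_snd rg (framed_mx C 3 3) (framed_mx C 1 1) oO); exact: (reg_id rg). Qed.

Lemma hol_tfl k : @holomorphic R _ _ (domVC k) (fun p => tf (lcoord k (p.1 *m n0 R))).
Proof.
apply: (reg_comp rg (framed_mx C 3 3) (@open_domA R k) (@open_domVC k) (@hol_tf R k)
  (hol_fst (@open_domVC k))).
by [].
Qed.

Lemma hol_lf k : @holomorphic R _ _ (domVC k)
  (fun p => lf (lcoord k (p.1 *m n0 R)) (p.2 0 0)).
Proof.
have oO := @open_domVC k; have f1 := hol_fst oO; have f2 := hol_snd oO.
rewrite /lf; apply: (reg_mul rg oO); first by apply: (reg_coord rg _ _ oO).
apply: (reg_inv rg oO); first by move=> p dp; rewrite expf_neq0.
apply: (reg_exp rg _ oO).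
exact: (reg_comp rg (framed_mx C 3 3) (@openT _) oO (@hol_af R k _ (@openT _)) f1).
Qed.

Lemma achart_dom k x : cdom (achart R k) (pi_assC x) <-> af (lcoord k (nuC x.1)) != 0.
Proof. by rewrite /achart /= proj_assCE; exact: (domX_pi (@rhomCK R) (@homC_nu R)). Qed.

Lemma achart_map k x : cmap (achart R k) (pi_assC x) =
  row_mx (vecC (tf (lcoord k (nuC x.1)))) (vecC (lf (lcoord k (nuC x.1)) x.2)).
Proof.
by rewrite /achart /= proj_assCE (tX_pi (@rhomCK R) (@homC_nu R)) (lE_pi (@rassCK R) (@assC_nu R)).
Qed.

Lemma row_mx_eta n1 n2 (y : 'rV[C]_(n1 + n2)) (f : 'rV[C]_n1) (g : 'rV[C]_n2) :
  f = lsubmx y -> g = rsubmx y -> row_mx f g = y.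
Proof. by move=> -> ->; exact: hsubmxK. Qed.

Lemma lf1 (n : 'cV[C]_3) (q : C) : af n = 1 -> lf n q = q.
Proof. by move=> a1; rewrite /lf a1 expr1n divr1. Qed.

Lemma cimg_achart k : cimg (achart R k) = setT.
Proof.
apply/seteqP; split=> // y _; exists (pi_assC (kel k (lsubmx y 0 0), rsubmx y 0 0)).
  by apply/achart_dom; rewrite /= nuC_kel lcoord_cycn af_nv oner_neq0.
rewrite achart_map nuC_kel lcoord_cycn tf_nv lf1 ?af_nv //.
by apply: row_mx_eta; exact: vecC_eta.
Qed.

Lemma achart_atlas k : @assC_atlas R (achart R k).
Proof.
split.
  split; first by rewrite cimg_achart; exact: openT.
  move=> e; rewrite -[e]rassCK; set x := rassC e => /achart_dom dx.
  rewrite achart_map /achart /=; apply/assC_nu; exists (af (lcoord k (nuC x.1))) => //=.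
  rewrite row_mxKl row_mxKr !vecCE nuC_kel; split; last by rewrite /lf; field.
  have := nuE (@nuC_iso R) (@rhomCK R) (@homC_nu R) (k := k) (g := x.1).
  rewrite (tX_pi (@rhomCK R) (@homC_nu R)); apply.
  exact/(domX_pi (@rhomCK R) (@homC_nu R)).
move=> m /achart_dom a0; split.
  exists (domVC k), (fun p : VC => row_mx (vecC (tf (lcoord k (p.1 *m n0 R))))
    (vecC (lf (lcoord k (p.1 *m n0 R)) (p.2 0 0)))); split.
  - exact: open_domVC.
  - exact: a0.
  - apply: (reg_row_mx rg (@open_domVC k)); apply: (hol_vecC (@open_domVC k)).
      exact: hol_tfl.
    exact: hol_lf.
  - move=> m' dm'; split; first exact/achart_dom.
    by rewrite achart_map /emb_SO3CxC /= vecCE.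
exists setT, (fun y => (ksec k m.1 (lsubmx y 0 0),
  af (lcoord k (nuC m.1)) ^+ 2 * rsubmx y 0 0)); split.
- exact: openT.
- by [].
- have oT := @openT 'rV[C]_(1 + 1).
  rewrite /emb_SO3CxC /comp /=; apply: (reg_pair rg (framed_mx C 3 3) (framed_mx C 1 1) oT).
    apply: (reg_mulmx rg oT); last exact: (reg_cst rg).
    apply: (reg_mulmx rg oT); first exact: (reg_cst rg).
    apply: (hol_kmx oT); apply: (reg_subr rg oT); last exact: (reg_cst rg).
    by apply: (reg_lsubmx rg _ _ oT); exact: (reg_id rg).
  apply: (hol_vecC oT); apply: (reg_mul rg oT); first exact: (reg_cst rg).
  by apply: (reg_rsubmx rg _ _ oT); exact: (reg_id rg).
- rewrite achart_map row_mxKl row_mxKr !vecCE ksec_id; case: (m) a0 => g q /= a0.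
  by congr pair; rewrite /lf; field.
- move=> y _; rewrite cimg_achart; split; first by [].
  apply/assC_nu; exists (af (lcoord k (nuC m.1)))^-1; first by rewrite invr_eq0.
  rewrite /= nuC_kel (nuC_ksec _ a0) scalerA mulVf // scale1r; split=> //.
  by field.
Qed.

Lemma homC_common x x' : exists k, cdom (hchart R k) x /\ cdom (hchart R k) x'.
Proof. exact: (domX_common (@rhomC R) (@nuC_iso R) (@nuC_neq0 R) x x').
Qed.

Lemma homC_manifold : is_manifold (@holomorphic R) (@homC_atlas R).
Proof.
apply: (quot_manifold rg (framed_mx C 3 3) (@pi_homC_surj R) (@hchart_atlas R)).
exact: homC_common.
Qed.

Lemma assC_manifold : is_manifold (@holomorphic R) (@assC_atlas R).
Proof.
apply: (quot_manifold rg framedVC (@pi_assC_surj R) achart_atlas).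
by move=> e e'; exact: homC_common.
Qed.

Lemma assC_bundle : is_vector_bundle (@holomorphic R) (L := R[i]^o) (@vecC R)
  (@assC_atlas R) (@homC_atlas R) (@proj_assC R) (@lin_assC R).
Proof.
split; [exact: assC_manifold|exact: homC_manifold|move=> x].
have [k [kx _]] := homC_common x x.
exists (hchart R k), (lE (@nuC R) (@rassC R) k), (cinv (achart R k)); split.
- by split; [exact: hchart_atlas|exact: kx].
- exact: achart_atlas.
- move=> y l dy.
  exact: (lE_surj (@rhomCK R) (@rassCK R) (@homC_nu R) (@assC_nu R) (@proj_assCE R) l dy).
- move=> a e1 e2 e3 d1.
  exact: (linEP (@rhomCK R) (@rassCK R) (@homC_nu R) (@assC_nu R) (@proj_assCE R) a e2 e3 d1).
Qed.

End ComplexBundle.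

(** * Charts of the real bundle *)

Section ComplexValuedSmooth.
Variable R : realType.
Notation C := (Num.NumField.sort R[i]).
Notation rg := (smooth_good R).
Variables (V : normedModType R) (O : set V).
Hypothesis oO : open O.
Implicit Types f g : V -> C.

(** As [C] is not a normed space over [R], smoothness is tested on the real and
    the imaginary part. *)
Definition csm f := @smooth R V R O (fun x => complex.Re (f x)) /\
  @smooth R V R O (fun x => complex.Im (f x)).

Lemma csm_cst c : csm (fun=> c). Proof. by split; exact: (reg_cst rg). Qed.

Lemma csm_real (f : V -> R) : @smooth R V R O f -> csm (fun x => (f x)%:C).
Proof. by move=> fO; split=> //; exact: (reg_cst rg). Qed.

Lemma csm_ext f g : (forall x, f x = g x) -> csm f -> csm g.
Proof. by move=> /funext ->. Qed.

Lemma csm_add f g : csm f -> csm g -> csm (fun x => f x + g x).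
Proof.
move=> [f1 f2] [g1 g2]; split.
  by under [X in smooth _ X]eq_fun do rewrite raddfD; exact: (reg_add rg oO).
by under [X in smooth _ X]eq_fun do rewrite raddfD; exact: (reg_add rg oO).
Qed.

Lemma csm_opp f : csm f -> csm (fun x => - f x).
Proof.
move=> [f1 f2]; split.
  by under [X in smooth _ X]eq_fun do rewrite raddfN; exact: (reg_opp rg oO).
by under [X in smooth _ X]eq_fun do rewrite raddfN; exact: (reg_opp rg oO).
Qed.

Lemma csm_sub f g : csm f -> csm g -> csm (fun x => f x - g x).
Proof. by move=> fO gO; apply: csm_add => //; exact: csm_opp. Qed.

Lemma ReM (z w : C) : complex.Re (z * w) =
  complex.Re z * complex.Re w - complex.Im z * complex.Im w.
Proof. by case: z w => ? ? [? ?]. Qed.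

Lemma ImM (z w : C) : complex.Im (z * w) =
  complex.Re z * complex.Im w + complex.Im z * complex.Re w.
Proof. by case: z w => ? ? [? ?]. Qed.

Lemma csm_mul f g : csm f -> csm g -> csm (fun x => f x * g x).
Proof.
move=> [f1 f2] [g1 g2]; split.
  under [X in smooth _ X]eq_fun do rewrite ReM.
  by apply: (reg_subr rg oO); apply: (reg_mul rg oO).
under [X in smooth _ X]eq_fun do rewrite ImM.
by apply: (reg_add rg oO); apply: (reg_mul rg oO).
Qed.

Lemma csm_exp f n : csm f -> csm (fun x => f x ^+ n).
Proof.
move=> fO; elim: n => [|n IH]; first exact: csm_cst.
by apply: csm_ext (csm_mul fO IH) => x; rewrite exprS.
Qed.

Definition sqn (z : C) : R := complex.Re z ^+ 2 + complex.Im z ^+ 2.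

Lemma sqn_neq0 z : (sqn z != 0) = (z != 0).
Proof.
rewrite /sqn paddr_eq0 ?sqr_ge0 // !sqrf_eq0.
by case: z => x y; rewrite eq_complex.
Qed.

Lemma smooth_sqn f : csm f -> @smooth R V R O (fun x => sqn (f x)).
Proof. by move=> [f1 f2]; apply: (reg_add rg oO); apply: (reg_exp rg _ oO). Qed.

Lemma csm_inv f : (forall x, O x -> f x != 0) -> csm f -> csm (fun x => (f x)^-1).
Proof.
move=> f0 fO; have n0 : forall x, O x -> sqn (f x) != 0.
  by move=> x Ox; rewrite sqn_neq0 f0.
have iO := reg_inv rg oO n0 (smooth_sqn fO).
have E z : z^-1 = (complex.Re z / sqn z) +i* (- (complex.Im z / sqn z)) :> C.
  by case: z.
move: fO => [f1 f2]; split.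
  under [X in smooth _ X]eq_fun do rewrite E /=.
  exact: (reg_mul rg oO).
under [X in smooth _ X]eq_fun do rewrite E /=.
by apply: (reg_opp rg oO); exact: (reg_mul rg oO).
Qed.

Lemma smooth_vecR f : csm f -> @smooth R V _ O (fun x => vecR (f x)).
Proof.
move=> [f1 f2]; apply: (reg_mx rg oO) => i j.
by case: j => [[|[|//]] ?]; under [X in smooth _ X]eq_fun do rewrite mxE.
Qed.

Lemma smooth_real_vec f : csm f -> @smooth R V _ O (fun x => real_vec (vecC (f x))).
Proof.
move=> [f1 f2]; apply: (reg_row_mx rg oO); apply: (reg_mx rg oO) => i j;
  by under [X in smooth _ X]eq_fun do rewrite !mxE.
Qed.

Lemma smooth_rmx (f g : V -> R) : @smooth R V _ O f -> @smooth R V _ O g ->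
  @smooth R V _ O (fun x => rmx (f x) (g x)).
Proof.
move=> fO gO; rewrite /rmx; apply: (reg_scale rg oO).
  apply: (reg_inv rg oO); first by move=> x _; rewrite gt_eqF // den_gt0.
  by rewrite /den; regt (smooth_good R) oO.
by apply: (reg_mx3 rg oO); regt (smooth_good R) oO.
Qed.

Lemma csm_lcoord k (f : V -> 'M[R]_3) i : @smooth R V _ O f ->
  csm (fun x => lcoord k (cm (f x) *m n0 R) i 0).
Proof.
move=> fO; have e a b : csm (fun x => cm (f x) a b).
  apply: csm_ext (csm_real (reg_coord rg a b oO fO)) => x.
  by rewrite mxE.
have en a : csm (fun x => (cm (f x) *m n0 R) a 0).
  have := csm_add (csm_add (csm_mul (e a o0) (csm_cst (n0 R o0 0)))
    (csm_mul (e a o1) (csm_cst (n0 R o1 0)))) (csm_mul (e a o2) (csm_cst (n0 R o2 0))).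
  by apply: csm_ext => x; rewrite [in RHS]mulmx3E.
pose h a := (cycn C k)^T i a.
have := csm_add (csm_add (csm_mul (csm_cst (h o0)) (en o0))
    (csm_mul (csm_cst (h o1)) (en o1))) (csm_mul (csm_cst (h o2)) (en o2)).
by apply: csm_ext => x; rewrite [in RHS]mulmx3E.
Qed.

Lemma csm_af (n : V -> 'cV[C]_3) : (forall i, csm (fun x => n x i 0)) ->
  csm (fun x => af (n x)).
Proof.
move=> nO; apply: csm_mul; last exact: csm_cst.
by apply: csm_sub => //; apply: csm_mul => //; exact: csm_cst.
Qed.

Lemma csm_tf (n : V -> 'cV[C]_3) : (forall x, O x -> af (n x) != 0) ->
  (forall i, csm (fun x => n x i 0)) -> csm (fun x => tf (n x)).
Proof.
move=> n0 nO; apply: csm_mul => //; apply: csm_inv.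
  by move=> x Ox; rewrite mulf_neq0 ?two_neq0 ?n0.
by apply: csm_mul; [exact: csm_cst|exact: csm_af].
Qed.

Lemma csm_lf (n : V -> 'cV[C]_3) q : (forall x, O x -> af (n x) != 0) ->
  (forall i, csm (fun x => n x i 0)) -> csm q -> csm (fun x => lf (n x) (q x)).
Proof.
move=> n0 nO qO; apply: csm_mul => //; apply: csm_inv.
  by move=> x Ox; rewrite expf_neq0 ?n0.
by apply: csm_exp; exact: csm_af.
Qed.

End ComplexValuedSmooth.

Section RealCharts.
Variable R : realType.
Notation C := (Num.NumField.sort R[i]).
Notation rg := (smooth_good R).

Definition nuR (g : SO3 R) : 'cV[C]_3 := cm (val g) *m n0 R.

Lemma nuR_iso g : bil (nuR g) (nuR g) = 0.
Proof. exact: (nuC_iso (SO3incl g)). Qed.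

Lemma nuR_neq0 g : nuR g != 0.
Proof. exact: (nuC_neq0 (SO3incl g)). Qed.

Definition rhomR (x : homR R) : SO3 R := repr x.
Definition rassR (x : assR R) : SO3 R * C := repr x.

Lemma rhomRK x : pi_homR (rhomR x) = x. Proof. exact: reprK. Qed.
Lemma rassRK x : pi_assR (rassR x) = x. Proof. exact: reprK. Qed.
Lemma pi_homR_surj x : exists g, @pi_homR R g = x. Proof. by exists (rhomR x); exact: rhomRK. Qed.
Lemma pi_assR_surj x : exists g, @pi_assR R g = x. Proof. by exists (rassR x); exact: rassRK. Qed.

Lemma homR_nu (g g' : SO3 R) : pi_homR g = pi_homR g' <->
  exists2 a : C, a != 0 & nuR g' = a *: nuR g.
Proof. exact: homR_eqP. Qed.

Lemma assR_nu (x x' : SO3 R * C) : pi_assR x = pi_assR x' <->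
  exists2 a : C, a != 0 & nuR x'.1 = a *: nuR x.1 /\ x'.2 = a ^+ 2 * x.2.
Proof. exact: assR_eqP. Qed.

Definition rmxc (t : C) : 'M[R]_3 := rmx (complex.Re t) (complex.Im t).
Definition denc (t : C) : C := (den (complex.Re t) (complex.Im t))%:C.

Lemma denc_neq0 t : denc t != 0.
Proof. by rewrite eq_complex /= eqxx andbT gt_eqF // den_gt0. Qed.

Lemma rmxc_n0 t : cm (rmxc t) *m n0 R = (denc t)^-1 *: nv t.
Proof.
rewrite /rmxc rmx_n0 /denc; case: t => x y /=; congr (_ *: _).
by rewrite (fmorphV (real_complex R)).
Qed.

Lemma inSO3_rmxc t : inSO3 (rmxc t). Proof. exact: inSO3_rmx. Qed.

Definition rotel k (t : C) : SO3 R :=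
  exist _ (cycn R k *m rmxc t) (inSO3M (inSO3_cycn _ k) (inSO3_rmxc t)).

Lemma nuR_rel k t : nuR (rotel k t) = (denc t)^-1 *: (cycn C k *m nv t).
Proof. by rewrite /nuR /= cmM cm_cycn -mulmxA rmxc_n0 -scalemxAr. Qed.

(** Since [rmxc] is not a homomorphism, [m] is first moved to the parameter 0 by
    the transpose of the rotation at its own parameter. *)
Definition rsec k (m : SO3 R) (t : C) : SO3 R :=
  exist _ (cycn R k *m rmxc t *m ((rmxc (tf (lcoord k (nuR m))))^T *m ((cycn R k)^T *m val m)))
   (inSO3M (inSO3M (inSO3_cycn _ k) (inSO3_rmxc _))
      (inSO3M (inSO3T (inSO3_rmxc _)) (inSO3M (inSO3T (inSO3_cycn _ k)) (valP m)))).

(** The factor between [nuR m] and the representative of its line, see [rel_nu]. *)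
Definition rscale k (m : SO3 R) : C :=
  af (lcoord k (nuR m)) * denc (tf (lcoord k (nuR m))).

Lemma rsec_id k m : rsec k m (tf (lcoord k (nuR m))) = m.
Proof.
apply: SO3_ext; rewrite /= -mulmxA SO3_Ktrm ?SO3_Ktrm //; first exact: inSO3_cycn.
exact: inSO3_rmxc.
Qed.

Lemma nuR_rsec k m t : af (lcoord k (nuR m)) != 0 ->
  nuR (rsec k m t) = (rscale k m / denc t) *: (cycn C k *m nv t).
Proof.
move=> a0; set t0 := tf (lcoord k (nuR m)).
have stab : cm (rmxc t0)^T *m lcoord k (nuR m) = rscale k m *: n0 R.
  rewrite {1}(isotropicE (lcoord_iso nuR_iso k m) a0) -/t0.
  have -> : nv t0 = denc t0 *: (cm (rmxc t0) *m n0 R).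
    by rewrite rmxc_n0 scalerA divff ?denc_neq0 // scale1r.
  rewrite scalerA -scalemxAr mulmxA -cmM SO3_trK ?(inSO3_rmxc t0) //.
  by rewrite /cm map_mx1 mul1mx.
rewrite /nuR /= !cmM -!mulmxA -/(nuR m) (cm_tr (cycn R k)) cm_cycn -/(lcoord k _) -/t0.
by rewrite stab -!scalemxAr rmxc_n0 -scalemxAr scalerA.
Qed.

Definition tC (y : 'rV[R]_(1 + 1)) : C := (lsubmx y 0 0) +i* (rsubmx y 0 0).

Definition hchartR k : chart R 2 (homR R) := @Chart R (1 + 1) _ (domX nuR rhomR k)
  (fun x => real_vec (vecC (tX nuR rhomR k x))) (fun y => pi_homR (rotel k (tC y))).

Lemma tC_real_vec (z : C) : tC (real_vec (vecC z)) = z.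
Proof. by rewrite /tC /real_vec row_mxKl row_mxKr !mxE; case: z. Qed.

Lemma real_vec_tC y : real_vec (vecC (tC y)) = y.
Proof.
rewrite -[RHS]hsubmxK /real_vec; congr row_mx; apply/rowP => j;
  by rewrite !ord1 !mxE /tC /= mxE.
Qed.

Lemma csm_tC (V : normedModType R) (O : set V) (f : V -> 'rV[R]_(1 + 1)) : open O ->
  @smooth R V _ O f -> csm O (fun y => tC (f y)).
Proof.
move=> oO fO; split=> /=.
  exact: (reg_lsubmx rg _ _ oO).
exact: (reg_rsubmx rg _ _ oO).
Qed.

Lemma smooth_rmxc (V : normedModType R) (O : set V) (f : V -> C) : open O ->
  csm O f -> @smooth R V _ O (fun y => rmxc (f y)).
Proof. by move=> oO [f1 f2]; exact: smooth_rmx. Qed.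

Lemma csm_denc (V : normedModType R) (O : set V) (f : V -> C) : open O ->
  csm O f -> csm O (fun y => denc (f y)).
Proof.
move=> oO [f1 f2]; apply: csm_real; rewrite /den.
by apply: (reg_add rg oO); [apply: (reg_add rg oO); first exact: (reg_cst rg)|]; apply: (reg_exp rg _ oO).
Qed.

Definition domR k : set 'M[R]_3 := [set A | af (lcoord k (cm A *m n0 R)) != 0].

Lemma csm_lcoord_id k i (O : set 'M[R]_3) : open O ->
  csm O (fun A => lcoord k (cm A *m n0 R) i 0).
Proof. by move=> oO; apply: (csm_lcoord oO); exact: (reg_id rg). Qed.

Lemma open_domR k : open (domR k).
Proof.
have h := smooth_sqn (@openT _) (csm_af (@openT _) (fun i => csm_lcoord_id k i (@openT _))).
have := reg_open_preim rg (@openT _) (@open_neq0 R) h; rewrite setTI.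
suff -> : domR k = (fun A => sqn (af (lcoord k (cm A *m n0 R)))) @^-1` [set z | z != 0] by [].
by apply/funext => A; rewrite /domR /= sqn_neq0.
Qed.

Lemma af_rel k t : af (lcoord k (nuR (rotel k t))) = (denc t)^-1.
Proof. by rewrite nuR_rel lcoordZ lcoord_cycn afZ af_nv mulr1. Qed.

Lemma tf_rel k t : tf (lcoord k (nuR (rotel k t))) = t.
Proof.
by rewrite nuR_rel lcoordZ lcoord_cycn tfZ ?tf_nv // invr_eq0 denc_neq0.
Qed.

Lemma cimg_hchartR k : cimg (hchartR k) = setT.
Proof.
apply/seteqP; split=> // y _; exists (pi_homR (rotel k (tC y))).
  by apply/(domX_pi rhomRK homR_nu); rewrite af_rel invr_eq0 denc_neq0.
by rewrite /= (tX_pi rhomRK homR_nu) tf_rel real_vec_tC.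
Qed.

Lemma rel_nu k m : af (lcoord k (nuR m)) != 0 ->
  nuR m = rscale k m *: nuR (rotel k (tf (lcoord k (nuR m)))).
Proof.
move=> a0; rewrite nuR_rel scalerA /rscale -mulrA divff ?denc_neq0 // mulr1.
have := nuE nuR_iso rhomRK homR_nu (k := k) (g := m).
rewrite (tX_pi rhomRK homR_nu); apply.
exact/(domX_pi rhomRK homR_nu).
Qed.

Lemma rscale_neq0 k m : af (lcoord k (nuR m)) != 0 -> rscale k m != 0.
Proof. by move=> a0; rewrite mulf_neq0 // denc_neq0. Qed.

Lemma hchartR_atlas k : @homR_atlas R (hchartR k).
Proof.
split.
  split; first by rewrite cimg_hchartR; exact: openT.
  move=> x; rewrite -[x]rhomRK => dx; apply/homR_nu.
  have a0 := (domX_pi rhomRK homR_nu k _).1 dx.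
  exists (rscale k (rhomR x)); first exact: rscale_neq0.
  by rewrite tC_real_vec (tX_pi rhomRK homR_nu) -rel_nu.
move=> m dm; have a0 := (domX_pi rhomRK homR_nu k m).1 dm; split.
  exists (domR k), (fun A => real_vec (vecC (tf (lcoord k (cm A *m n0 R))))); split.
  - exact: open_domR.
  - exact: a0.
  - apply: (smooth_real_vec (@open_domR k)); apply: (csm_tf (@open_domR k)) => // i.
    exact: (csm_lcoord_id _ _ (@open_domR k)).
  - move=> m' dm'; split; first exact/(domX_pi rhomRK homR_nu).
    by rewrite /= (tX_pi rhomRK homR_nu).
exists setT, (fun y => rsec k m (tC y)); split.
- exact: openT.
- by [].
- have oT := @openT 'rV[R]_(1 + 1).
  rewrite /emb_SO3R /comp /=; apply: (reg_mulmx rg oT); last exact: (reg_cst rg).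
  apply: (reg_mulmx rg oT); first exact: (reg_cst rg).
  by apply: (smooth_rmxc oT); apply: (csm_tC oT); exact: (reg_id rg).
- by rewrite /= tC_real_vec (tX_pi rhomRK homR_nu) rsec_id.
- move=> y _; rewrite cimg_hchartR; split; first by [].
  apply/homR_nu; exists (rscale k m)^-1; first by rewrite invr_eq0 rscale_neq0.
  rewrite nuR_rel (nuR_rsec _ a0) scalerA mulrA mulVf ?mul1r //.
  exact: rscale_neq0.
Qed.

End RealCharts.

Section RealBundle.
Variable R : realType.
Notation C := (Num.NumField.sort R[i]).
Notation rg := (smooth_good R).
Notation VR := ('M[R]_3 * 'rV[R]_2)%type.

Definition lC (y : 'rV[R]_2) : C := y 0 (@Ordinal 2 0 isT) +i* y 0 (@Ordinal 2 1 isT).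

Lemma lC_vecR (q : C) : lC (vecR q) = q.
Proof. by rewrite /lC !mxE /=; case: q. Qed.

Lemma vecR_lC y : vecR (lC y) = y.
Proof.
by apply/rowP => -[[|[|//]] p]; rewrite mxE /=; congr (y _ _); exact: val_inj.
Qed.

Lemma csm_lC (V : normedModType R) (O : set V) (f : V -> 'rV[R]_2) : open O ->
  @smooth R V _ O f -> csm O (fun y => lC (f y)).
Proof. by move=> oO fO; split; exact: (reg_coord rg _ _ oO). Qed.

(** As [nuR (rotel k t)] has the factor [(denc t)^-1], the fibre coordinate carries
    [(denc t)^-2]. *)
Definition achartR k : chart R (2 + 2) (assR R) :=
  Chart [set e | cdom (hchartR R k) (proj_assR e)]
    (fun e => row_mx (cmap (hchartR R k) (proj_assR e))
       (vecR (lE (@nuR R) (@rassR R) k e)))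
    (fun y => pi_assR (rotel k (tC (lsubmx y : 'rV_(1 + 1))),
       lC (rsubmx y) / denc (tC (lsubmx y : 'rV_(1 + 1))) ^+ 2)).

Lemma framedVR : framed VR. Proof. by apply: framed_prod; exact: framed_mx. Qed.

Definition domVR k : set VR := [set p | domR k p.1].

Lemma smooth_fst (O : set VR) : open O -> @smooth R _ _ O (fun p => p.1).
Proof. by move=> oO; apply: (reg_fst rg (framed_mx R 3 3) (framed_mx R 1 2) oO); exact: (reg_id rg). Qed.

Lemma smooth_snd (O : set VR) : open O -> @smooth R _ _ O (fun p => p.2).
Proof. by move=> oO; apply: (reg_snd rg (framed_mx R 3 3) (framed_mx R 1 2) oO); exact: (reg_id rg). Qed.

Lemma open_domVR k : open (domVR k).
Proof.
have := reg_open_preim rg (@openT _) (@open_domR R k) (smooth_fst (@openT _)).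
by rewrite setTI.
Qed.

Lemma achartR_dom k x : cdom (achartR k) (pi_assR x) <-> af (lcoord k (nuR x.1)) != 0.
Proof. by rewrite /achartR /= proj_assRE; exact: (domX_pi (@rhomRK R) (@homR_nu R)). Qed.

Lemma achartR_map k x : cmap (achartR k) (pi_assR x) =
  row_mx (real_vec (vecC (tf (lcoord k (nuR x.1))))) (vecR (lf (lcoord k (nuR x.1)) x.2)).
Proof.
by rewrite /achartR /= proj_assRE (tX_pi (@rhomRK R) (@homR_nu R)) (lE_pi (@rassRK R) (@assR_nu R)).
Qed.

Lemma cimg_achartR k : cimg (achartR k) = setT.
Proof.
apply/seteqP; split=> // y _; exists (cinv (achartR k) y).
  by apply/achartR_dom; rewrite /= af_rel invr_eq0 denc_neq0.
rewrite achartR_map /= tf_rel real_vec_tC /lf af_rel.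
rewrite (_ : _ / _ = lC (rsubmx y)) ?vecR_lC ?hsubmxK //.
by field; rewrite denc_neq0.
Qed.

Lemma csm_lcoordVR k i (O : set VR) : open O ->
  csm O (fun p => lcoord k (cm p.1 *m n0 R) i 0).
Proof. by move=> oO; apply: (csm_lcoord oO); exact: smooth_fst. Qed.

Lemma achartR_atlas k : @assR_atlas R (achartR k).
Proof.
split.
  split; first by rewrite cimg_achartR; exact: openT.
  move=> e; rewrite -[e]rassRK; set x := rassR e => /achartR_dom a0.
  rewrite achartR_map /achartR /=; apply/assR_nu; exists (rscale k x.1).
    exact: rscale_neq0.
  rewrite /= row_mxKl row_mxKr tC_real_vec lC_vecR -(rel_nu a0); split=> //.
  by rewrite /lf /rscale; field; rewrite a0 denc_neq0.
move=> m /achartR_dom a0; split.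
  exists (domVR k), (fun p : VR => row_mx (real_vec (vecC (tf (lcoord k (cm p.1 *m n0 R)))))
    (vecR (lf (lcoord k (cm p.1 *m n0 R)) (lC p.2)))); split.
  - exact: open_domVR.
  - exact: a0.
  - have oO := @open_domVR k; apply: (reg_row_mx rg oO).
      apply: (smooth_real_vec oO); apply: (csm_tf oO) => // i; exact: csm_lcoordVR.
    apply: (smooth_vecR oO); apply: (csm_lf oO) => //.
      by move=> i; exact: csm_lcoordVR.
    by apply: (csm_lC oO); exact: smooth_snd.
  - move=> m' dm'; split; first exact/achartR_dom.
    by rewrite achartR_map /emb_SO3RxC /= lC_vecR.
exists setT, (fun y => (rsec k m.1 (tC (lsubmx y : 'rV_(1 + 1))),
  (rscale k m.1 / denc (tC (lsubmx y : 'rV_(1 + 1)))) ^+ 2 * lC (rsubmx y))); split.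
- exact: openT.
- by [].
- have oT := @openT 'rV[R]_(2 + 2).
  have lsm : @smooth R _ _ setT (fun y : 'rV[R]_(2 + 2) => lsubmx y).
    by apply: (reg_mx rg oT) => i j; apply: (reg_lsubmx rg _ _ oT); exact: (reg_id rg).
  have rsm : @smooth R _ _ setT (fun y : 'rV[R]_(2 + 2) => rsubmx y).
    by apply: (reg_mx rg oT) => i j; apply: (reg_rsubmx rg _ _ oT); exact: (reg_id rg).
  have tsm := csm_tC oT (lsm : @smooth R _ 'rV[R]_(1 + 1) _ _).
  rewrite /emb_SO3RxC /comp /=; apply: (reg_pair rg (framed_mx R 3 3) (framed_mx R 1 2) oT).
    apply: (reg_mulmx rg oT); last exact: (reg_cst rg).
    apply: (reg_mulmx rg oT); first exact: (reg_cst rg).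
    exact: (smooth_rmxc oT tsm).
  apply: (smooth_vecR oT); apply: (csm_mul oT); last exact: (csm_lC oT rsm).
  apply: (csm_exp oT); apply: (csm_mul oT); first exact: csm_cst.
  apply: (csm_inv oT); last exact: (csm_denc oT tsm).
  by move=> y _; exact: denc_neq0.
- rewrite achartR_map row_mxKl row_mxKr tC_real_vec lC_vecR rsec_id; case: (m) a0 => g q /= a0.
  by congr pair; rewrite /lf /rscale; field; rewrite a0 denc_neq0.
- move=> y _; rewrite cimg_achartR; split; first by [].
  apply/assR_nu; exists (rscale k m.1)^-1; first by rewrite invr_eq0 rscale_neq0.
  rewrite /= nuR_rel (nuR_rsec _ a0) scalerA; split.
    by rewrite mulrA mulVf ?mul1r // rscale_neq0.
  by field; rewrite denc_neq0 rscale_neq0.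
Qed.

Lemma homR_common x x' : exists k, cdom (hchartR R k) x /\ cdom (hchartR R k) x'.
Proof. exact: (domX_common (@rhomR R) (@nuR_iso R) (@nuR_neq0 R) x x'). Qed.

Lemma homR_manifold : is_manifold (@smooth R) (@homR_atlas R).
Proof.
apply: (quot_manifold rg (framed_mx R 3 3) (@pi_homR_surj R) (@hchartR_atlas R)).
exact: homR_common.
Qed.

Lemma assR_manifold : is_manifold (@smooth R) (@assR_atlas R).
Proof.
apply: (quot_manifold rg framedVR (@pi_assR_surj R) achartR_atlas).
by move=> e e'; exact: homR_common.
Qed.

Lemma assR_linP k (a : C) e1 e2 e3 : cdom (hchartR R k) (proj_assR e1) ->
  lin_assR a e1 e2 e3 <->
  [/\ proj_assR e2 = proj_assR e1, proj_assR e3 = proj_assR e1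
    & lE (@nuR R) (@rassR R) k e3 = a * lE (@nuR R) (@rassR R) k e1 + lE (@nuR R) (@rassR R) k e2].
Proof.
exact: (linEP (@rhomRK R) (@rassRK R) (@homR_nu R) (@assR_nu R) (@proj_assRE R) a e2 e3).
Qed.

Lemma assR_fibre k y (l : C) : cdom (hchartR R k) y ->
  exists e, proj_assR e = y /\ lE (@nuR R) (@rassR R) k e = l.
Proof.
exact: (lE_surj (@rhomRK R) (@rassRK R) (@homR_nu R) (@assR_nu R) (@proj_assRE R) l).
Qed.

Lemma assR_bundle : is_vector_bundle (@smooth R) (L := R[i]^o) (@vecR R)
  (@assR_atlas R) (@homR_atlas R) (@proj_assR R) (@lin_assR R).
Proof.
split; [exact: assR_manifold|exact: homR_manifold|move=> x].
have [k [kx _]] := homR_common x x.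
exists (hchartR R k), (lE (@nuR R) (@rassR R) k), (cinv (achartR k)); split.
- by split; [exact: hchartR_atlas|exact: kx].
- exact: achartR_atlas.
- by move=> y l; exact: assR_fibre.
- by move=> a e1 e2 e3; exact: assR_linP.
Qed.

(** Defined through representatives; [homR_homCE] and [assR_assCE] show that they
    are induced by the inclusion. *)
Definition homR_homC (x : homR R) : homC R := pi_homC (SO3incl (rhomR x)).
Definition assR_assC (e : assR R) : assC R := pi_assC (SO3incl (rassR e).1, (rassR e).2).

Lemma nuC_incl g : nuC (SO3incl g) = nuR g :> 'cV[C]_3. Proof. by []. Qed.

Lemma homR_homCE g : homR_homC (pi_homR g) = pi_homC (SO3incl g).
Proof.
apply/homC_nu; rewrite !nuC_incl.
by apply/homR_nu; rewrite rhomRK.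
Qed.

Lemma assR_assCE x : assR_assC (pi_assR x) = pi_assC (SO3incl x.1, x.2).
Proof.
apply/assC_nu; rewrite /= !nuC_incl.
by apply/assR_nu; rewrite rassRK.
Qed.

Lemma homR_homC_inj : injective homR_homC.
Proof.
move=> x x'; rewrite -[x]rhomRK -[x']rhomRK !homR_homCE => /homC_nu.
by rewrite !nuC_incl => /homR_nu.
Qed.

Lemma assR_assC_inj : injective assR_assC.
Proof.
move=> x x'; rewrite -[x]rassRK -[x']rassRK !assR_assCE => /assC_nu.
by rewrite /= !nuC_incl => /assR_nu.
Qed.

(** The rotation [rotel k t] is real and has the parameter [t] of the given line. *)
Lemma real_repr (g : SO3 R[i]) : exists (h : SO3 R) (a : C),
  a != 0 /\ nuC g = a *: nuR h.
Proof.
have [k [dk _]] := homC_common (pi_homC g) (pi_homC g).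
have a0 := (domX_pi (@rhomCK R) (@homC_nu R) k g).1 dk.
have E := nuE (@nuC_iso R) (@rhomCK R) (@homC_nu R) dk.
set t := tX _ _ _ _ in E.
exists (rotel k t), (af (lcoord k (nuC g)) * denc t); split.
  by rewrite mulf_neq0 // denc_neq0.
by rewrite nuR_rel scalerA -mulrA divff ?denc_neq0 // mulr1.
Qed.

Lemma homR_homC_surj y : exists x, homR_homC x = y.
Proof.
rewrite -[y]rhomCK; have [h [a [a0 E]]] := real_repr (rhomC y).
by exists (pi_homR h); rewrite homR_homCE; apply/homC_nu; exists a; rewrite ?nuC_incl.
Qed.

Lemma assR_assC_surj y : exists x, assR_assC x = y.
Proof.
rewrite -[y]rassCK; case: (rassC y) => g q.
have [h [a [a0 E]]] := real_repr g.
exists (pi_assR (h, a ^- 2 * q)); rewrite assR_assCE; apply/assC_nu; exists a => //=.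
by rewrite nuC_incl; split=> //; field.
Qed.

Lemma proj_assR_assC e : proj_assC (assR_assC e) = homR_homC (proj_assR e).
Proof. by rewrite -[e]rassRK assR_assCE proj_assRE proj_assCE homR_homCE. Qed.

Lemma bij_inverse (A B : Type) (f : A -> B) : injective f ->
  (forall y, exists x, f x = y) -> exists g, cancel f g /\ cancel g f.
Proof.
move=> fI fS; have [g gK] := choice fS.
by exists g; split=> // x; apply: fI.
Qed.

Lemma homR_homC_dom k x : cdom (hchart R k) (homR_homC x) <-> cdom (hchartR R k) x.
Proof.
rewrite -[x]rhomRK homR_homCE; split.
  by move=> /(domX_pi (@rhomCK R) (@homC_nu R)) d; apply/(domX_pi (@rhomRK R) (@homR_nu R)).
by move=> /(domX_pi (@rhomRK R) (@homR_nu R)) d; apply/(domX_pi (@rhomCK R) (@homC_nu R)).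
Qed.

Lemma homR_homC_coord k x : tX (@nuC R) (@rhomC R) k (homR_homC x) = tX (@nuR R) (@rhomR R) k x.
Proof.
by rewrite -[x]rhomRK homR_homCE (tX_pi (@rhomCK R) (@homC_nu R)) (tX_pi (@rhomRK R) (@homR_nu R)).
Qed.

Lemma assR_assC_fibre k e : lE (@nuC R) (@rassC R) k (assR_assC e) = lE (@nuR R) (@rassR R) k e.
Proof.
by rewrite -[e]rassRK assR_assCE (lE_pi (@rassCK R) (@assC_nu R)) (lE_pi (@rassRK R) (@assR_nu R)).
Qed.

Definition real_chart n X (c : chart R[i] n X) : chart R (n + n) X :=
  Chart (cdom c) (fun x => real_vec (cmap c x)) (fun y => cinv c (cplx_vec y)).

Lemma real_vecK n : cancel (@real_vec R n) (@cplx_vec R n).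
Proof.
move=> z; apply/rowP => j; rewrite mxE /real_vec row_mxEl row_mxEr !mxE.
by case: (z 0 j).
Qed.

Lemma cplx_vecK n : cancel (@cplx_vec R n) (@real_vec R n).
Proof.
move=> y; rewrite -[RHS]hsubmxK /real_vec; congr row_mx; apply/rowP => j;
  by rewrite !mxE.
Qed.

Lemma real_chart_atlas n X (A : set (chart R[i] n X)) c : A c -> real_atlas A (real_chart c).
Proof.
move=> Ac; rewrite /real_atlas /= (_ : cplx_chart _ = c) //.
case: c {Ac} => d m v; rewrite /cplx_chart /real_chart /=; congr Chart.
  by apply/funext => x; rewrite real_vecK.
by apply/funext => z; rewrite real_vecK.
Qed.

Lemma homR_homC_diffeo : diffeo (@smooth R) (@homR_atlas R) (real_atlas (@homC_atlas R)) homR_homC.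
Proof.
have [g [jK gK]] := bij_inverse homR_homC_inj homR_homC_surj.
exists g; split=> // x.
  have [k [kx _]] := homR_common x x.
  exists (hchartR R k), (real_chart (hchart R k)); split.
  - exact: hchartR_atlas.
  - exact: (real_chart_atlas (@hchart_atlas R k)).
  - exact: kx.
  - by move=> y ky; exact/homR_homC_dom.
  - rewrite cimg_hchartR; have oT := @openT 'rV[R]_(1 + 1).
    apply: (reg_eq rg oT (f := fun y => y)); last exact: (reg_id rg).
    move=> y _ /=; rewrite homR_homC_coord (tX_pi (@rhomRK R) (@homR_nu R)) tf_rel.
    by rewrite real_vec_tC.
have [k [kx _]] := homC_common x x.
exists (real_chart (hchart R k)), (hchartR R k); split.
- exact: (real_chart_atlas (@hchart_atlas R k)).
- exact: hchartR_atlas.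
- exact: kx.
- by move=> y ky; apply/homR_homC_dom; rewrite gK.
- have oT := @openT 'rV[R]_(1 + 1).
  have -> : cimg (real_chart (hchart R k)) = setT.
    apply/seteqP; split=> // y _.
    have : cimg (hchart R k) (cplx_vec y) by rewrite cimg_hchart.
    by move=> [z kz zE]; exists z => //=; rewrite -[RHS]cplx_vecK -zE.
  apply: (reg_eq rg oT (f := fun y => y)); last exact: (reg_id rg).
  move=> y _ /=; rewrite -homR_homC_coord gK (tX_pi (@rhomCK R) (@homC_nu R)).
  by rewrite nuC_kel lcoord_cycn tf_nv vecC_eta cplx_vecK.
Qed.

End RealBundle.

Section JIso.
Variable R : realType.
Notation C := (Num.NumField.sort R[i]).
Notation rg := (smooth_good R).

Lemma smooth_real_vec_mx (V : normedModType R) (O : set V) n (f : V -> 'rV[C]_n) :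
  open O -> (forall j, csm O (fun x => f x 0 j)) ->
  @smooth R _ _ O (fun x => real_vec (f x)).
Proof.
move=> oO fO; apply: (reg_row_mx rg oO); apply: (reg_mx rg oO) => i j;
  under [X in smooth _ X]eq_fun do rewrite mxE; rewrite ord1; by have [] := fO j.
Qed.

Lemma csm_cplx_vec (V : normedModType R) (O : set V) n (f : V -> 'rV[R]_(n + n)) j :
  open O -> @smooth R _ _ O f -> csm O (fun x => cplx_vec (f x) 0 j).
Proof.
move=> oO fO; apply: (@csm_ext _ _ _ (fun x => f x 0 (lshift n j) +i* f x 0 (rshift n j))).
  by move=> x; rewrite mxE.
by split; exact: (reg_coord rg _ _ oO).
Qed.

Lemma achartR_tX k y :
  tX (@nuR R) (@rhomR R) k (proj_assR (cinv (achartR R k) y)) = tC (lsubmx y : 'rV_(1 + 1)).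
Proof. by rewrite /achartR /= proj_assRE (tX_pi (@rhomRK R) (@homR_nu R)) tf_rel. Qed.

Lemma achartR_lE k y : lE (@nuR R) (@rassR R) k (cinv (achartR R k) y) = lC (rsubmx y).
Proof.
rewrite /achartR /= (lE_pi (@rassRK R) (@assR_nu R)) /= /lf af_rel.
by field; rewrite denc_neq0.
Qed.

Lemma achart_tX k y :
  tX (@nuC R) (@rhomC R) k (proj_assC (cinv (achart R k) y)) = lsubmx y 0 0.
Proof.
by rewrite /achart /= proj_assCE (tX_pi (@rhomCK R) (@homC_nu R)) nuC_kel lcoord_cycn tf_nv.
Qed.

Lemma achart_lE k y : lE (@nuC R) (@rassC R) k (cinv (achart R k) y) = rsubmx y 0 0.
Proof.
rewrite /achart /= (lE_pi (@rassCK R) (@assC_nu R)) /= nuC_kel lcoord_cycn lf1 //.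
exact: af_nv.
Qed.

Lemma assR_assC_diffeo : diffeo (@smooth R) (@assR_atlas R) (real_atlas (@assC_atlas R)) (@assR_assC R).
Proof.
have [g [JK gK]] := bij_inverse (@assR_assC_inj R) (@assR_assC_surj R).
exists g; split=> // e.
  have [k [ke _]] := homR_common (proj_assR e) (proj_assR e).
  exists (achartR R k), (real_chart (achart R k)); split.
  - exact: achartR_atlas.
  - exact: (real_chart_atlas (@achart_atlas R k)).
  - exact: ke.
  - by move=> y ky; rewrite /= proj_assR_assC; exact/homR_homC_dom.
  - rewrite cimg_achartR; have oT := @openT 'rV[R]_(2 + 2).
    have lsm : @smooth R _ _ setT (fun y : 'rV[R]_(2 + 2) => lsubmx y).
      by apply: (reg_mx rg oT) => i j; apply: (reg_lsubmx rg _ _ oT); exact: (reg_id rg).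
    have rsm : @smooth R _ _ setT (fun y : 'rV[R]_(2 + 2) => rsubmx y).
      by apply: (reg_mx rg oT) => i j; apply: (reg_rsubmx rg _ _ oT); exact: (reg_id rg).
    apply: (reg_eq rg oT (f := fun y => real_vec (row_mx
      (vecC (tC (lsubmx y : 'rV_(1 + 1)))) (vecC (lC (rsubmx y)))))).
      move=> y _; rewrite -[RHS]/(real_vec (row_mx _ _)); congr real_vec; congr row_mx.
        by rewrite /= proj_assR_assC homR_homC_coord achartR_tX.
      by rewrite assR_assC_fibre achartR_lE.
    apply: (smooth_real_vec_mx oT) => j; case: (split_ordP j) => i ->.
      apply: csm_ext (csm_tC oT (lsm : @smooth R _ 'rV[R]_(1 + 1) _ _)) => y.
      by rewrite row_mxEl vecCE.
    by apply: csm_ext (csm_lC oT rsm) => y; rewrite row_mxEr vecCE.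
have [k [ke _]] := homC_common (proj_assC e) (proj_assC e).
exists (real_chart (achart R k)), (achartR R k); split.
- exact: (real_chart_atlas (@achart_atlas R k)).
- exact: achartR_atlas.
- exact: ke.
- by move=> y ky; rewrite /=; apply/homR_homC_dom; rewrite -proj_assR_assC gK.
- have oT := @openT 'rV[R]_((1 + 1) + (1 + 1)).
  have -> : cimg (real_chart (achart R k)) = setT.
    apply/seteqP; split=> // y _.
    have : cimg (achart R k) (cplx_vec y) by rewrite cimg_achart.
    by move=> [z kz zE]; exists z => //=; rewrite -[RHS]cplx_vecK -zE.
  apply: (reg_eq rg oT (f := fun y => row_mx
    (real_vec (vecC (cplx_vec y 0 (lshift 1 0)))) (vecR (cplx_vec y 0 (rshift 1 0))))).
    move=> y _; rewrite -[RHS]/(row_mx _ _); congr row_mx.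
      rewrite /= -homR_homC_coord -proj_assR_assC gK achart_tX; congr (real_vec (vecC _)).
      by rewrite [RHS]mxE.
    by rewrite -assR_assC_fibre gK achart_lE [in RHS]mxE.
  apply: (reg_row_mx rg oT).
    by apply: (smooth_real_vec oT); apply: (csm_cplx_vec _ oT); exact: (reg_id rg).
  by apply: (smooth_vecR oT); apply: (csm_cplx_vec _ oT); exact: (reg_id rg).
Qed.

Lemma J_iso : bundle_iso (@smooth R)
  (@assR_atlas R) (@homR_atlas R) (@proj_assR R) (@lin_assR R)
  (real_atlas (@assC_atlas R)) (real_atlas (@homC_atlas R))
  (@proj_assC R) (@lin_assC R) (@assR_assC R) (@homR_homC R).
Proof.
split; [exact: assR_assC_diffeo|exact: homR_homC_diffeo|exact: proj_assR_assC|].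
move=> a _ _ _ [g [q1 [q2 [-> -> ->]]]]; rewrite !assR_assCE.
by exists (SO3incl g), q1, q2.
Qed.

End JIso.

(** * The sphere and the bundle Q *)

Section SphereAndQ.
Variable R : realType.
Notation C := (Num.NumField.sort R[i]).
Notation rg := (smooth_good R).

Lemma bil_e3 : bil (e3 R) (e3 R) = 1.
Proof. by rewrite bil3 !mxE /=; ring. Qed.

Lemma sphere_e3 (g : SO3 R) : bil (val g *m e3 R) (val g *m e3 R) == 1.
Proof. by rewrite SO3_bil ?(valP g) // bil_e3. Qed.

Definition ge3 (g : SO3 R) : sphere R := exist _ (val g *m e3 R) (sphere_e3 g).

Definition homR_sphere (x : homR R) : sphere R := ge3 (rhomR x).

Lemma homR_sphereE g : homR_sphere (pi_homR g) = ge3 g.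
Proof.
by apply: val_inj; rewrite /=; apply/esym/homR_eqP3; rewrite rhomRK.
Qed.

Lemma inQ_conj (g : SO3 R) (q : C) :
  inQ (val g *m e3 R, val g *m Qe3 q *m invmx (val g)).
Proof.
have gS := valP g; rewrite (SO3_invmx gS).
apply/and4P; split=> /=.
- exact: sphere_e3.
- rewrite !trmx_mul trmxK -mulmxA; apply/eqP; congr (_ *m (_ *m _)).
  by apply: mx3P => j; case: (ord3P j) => ->; rewrite !mxE.
- rewrite mxtrace_mulC mulmxA (SO3_trK gS) mul1mx /mxtrace sum3 !mxE /=.
  by rewrite subrr addr0.
- rewrite -(mulmxA _ (val g)^T) (SO3_trKm gS) -mulmxA (_ : Qe3 q *m e3 R = 0) ?mulmx0 //.
  by apply: cV3P; rewrite mulmx3E !mxE /=; ring.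
Qed.

(** The point of [Q] represented by a pair. *)
Definition Fpi (x : SO3 R * C) : Q R :=
  @exist _ (fun y => inQ y) _ (inQ_conj x.1 x.2).

Definition assR_Q (e : assR R) : Q R := Fpi (rassR e).

(** A rotation about [e3] acts on the fibre by the square of its phase; so [Fpi] is
    constant on classes. *)
Lemma Qe3_rot (phi : R) (q : C) :
  Qe3 (expi (2 * phi) * q) = rotz phi *m Qe3 q *m invmx (rotz phi).
Proof.
rewrite expi2 invmx_rotzE /expi; case: q => x y.
have -> : ((cos phi +i* sin phi) ^+ 2 * (x +i* y) : C) =
  ((cos phi * cos phi - sin phi * sin phi) * x - (2 * cos phi * sin phi) * y) +i*
  ((cos phi * cos phi - sin phi * sin phi) * y + (2 * cos phi * sin phi) * x).
  by rewrite expr2; simpc; congr (_ +i* _); ring.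
by apply: mx3P => j; case: (ord3P j) => ->; rewrite !mulmx3E !mxE /=; ring.
Qed.

Lemma Fpi_eq x x' : pi_assR x = pi_assR x' -> Fpi x = Fpi x'.
Proof.
move=> /eqmodP /asboolP[phi [E1 E2]]; apply: val_inj; rewrite /= E1 E2 Qe3_rot.
rewrite -(mulmxA (val x.1) _ (e3 R)) rotz_e3; congr (_, _).
have Rz : inSO3 (invmx (rotz phi)).
  apply/inSO3P; split.
    by rewrite invmx_rotzE det3 !mxE /= -[RHS](cos2Dsin2 phi); ring.
  rewrite invmx_rotzE; apply: mx3P => j; case: (ord3P j) => ->; rewrite mulmx3E !mxE /=;
    first [ring | rewrite -[RHS](cos2Dsin2 phi); ring].
rewrite (inSO3_invM (valP x.1) Rz) invmxK.
rewrite !mulmxA -(mulmxA (val x.1) (invmx _)) mulVmx ?rotz_unit // mulmx1.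
by rewrite -(mulmxA _ (invmx (rotz phi))) mulVmx ?rotz_unit // mulmx1.
Qed.

Lemma assR_QE x : assR_Q (pi_assR x) = Fpi x.
Proof. by apply: Fpi_eq; rewrite rassRK. Qed.

Lemma Qe3_inj : injective (@Qe3 R).
Proof.
move=> [a b] [c d] /matrixP E; have := E o0 o0; have := E o0 o1.
by rewrite !mxE /= => -> ->.
Qed.

Definition q_of (A : 'M[R]_3) : C := A o0 o0 +i* A o0 o1.

Lemma q_ofK q : q_of (Qe3 q) = q.
Proof. by rewrite /q_of !mxE /=; case: q. Qed.

Lemma Qe3E (A : 'M[R]_3) : A^T = A -> \tr A = 0 -> A *m e3 R = 0 -> Qe3 (q_of A) = A.
Proof.
move=> /matrixP As + /colP Ae; rewrite /mxtrace sum3 => At.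
have col2 i : A i o2 = 0.
  by have := Ae i; rewrite mulmx3E !mxE /= !mulr0 mulr1 !add0r.
have row2 i : A o2 i = 0 by rewrite -(As o2 i) mxE col2.
have sym : A o1 o0 = A o0 o1 by rewrite -(As o0 o1) mxE.
have tr : A o1 o1 = - A o0 o0.
  by move: At; rewrite col2 addr0 => /eqP; rewrite addrC addr_eq0 => /eqP.
by rewrite [RHS]mx3_id !row2 !col2 sym tr.
Qed.

Lemma conj_inj (g : SO3 R) (A B : 'M[R]_3) :
  val g *m A *m invmx (val g) = val g *m B *m invmx (val g) -> A = B.
Proof.
move=> /(congr1 (fun M => invmx (val g) *m M *m val g)).
by rewrite !mulmxA mulVmx ?SO3_unit // !mul1mx -!mulmxA mulVmx ?SO3_unit // !mulmx1.
Qed.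

Lemma homR_sphere_inj : injective homR_sphere.
Proof.
move=> x x'; rewrite -[x]rhomRK -[x']rhomRK !homR_sphereE => /(congr1 val) /= E.
exact/homR_eqP3.
Qed.

Lemma proj_assR_Q e : proj_Q (assR_Q e) = homR_sphere (proj_assR e).
Proof. by rewrite -[e]rassRK assR_QE proj_assRE homR_sphereE; apply: val_inj. Qed.

Lemma assR_Q_inj : injective assR_Q.
Proof.
move=> e e' E; have pe : proj_assR e = proj_assR e'.
  by apply: homR_sphere_inj; rewrite -!proj_assR_Q E.
move: E pe; rewrite -[e']rassRK; case: (rassR e') => g q E; rewrite proj_assRE => pe.
have [q' eE] := fibreE (@rassRK R) (@homR_nu R) (@assR_nu R) (@proj_assRE R) pe.
move: E; rewrite eE !assR_QE => /(congr1 val) [] /conj_inj /Qe3_inj ->.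
by [].
Qed.

(** Stereographic coordinates miss [- e3], which is reached by the half turn about
    the first axis. *)
Lemma sphere_surj (s : 'cV[R]_3) : bil s s = 1 -> exists g : SO3 R, val g *m e3 R = s.
Proof.
move=> ss; have [s1|s1] := eqVneq (1 + s o2 0) 0; last first.
  by exists (@exist _ (fun g => inSO3 g) _ (inSO3_rmx (tx s) (ty s))); exact: rmx_e3.
have s2 : s o2 0 = -1 by apply/eqP; rewrite -addr_eq0 addrC s1.
have /eqP : s o0 0 ^+ 2 + s o1 0 ^+ 2 = 0.
  by move: ss; rewrite bil3 s2 mulrNN mulr1 => /eqP; rewrite -subr_eq0 addrK => /eqP.
rewrite paddr_eq0 ?sqr_ge0 // !sqrf_eq0 => /andP[/eqP s0 /eqP s1'].
pose D : 'M[R]_3 := mx3 [:: [:: 1; 0; 0]; [:: 0; -1; 0]; [:: 0; 0; -1]].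
have DS : inSO3 D.
  apply/inSO3P; split; first by rewrite det3 !mxE /=; ring.
  by apply: mx3P => j; case: (ord3P j) => ->; rewrite mulmx3E !mxE /=; ring.
exists (@exist _ (fun g => inSO3 g) D DS); apply: cV3P; rewrite mulmx3E !mxE /= ?s0 ?s1' ?s2; ring.
Qed.

Lemma homR_sphere_surj y : exists x, homR_sphere x = y.
Proof.
have [g gE] := sphere_surj (eqP (valP y)).
by exists (pi_homR g); rewrite homR_sphereE; apply: val_inj.
Qed.

(** A rotation carrying [e3] to [x.1] turns [x.2] into an element of the fibre
    over [e3]. *)
Lemma Fpi_q_of (x : Q R) (g : SO3 R) : val g *m e3 R = (val x).1 ->
  Fpi (g, q_of ((val g)^T *m (val x).2 *m val g)) = x.
Proof.
move=> gE; have gS := valP g; have /and4P[_ /eqP xs /eqP xt /eqP xe] := valP x.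
have E : Qe3 (q_of ((val g)^T *m (val x).2 *m val g)) = (val g)^T *m (val x).2 *m val g.
  apply: Qe3E.
  - by rewrite !trmx_mul trmxK xs mulmxA.
  - by rewrite -mulmxA mxtrace_mulC -mulmxA (SO3_Ktr gS) mulmx1.
  - by rewrite -!mulmxA gE xe mulmx0.
apply: val_inj; rewrite /= E gE [RHS]surjective_pairing; congr pair.
rewrite (SO3_invmx gS) !mulmxA (SO3_Ktr gS) mul1mx -mulmxA (SO3_Ktr gS).
exact: mulmx1.
Qed.

Lemma assR_Q_surj y : exists x, assR_Q x = y.
Proof.
have [g gE] := sphere_surj (eqP (inQ_sphere (valP y))).
by eexists (pi_assR (g, _)); rewrite assR_QE; exact: Fpi_q_of.
Qed.

Definition sphere_homR : sphere R -> homR R := sval (cid (bij_inverse homR_sphere_inj homR_sphere_surj)).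
Definition Q_assR : Q R -> assR R := sval (cid (bij_inverse assR_Q_inj assR_Q_surj)).

Lemma homR_sphereK : cancel homR_sphere sphere_homR. Proof. by rewrite /sphere_homR; case: cid => ? []. Qed.
Lemma sphere_homRK : cancel sphere_homR homR_sphere. Proof. by rewrite /sphere_homR; case: cid => ? []. Qed.
Lemma assR_QK : cancel assR_Q Q_assR. Proof. by rewrite /Q_assR; case: cid => ? []. Qed.
Lemma Q_assRK : cancel Q_assR assR_Q. Proof. by rewrite /Q_assR; case: cid => ? []. Qed.

Lemma sphere_homR_proj e : sphere_homR (proj_Q e) = proj_assR (Q_assR e).
Proof. by rewrite -{1}[e]Q_assRK proj_assR_Q homR_sphereK. Qed.

(** A rotation carrying [e3] to [s], equal to [g] at [s = g e3]. *)
Definition rlift (g : SO3 R) (s : 'cV[R]_3) : SO3 R :=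
  exist _ (val g *m rmx (tx ((val g)^T *m s)) (ty ((val g)^T *m s)))
    (inSO3M (valP g) (inSO3_rmx _ _)).

Definition rdom (g : SO3 R) : set 'cV[R]_3 := [set s | 1 + ((val g)^T *m s) o2 0 != 0].

Lemma rlift_e3 g s : bil s s = 1 -> rdom g s -> val (rlift g s) *m e3 R = s.
Proof.
move=> ss gs; have gS := valP g; rewrite /= -mulmxA rmx_e3 ?SO3_Ktrm //.
by rewrite SO3_bil //; exact: inSO3T.
Qed.

Lemma rlift_id g : rlift g (val g *m e3 R) = g.
Proof.
apply: SO3_ext; have [t0 t1] := tx_e3 R.
by rewrite /= SO3_trKm ?(valP g) // t0 t1 rmx0 mulmx1.
Qed.

Lemma rdom_id g : rdom g (val g *m e3 R).
Proof.
rewrite /rdom /= SO3_trKm ?(valP g) // mxE /=.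
by rewrite (_ : 1 + 1 = 2) ?pnatr_eq0.
Qed.

Lemma open_rdom g : open (rdom g).
Proof.
have oT := @openT 'cV[R]_3.
have h : @smooth R _ _ setT (fun s : 'cV[R]_3 => 1 + ((val g)^T *m s) o2 0).
  by regt (smooth_good R) oT.
by have := reg_open_preim rg oT (@open_neq0 R) h; rewrite setTI.
Qed.

Lemma smooth_rlift (V : normedModType R) (O : set V) (f : V -> 'cV[R]_3) g : open O ->
  @smooth R _ _ O f -> (forall x, O x -> rdom g (f x)) ->
  @smooth R _ _ O (fun x => val (rlift g (f x))).
Proof.
move=> oO fO fd; rewrite /=; apply: (reg_mulmx rg oO); first exact: (reg_cst rg).
have dO : @smooth R _ _ O (fun x => (1 + ((val g)^T *m f x) o2 0)^-1).
  by apply: (reg_inv rg oO) => //; regt (smooth_good R) oO.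
by apply: (smooth_rmx oO); rewrite /tx /ty; regt (smooth_good R) oO.
Qed.

Lemma f_lift (y : sphere R) : exists m,
  local_lift (@smooth R) (@emb_SO3R R) (@pi_homR R) (@emb_sphere R) id homR_sphere m y.
Proof.
have [g gE] := sphere_surj (eqP (valP y)).
exists g, ge3, setT, (fun A => A *m e3 R); split.
- exact: openT.
- by [].
- have oT := @openT 'M[R]_3; regt (smooth_good R) oT.
- exact: val_inj.
- by move=> m1 _; rewrite homR_sphereE.
Qed.

Lemma sphere_homR_lift_at (g : SO3 R) :
  local_lift (@smooth R) (@emb_sphere R) id (@emb_SO3R R) (@pi_homR R) sphere_homR (ge3 g) g.
Proof.
exists (fun s => rlift g (val s)), (rdom g), (fun s => val (rlift g s)); split.
- exact: open_rdom.
- exact: rdom_id.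
- apply: (smooth_rlift (@open_rdom g)) => //; exact: (reg_id rg).
- exact: rlift_id.
- move=> s ds; split=> //; rewrite -[LHS]homR_sphereK; congr sphere_homR.
  rewrite homR_sphereE; apply: val_inj; apply: rlift_e3 => //; exact/eqP/(valP s).
Qed.

Lemma sphere_homR_lift (y : sphere R) : exists g,
  local_lift (@smooth R) (@emb_sphere R) id (@emb_SO3R R) (@pi_homR R) sphere_homR y g.
Proof.
have [g gE] := sphere_surj (eqP (valP y)); exists g.
by rewrite (_ : y = ge3 g); [exact: sphere_homR_lift_at|apply: val_inj].
Qed.

Lemma F_lift (y : Q R) : exists m,
  local_lift (@smooth R) (@emb_SO3RxC R) (@pi_assR R) (@emb_Q R) id assR_Q m y.
Proof.
have [g gE] := sphere_surj (eqP (inQ_sphere (valP y))).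
exists (g, q_of ((val g)^T *m (val y).2 *m val g)), Fpi, setT.
exists (fun p : 'M[R]_3 * 'rV[R]_2 => (p.1 *m e3 R, p.1 *m Qe3 (lC p.2) *m p.1^T)); split.
- exact: openT.
- by [].
- have oT := @openT ('M[R]_3 * 'rV[R]_2)%type.
  have f1 := smooth_fst oT; have f2 := smooth_snd oT.
  apply: (reg_pair rg (framed_mx R 3 1) (framed_mx R 3 3) oT); first by regt (smooth_good R) oT.
  have qs : @smooth R _ _ setT (fun p : 'M[R]_3 * 'rV[R]_2 => Qe3 (lC p.2)).
    by apply: (reg_mx3 rg oT) => /=; regt (smooth_good R) oT.
  by regt (smooth_good R) oT.
- exact: Fpi_q_of.
- move=> m1 _; rewrite assR_QE; split=> //.
  by rewrite /emb_Q /= lC_vecR SO3_invmx // (valP m1.1).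
Qed.

Lemma Q_assR_lift_at (m' : SO3 R * C) :
  local_lift (@smooth R) (@emb_Q R) id (@emb_SO3RxC R) (@pi_assR R) Q_assR (Fpi m') m'.
Proof.
case: m' => g q.
pose qq (s : 'cV[R]_3) (B : 'M[R]_3) : C :=
  q_of ((val (rlift g s))^T *m B *m val (rlift g s)).
pose U : set ('cV[R]_3 * 'M[R]_3) := [set p | rdom g p.1].
have oT := @openT ('cV[R]_3 * 'M[R]_3)%type.
have oU : open U.
  have h : @smooth R _ _ setT (fun p : 'cV[R]_3 * 'M[R]_3 => p.1).
    by apply: (reg_fst rg (framed_mx R 3 1) (framed_mx R 3 3) oT); exact: (reg_id rg).
  by have := reg_open_preim rg oT (@open_rdom g) h; rewrite setTI.
exists (fun x => (rlift g (val x).1, qq (val x).1 (val x).2)), U.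
exists (fun p => (val (rlift g p.1), vecR (qq p.1 p.2))); split.
- exact: oU.
- exact: rdom_id.
- have f1 : @smooth R _ _ U (fun p : 'cV[R]_3 * 'M[R]_3 => p.1).
    by apply: (reg_fst rg (framed_mx R 3 1) (framed_mx R 3 3) oU); exact: (reg_id rg).
  have f2 : @smooth R _ _ U (fun p : 'cV[R]_3 * 'M[R]_3 => p.2).
    by apply: (reg_snd rg (framed_mx R 3 1) (framed_mx R 3 3) oU); exact: (reg_id rg).
  have rs := smooth_rlift oU f1 (fun p (Up : U p) => Up).
  apply: (reg_pair rg (framed_mx R 3 3) (framed_mx R 1 2) oU) => //.
  apply: (smooth_vecR oU); split; rewrite /qq /=; apply: (reg_coord rg _ _ oU);
    apply: (reg_mulmx rg oU) => //; apply: (reg_mulmx rg oU) => //; exact: (reg_trmx rg oU rs).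
- rewrite /= /qq rlift_id SO3_invmx ?(valP g) //.
  rewrite !mulmxA (SO3_trK (valP g)) mul1mx -mulmxA (SO3_trK (valP g)) mulmx1.
  by rewrite q_ofK.
- move=> x Ux; split=> //; rewrite -[LHS]assR_QK; congr Q_assR.
  by rewrite assR_QE Fpi_q_of // rlift_e3 //; exact/eqP/inQ_sphere/(valP x).
Qed.

Lemma Q_assR_lift (y : Q R) : exists m,
  local_lift (@smooth R) (@emb_Q R) id (@emb_SO3RxC R) (@pi_assR R) Q_assR y m.
Proof.
have [g gE] := sphere_surj (eqP (inQ_sphere (valP y))).
eexists; rewrite -{1}(Fpi_q_of gE); exact: Q_assR_lift_at.
Qed.

(** The charts of the quotients, transported to the sphere and to [Q]. *)
Definition hchartS k : chart R 2 (sphere R) :=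
  Chart (sphere_homR @^-1` cdom (hchartR R k)) (cmap (hchartR R k) \o sphere_homR) (homR_sphere \o cinv (hchartR R k)).

Definition achartQ k : chart R (2 + 2) (Q R) :=
  Chart (Q_assR @^-1` cdom (achartR R k)) (cmap (achartR R k) \o Q_assR) (assR_Q \o cinv (achartR R k)).

Lemma hchartS_atlas k : @sphere_atlas R (hchartS k).
Proof.
have H := quot_transport rg (framed_mx R 3 3) (@pi_homR_surj R) homR_sphereK sphere_homRK f_lift sphere_homR_lift (@hchartR_atlas R k).
exact: H.
Qed.

Lemma achartQ_atlas k : @Q_atlas R (achartQ k).
Proof.
exact: (quot_transport rg (@framedVR R) (@pi_assR_surj R) assR_QK Q_assRK F_lift Q_assR_lift
  (@achartR_atlas R k)).
Qed.

Lemma sphere_manifold : is_manifold (@smooth R) (@sphere_atlas R).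
Proof.
apply: (quot_manifold rg (framed_mx R 3 1) _ hchartS_atlas); first by move=> x; exists x.
by move=> x x'; exact: (homR_common (sphere_homR x) (sphere_homR x')).
Qed.

Lemma Q_manifold : is_manifold (@smooth R) (@Q_atlas R).
Proof.
apply: (quot_manifold rg _ _ achartQ_atlas).
- by apply: framed_prod; exact: framed_mx.
- by move=> x; exists x.
- by move=> x x'; exact: homR_common.
Qed.

Lemma homR_sphere_diffeo : diffeo (@smooth R) (@homR_atlas R) (@sphere_atlas R) homR_sphere.
Proof.
apply: (transport_diffeo rg homR_sphereK sphere_homRK) => x; have [k [kx _]] := homR_common x x.
exists (hchartR R k); split; [exact: hchartR_atlas|exact: kx| |exact: hchartS_atlas].
exact: quot_ok (@hchartR_atlas R k).
Qed.

Lemma assR_Q_diffeo : diffeo (@smooth R) (@assR_atlas R) (@Q_atlas R) assR_Q.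
Proof.
apply: (transport_diffeo rg assR_QK Q_assRK) => e.
have [k [kx _]] := homR_common (proj_assR e) (proj_assR e).
exists (achartR R k); split; [exact: achartR_atlas|exact: kx| |exact: achartQ_atlas].
exact: quot_ok (@achartR_atlas R k).
Qed.

Lemma Qe3_lin (a : R) (q1 q2 : C) : Qe3 (a%:C * q1 + q2) = a *: Qe3 q1 + Qe3 q2.
Proof.
case: q1 q2 => [x1 y1] [x2 y2]; apply: mx3P => j; case: (ord3P j) => ->;
  rewrite !mxE /=; ring.
Qed.

Lemma lin_assR_Q (a : R) e1 e2 e3 :
  lin_Q a (assR_Q e1) (assR_Q e2) (assR_Q e3) <-> lin_assR a%:C e1 e2 e3.
Proof.
split=> [[p2 p3 E]|[g [q1 [q2 [-> -> ->]]]]]; last first.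
  rewrite !assR_QE; split=> //=.
  by rewrite Qe3_lin mulmxDr mulmxDl -scalemxAr -scalemxAl.
have pr2 : proj_assR e2 = proj_assR e1.
  by apply: homR_sphere_inj; rewrite -!proj_assR_Q; apply: val_inj.
have pr3 : proj_assR e3 = proj_assR e1.
  by apply: homR_sphere_inj; rewrite -!proj_assR_Q; apply: val_inj.
move: E pr2 pr3; rewrite -[e1]rassRK; case: (rassR e1) => g q1; rewrite proj_assRE => + pr2 pr3.
have [q2 ->] := fibreE (@rassRK R) (@homR_nu R) (@assR_nu R) (@proj_assRE R) pr2.
have [q3 ->] := fibreE (@rassRK R) (@homR_nu R) (@assR_nu R) (@proj_assRE R) pr3.
rewrite !assR_QE /= scalemxAl scalemxAr -mulmxDl -mulmxDr -Qe3_lin => /conj_inj /Qe3_inj ->.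
by exists g, q1, q2.
Qed.

Lemma F_iso : bundle_iso (@smooth R)
  (@assR_atlas R) (@homR_atlas R) (@proj_assR R) (fun a : R => lin_assR a%:C)
  (@Q_atlas R) (@sphere_atlas R) (@proj_Q R) (@lin_Q R) assR_Q homR_sphere.
Proof.
split; [exact: assR_Q_diffeo|exact: homR_sphere_diffeo|exact: proj_assR_Q|].
by move=> a e1 e2 e3 /lin_assR_Q.
Qed.

Lemma vecR_lin (a : R) (z w : C) : vecR (a%:C * z + w) = a *: vecR z + vecR w.
Proof.
by apply/rowP => -[[|[|//]] p]; rewrite !mxE /=; case: z w => ? ? [? ?]; simpc.
Qed.

Lemma vecR_inj : injective (@vecR R).
Proof. exact: can_inj (@lC_vecR R). Qed.

Lemma Q_bundle : is_vector_bundle (@smooth R) (L := 'rV[R]_2) id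
  (@Q_atlas R) (@sphere_atlas R) (@proj_Q R) (@lin_Q R).
Proof.
split; [exact: Q_manifold|exact: sphere_manifold|move=> x].
have [k [kx _]] := homR_common (sphere_homR x) (sphere_homR x).
pose t e : 'rV[R]_2 := vecR (lE (@nuR R) (@rassR R) k (Q_assR e)).
exists (hchartS k), t, (cinv (achartQ k)); split.
- by split; [exact: hchartS_atlas|exact: kx].
- have E1 : [set e | cdom (hchartS k) (proj_Q e)] = Q_assR @^-1` cdom (achartR R k).
    by apply/funext => e; rewrite /= sphere_homR_proj.
  have E2 : (fun e => row_mx (cmap (hchartS k) (proj_Q e)) (id (t e))) =
      cmap (achartR R k) \o Q_assR.
    by apply/funext => e; rewrite /= sphere_homR_proj.
  by rewrite E1 E2; exact: achartQ_atlas.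
- move=> y l dy; have [e [pe le]] := assR_fibre (lC l) dy.
  by exists (assR_Q e); rewrite proj_assR_Q pe sphere_homRK /t assR_QK le vecR_lC.
- move=> a e1 e2 e3 d1.
  have d1' : cdom (hchartR R k) (proj_assR (Q_assR e1)) by rewrite -sphere_homR_proj.
  have pE e : proj_Q e = proj_Q e1 <-> proj_assR (Q_assR e) = proj_assR (Q_assR e1).
    by rewrite -!sphere_homR_proj; split=> [->//|/(can_inj sphere_homRK)].
  rewrite -{1}[e1]Q_assRK -{1}[e2]Q_assRK -{1}[e3]Q_assRK; split.
    move=> /lin_assR_Q /(assR_linP _ _ _ d1')[/pE p2 /pE p3 l3]; split=> //.
    by rewrite /t l3 vecR_lin.
  move=> [/pE p2 /pE p3 l3]; apply/lin_assR_Q/(assR_linP _ _ _ d1'); split=> //.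
  by apply: vecR_inj; rewrite vecR_lin.
Qed.

End SphereAndQ.

(** * Cayley charts of SO(3,C) x C *)

Section CayleyRing.
Variable U : unitRingType.
Hypothesis two_unit : (2 : U) \is a GRing.unit.
Implicit Types a h : U.

Let two_comm a : GRing.comm 2 a.
Proof. by rewrite /GRing.comm mulr_natl mulr_natr. Qed.

(** The Cayley transform and its inverse. *)
Definition cayR a : U := (1 - a)^-1 * (1 + a).
Definition cayVR h : U := (h - 1) * (1 + h)^-1.

Lemma comm_sub_add a : GRing.comm (1 - a) (1 + a).
Proof.
apply: commrD; first exact: commr1.
by apply: commr_sym; apply: commrB; [exact: commr1|exact: commr_refl].
Qed.

Lemma cayVR_sub h : 1 + h \is a GRing.unit -> 1 - cayVR h = 2 * (1 + h)^-1.
Proof.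
move=> u; rewrite -[X in X + _](divrr u) -mulrBl; congr (_ * _).
by rewrite opprB addrACA subrr addr0.
Qed.

Lemma cayVR_add h : 1 + h \is a GRing.unit -> 1 + cayVR h = 2 * (h * (1 + h)^-1).
Proof.
move=> u; rewrite -[X in X + _](divrr u) -mulrDl mulrA; congr (_ * _).
by rewrite addrC addrA subrK mulr_natl mulr2n.
Qed.

Lemma cayR_sub a : 1 - a \is a GRing.unit -> cayR a - 1 = (1 - a)^-1 * (2 * a).
Proof.
move=> u; rewrite -[X in _ - X](mulVr u) -mulrBr; congr (_ * _).
by rewrite opprB addrC addrA subrK mulr_natl mulr2n.
Qed.

Lemma cayR_add a : 1 - a \is a GRing.unit -> 1 + cayR a = (1 - a)^-1 * 2.
Proof.
move=> u; rewrite -[X in X + _](mulVr u) -mulrDr; congr (_ * _).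
by rewrite addrACA addNr addr0.
Qed.

Lemma cayVRK h : 1 + h \is a GRing.unit -> cayR (cayVR h) = h.
Proof.
move=> u; rewrite /cayR cayVR_sub // cayVR_add // invrM ?unitrV // invrK.
rewrite -mulrA (mulrA 2^-1) mulVr // mul1r mulrA.
have -> : (1 + h) * h = h * (1 + h) by rewrite mulrDl mulrDr mul1r mulr1.
by rewrite mulrK.
Qed.

Lemma cayRK a : 1 - a \is a GRing.unit -> cayVR (cayR a) = a.
Proof.
move=> u; rewrite /cayVR cayR_sub // cayR_add // invrM ?unitrV // invrK.
rewrite two_comm -!mulrA (mulrA 2) divrr // mul1r.
have -> : a * (1 - a) = (1 - a) * a by rewrite mulrBl mulrBr mul1r mulr1.
by rewrite mulKr.
Qed.

End CayleyRing.

Section Cayley.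
Variable K : numFieldType.

(** The matrix of [cross v]; [ax] is the inverse on antisymmetric matrices. *)
Definition sk (v : 'rV[K]_3) : 'M[K]_3 := mx3
  [:: [:: 0; - v 0 o2; v 0 o1]; [:: v 0 o2; 0; - v 0 o0]; [:: - v 0 o1; v 0 o0; 0]].

Definition ax (A : 'M[K]_3) : 'rV[K]_3 := \row_j [:: A o2 o1; A o0 o2; A o1 o0]`_j.

Lemma axK (v : 'rV[K]_3) : ax (sk v) = v.
Proof. by apply/rowP => j; case: (ord3P j) => ->; rewrite !mxE. Qed.

Lemma skK (A : 'M[K]_3) : A^T = - A -> sk (ax A) = A.
Proof.
move=> /matrixP As; have E i j : A i j = - A j i by have := As j i; rewrite !mxE.
have Z i : A i i = 0.
  have := E i i => /eqP; rewrite -addr_eq0 -mulr2n -mulr_natl mulf_eq0 pnatr_eq0 /=.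
  by move/eqP.
by apply: mx3P => i; case: (ord3P i) => ->; rewrite !mxE /= ?Z; rewrite //= ?(E o0 o1) ?(E o1 o2) ?(E o2 o0) ?opprK.
Qed.

Lemma sk_tr v : (sk v)^T = - sk v.
Proof.
by apply: mx3P => j; case: (ord3P j) => ->; rewrite !mxE /= ?opprK ?oppr0.
Qed.

Definition cay (A : 'M[K]_3) : 'M[K]_3 := cayR A.
Definition cayV (h : 'M[K]_3) : 'M[K]_3 := cayVR h.

Lemma det_unit (A : 'M[K]_3) : (A \is a GRing.unit) = (\det A != 0).
Proof. by rewrite -unitfE -unitmxE. Qed.

Lemma two_unit3 : (2 : 'M[K]_3) \is a GRing.unit.
Proof.
have -> : (2 : 'M[K]_3) = 2%:M by rewrite -[RHS]scalemx1 scaler_nat.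
by rewrite det_unit det_scalar expf_neq0 // pnatr_eq0.
Qed.

Lemma det_antisym (A : 'M[K]_3) : A^T = - A -> \det (1 + A) = \det (1 - A).
Proof. by move=> AT; rewrite -det_tr raddfD /= trmx1 AT. Qed.

(** The transposes of [1 - A] and [1 + A] are each other, and they commute. *)
Lemma inSO3_cay (A : 'M[K]_3) : A^T = - A -> \det (1 - A) != 0 -> inSO3 (cay A).
Proof.
move=> AT d0; have d1 : \det (1 + A) != 0 by rewrite det_antisym.
have u0 : (1 - A) \is a GRing.unit by rewrite det_unit.
have u1 : (1 + A) \is a GRing.unit by rewrite det_unit.
have t1 : (1 + A)^T = 1 - A by rewrite raddfD /= trmx1 AT.
have t0 : (1 - A)^T = 1 + A by rewrite raddfB /= trmx1 AT opprK.
apply/inSO3P; split.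
  rewrite /cay /cayR (det_mulmx (1 - A)^-1) (det_inv (1 - A)) (det_antisym AT).
  by rewrite mulVf.
rewrite /cay /cayR (trmx_mul (1 - A)^-1) t1 (trmx_inv (1 - A)) t0.
change ((1 - A) * (1 + A)^-1 * ((1 - A)^-1 * (1 + A)) = 1).
have c := commrV (commr_sym (commrV (comm_sub_add A))).
by rewrite mulrA -(mulrA (1 - A)) c mulrA divrr // mul1r mulVr.
Qed.

Lemma cayV_antisym (h : 'M[K]_3) : inSO3 h -> \det (1 + h) != 0 ->
  (cayV h)^T = - cayV h.
Proof.
move=> /inSO3P[_ hh] d0; have u : (1 + h) \is a GRing.unit by rewrite det_unit.
have dT : (1 + h^T) \is a GRing.unit.
  by rewrite det_unit -det_tr raddfD /= trmx1 trmxK.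
rewrite /cayV /cayVR (trmx_mul (h - 1)) (trmx_inv (1 + h)) raddfD raddfB /= trmx1.
change ((1 + h^T)^-1 * (h^T - 1) = - ((h - 1) * (1 + h)^-1)).
apply: (mulrI dT); rewrite mulVKr // mulrN mulrA; apply: (mulIr u).
rewrite mulNr mulrVK //.
have hh' : h^T * h = 1 by [].
transitivity (h^T - h).
  by rewrite mulrDr mulr1 mulrBl hh' mul1r addrA subrK.
by rewrite mulrDl mul1r mulrBr hh' mulr1 addrA subrK opprB.
Qed.

Lemma det_sub_cayV (h : 'M[K]_3) : \det (1 + h) != 0 -> \det (1 - cayV h) != 0.
Proof.
rewrite -!det_unit => u; rewrite /cayV (cayVR_sub u).
by rewrite (unitrMr _ two_unit3) unitrV.
Qed.

Lemma det_add_cay (A : 'M[K]_3) : \det (1 - A) != 0 -> \det (1 + cay A) != 0.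
Proof.
rewrite -!det_unit => u; rewrite /cay (cayR_add u).
by rewrite (unitrMl _ two_unit3) unitrV.
Qed.

Lemma cayVK (h : 'M[K]_3) : \det (1 + h) != 0 -> cay (cayV h) = h.
Proof. by rewrite -det_unit => u; exact: (cayVRK two_unit3 u). Qed.

Lemma cayK (A : 'M[K]_3) : \det (1 - A) != 0 -> cayV (cay A) = A.
Proof. by rewrite -det_unit => u; exact: (cayRK two_unit3 u). Qed.

End Cayley.

Section CayleyCover.
Variable K : numFieldType.

(** The diagonal matrices of signs in SO(3). *)
Definition sgn (k : nat) : 'M[K]_3 :=
  match k with
  | 0 => mx3 [:: [:: 1; 0; 0]; [:: 0; 1; 0]; [:: 0; 0; 1]]
  | 1 => mx3 [:: [:: 1; 0; 0]; [:: 0; -1; 0]; [:: 0; 0; -1]]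
  | 2 => mx3 [:: [:: -1; 0; 0]; [:: 0; 1; 0]; [:: 0; 0; -1]]
  | _ => mx3 [:: [:: -1; 0; 0]; [:: 0; -1; 0]; [:: 0; 0; 1]]
  end.

Lemma sgnT k : (sgn k)^T = sgn k.
Proof.
by case: k => [|[|[|k]]]; apply: mx3P => j; case: (ord3P j) => ->; rewrite !mxE.
Qed.

Lemma inSO3_sgn k : inSO3 (sgn k).
Proof.
apply/inSO3P; rewrite sgnT; case: k => [|[|[|k]]]; split;
  by [rewrite det3 !mxE /=; ring |
      apply: mx3P => j; case: (ord3P j) => ->; rewrite mulmx3E !mxE /=; ring].
Qed.

Lemma sgnK n k (A : 'M[K]_(3, n)) : sgn k *m (sgn k *m A) = A.
Proof. by rewrite -[X in X *m (_ *m _)]sgnT; exact/SO3_trKm/inSO3_sgn. Qed.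

(** The characteristic polynomial of a rotation at -1: the principal minors of
    order two are the diagonal entries. *)
Lemma det_add1 (h : 'M[K]_3) : inSO3 h ->
  \det (1 + h) = 2 * (1 + (h o0 o0 + h o1 o1 + h o2 o2)).
Proof.
move=> hS; have dh := SO3_det hS.
have cr u v i := congr1 (fun w : 'cV[K]_3 => w i 0) (SO3_cross hS (col3 u) (col3 v)).
have := cr [:: 1; 0; 0] [:: 0; 1; 0] o2; have := cr [:: 0; 1; 0] [:: 0; 0; 1] o0.
have := cr [:: 0; 0; 1] [:: 1; 0; 0] o1.
rewrite !mxE /= !sum3 !mxE /= !(mulr0, mulr1, addr0, add0r, subr0, sub0r, oppr0, mul0r) => m1 m0 m2.
have -> : \det (1 + h) = 1 + (h o0 o0 + h o1 o1 + h o2 o2) +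
    ((h o0 o0 * h o1 o1 - h o1 o0 * h o0 o1) + (h o1 o1 * h o2 o2 - h o2 o1 * h o1 o2) +
     (h o2 o2 * h o0 o0 - h o0 o2 * h o2 o0)) + \det h.
  by rewrite !det3 !mxE /=; ring.
rewrite dh.
have -> : h o0 o0 * h o1 o1 - h o1 o0 * h o0 o1 = h o2 o2.
  by rewrite -m2; ring.
have -> : h o1 o1 * h o2 o2 - h o2 o1 * h o1 o2 = h o0 o0.
  by rewrite -m0; ring.
have -> : h o2 o2 * h o0 o0 - h o0 o2 * h o2 o0 = h o1 o1.
  by rewrite -m1; ring.
ring.
Qed.

(** The matrices [sgn k] add up to 0, so the four values of [det_add1] add up to 8
    and cannot all vanish. *)
Lemma sgn_cover (h : 'M[K]_3) : inSO3 h ->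
  exists k, \det (1 + sgn k *m h) != 0.
Proof.
move=> hS; apply: contrapT => no.
have Z k : 1 + ((sgn k *m h) o0 o0 + (sgn k *m h) o1 o1 + (sgn k *m h) o2 o2) = 0.
  have : \det (1 + sgn k *m h) == 0.
    by apply: contrapT => /negP nk; apply: no; exists k.
  rewrite det_add1; last exact: inSO3M (inSO3_sgn k) hS.
  by rewrite mulf_eq0 pnatr_eq0 /= => /eqP.
move: (Z 0%N) (Z 1%N) (Z 2%N) (Z 3%N); rewrite !mulmx3E !mxE /= => Z0 Z1 Z2 Z3.
have : (4 : K) = 0.
  transitivity (0 + 0 + 0 + 0 : K); last by rewrite !addr0.
  rewrite -[X in _ = X + _ + _ + _]Z0 -[X in _ = _ + X + _ + _]Z1.
  rewrite -[X in _ = _ + X + _]Z2 -[X in _ = _ + X]Z3; ring.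
by move/eqP; rewrite pnatr_eq0.
Qed.

End CayleyCover.

Section CayleyCharts.
Variable R : realType.
Notation C := (Num.NumField.sort R[i]).
Notation rg := (holomorphic_good R).
Notation VC := ('M[C]_3 * 'rV[C]_1)%type.

(** The value outside SO(3,C) is the identity. *)
Definition SO3of (A : 'M[C]_3) : SO3 C := insubd (exist _ 1%:M (inSO31 C) : SO3 C) A.

Lemma SO3ofE (A : 'M[C]_3) : inSO3 A -> val (SO3of A) = A.
Proof. by move=> AS; rewrite val_insubd; case: ifP => //; rewrite /in_mem /= AS. Qed.

Definition sky (y : 'rV[C]_(3 + 1)) : 'M[C]_3 := sk (lsubmx y).

(** The Cayley transform covers the rotations without eigenvalue -1; its translates
    by the matrices [sgn k] cover SO(3,C). *)
Definition cayley k : chart C 4 (SO3 C * C) := Chart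
  [set x | \det (1 + sgn C k *m val x.1) != 0]
  (fun x => row_mx (ax (cayV (sgn C k *m val x.1))) (vecC x.2) : 'rV[C]_(3 + 1))
  (fun y => (SO3of (sgn C k *m cay (sky y)), rsubmx y 0 0)).

Definition cayD : set 'rV[C]_(3 + 1) := [set y | \det (1 - sky y) != 0].

Lemma inSO3_sky k y : cayD y -> inSO3 (sgn C k *m cay (sky y)).
Proof. by move=> dy; apply: inSO3M; [exact: inSO3_sgn|apply: inSO3_cay; [exact: sk_tr|]]. Qed.

Lemma cayley_invE k y : cayD y -> val (cinv (cayley k) y).1 = sgn C k *m cay (sky y).
Proof. by move=> dy; rewrite /= SO3ofE //; exact: inSO3_sky. Qed.

Lemma cayley_mapK k x : cdom (cayley k) x ->
  cayD (cmap (cayley k) x) /\ cinv (cayley k) (cmap (cayley k) x) = x.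
Proof.
move=> /= dx; have gS : inSO3 (sgn C k *m val x.1).
  by apply: inSO3M; [exact: inSO3_sgn|exact: SO3_val].
have E : sky (cmap (cayley k) x) = cayV (sgn C k *m val x.1).
  by rewrite /sky /= row_mxKl skK //; exact: cayV_antisym.
have D : cayD (cmap (cayley k) x).
  by change (\det (1 - sky (cmap (cayley k) x)) != 0); rewrite E; exact: det_sub_cayV.
split=> //; apply: injective_projections.
  by apply: SO3_ext; rewrite (cayley_invE k D) E (cayVK dx) sgnK.
by rewrite /= row_mxKr vecCE.
Qed.

Lemma cayley_invK k y : cayD y ->
  cdom (cayley k) (cinv (cayley k) y) /\ cmap (cayley k) (cinv (cayley k) y) = y.
Proof.
move=> dy; have E : sgn C k *m val (cinv (cayley k) y).1 = cay (sky y).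
  by rewrite cayley_invE // sgnK.
split.
  change (\det (1 + sgn C k *m val (cinv (cayley k) y).1) != 0).
  by rewrite E; exact: det_add_cay.
change (row_mx (ax (cayV (sgn C k *m val (cinv (cayley k) y).1)))
  (vecC (rsubmx y 0 0)) = y).
rewrite E cayK // /sky axK vecC_eta; exact: hsubmxK.
Qed.

Lemma cimg_cayley k : cimg (cayley k) = cayD.
Proof.
apply/seteqP; split=> y; first by case=> x /cayley_mapK[D _] <-.
by move=> /(cayley_invK k)[d e]; exists (cinv (cayley k) y).
Qed.

Lemma hol_sky (O : set 'rV[C]_(3 + 1)) : open O -> @holomorphic R _ _ O sky.
Proof.
move=> oO; have h j : @holomorphic R _ _ O (fun y => lsubmx y 0 j).
  by apply: (reg_lsubmx rg _ _ oO); exact: (reg_id rg).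
apply: (reg_mx3 rg oO); first [exact: (reg_cst rg)|exact: h|apply: (reg_opp rg oO); exact: h].
Qed.

Lemma open_cayD : open cayD.
Proof.
have oT := @openT 'rV[C]_(3 + 1).
have h : @holomorphic R _ _ setT (fun y => \det (1%:M - sky y)).
  apply: (reg_det rg oT); apply: (reg_subr rg oT); first exact: (reg_cst rg).
  exact: hol_sky.
by have := reg_open_preim rg oT (@open_neq0 C) h; rewrite setTI.
Qed.

Definition cayO k : set VC := [set p | \det (1 + sgn C k *m p.1) != 0].

Lemma hol_sgn k (O : set VC) : open O -> @holomorphic R _ _ O (fun p => 1%:M + sgn C k *m p.1).
Proof.
move=> oO; apply: (reg_add rg oO); first exact: (reg_cst rg).
by apply: (reg_mulmx rg oO); [exact: (reg_cst rg)|exact: hol_fst].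
Qed.

Lemma open_cayO k : open (cayO k).
Proof.
have oT := @openT VC; have h := reg_det rg oT (hol_sgn k oT).
by have := reg_open_preim rg oT (@open_neq0 C) h; rewrite setTI.
Qed.

Lemma hol_cinv k : @holomorphic R _ _ cayD (@emb_SO3CxC R \o cinv (cayley k)).
Proof.
have oD := open_cayD.
apply: (@reg_eq _ _ rg _ _ _ (fun y => (sgn C k *m cay (sky y), vecC (rsubmx y 0 0)))) => //.
  by move=> y dy; rewrite /emb_SO3CxC /comp cayley_invE.
apply: (reg_pair rg (framed_mx C 3 3) (framed_mx C 1 1) oD).
  apply: (reg_mulmx rg oD); first exact: (reg_cst rg).
  apply: (reg_mulmx rg oD).
    apply: (reg_invmx rg oD); first by move=> y; exact.
    by apply: (reg_subr rg oD); [exact: (reg_cst rg)|exact: hol_sky].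
  apply: (reg_add rg oD); first exact: (reg_cst rg).
  exact: hol_sky.
apply: (hol_vecC oD); apply: (reg_rsubmx rg _ _ oD); exact: (reg_id rg).
Qed.

Lemma cayley_atlas k : @SO3CxC_atlas R (cayley k).
Proof.
have oD := open_cayD; have oO := @open_cayO k.
split.
  by split; [rewrite cimg_cayley; exact: oD|move=> x /cayley_mapK[]].
have cO : @holomorphic R _ _ (cayO k) (fun p => cayV (sgn C k *m p.1)).
  apply: (reg_mulmx rg oO).
    apply: (reg_subr rg oO); last exact: (reg_cst rg).
    by apply: (reg_mulmx rg oO); [exact: (reg_cst rg)|exact: hol_fst].
  by apply: (reg_invmx rg oO); [move=> p; exact|exact: hol_sgn].
have aO : @holomorphic R _ _ (cayO k) (fun p => ax (cayV (sgn C k *m p.1))).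
  apply: (reg_mx rg oO) => i j.
  case: (ord3P j) => ->; under [X in holomorphic _ X]eq_fun do rewrite mxE /=;
    exact: (reg_coord rg _ _ oO cO).
pose F (p : VC) : 'rV[C]_(3 + 1) := row_mx (ax (cayV (sgn C k *m p.1))) p.2.
have FO : @holomorphic R _ _ (cayO k) F := reg_row_mx rg oO aO (hol_snd oO).
move=> m dm; split.
  exists (cayO k), F; split; [exact: oO|exact: dm|exact: FO|].
  by move=> m' dm'; split; first exact: dm'.
have [dy my] := cayley_mapK dm.
exists cayD, (cinv (cayley k)); split; [exact: oD|exact: dy|exact: hol_cinv|exact: my|].
by move=> y dy'; rewrite cimg_cayley.
Qed.

Lemma SO3CxC_manifold : is_manifold (@holomorphic R) (@SO3CxC_atlas R).
Proof.
have iI : injective (@emb_SO3CxC R).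
  move=> [g q] [g' q'] [/SO3_ext -> /matrixP/(_ 0 0)]; rewrite !vecCE /= => ->.
  by [].
have H := @sub_manifold _ _ rg 4 VC _ (@emb_SO3CxC R) cayley (framedVC R) iI.
exact: (H cayley_atlas (fun x => sgn_cover (SO3_val x.1))).
Qed.

End CayleyCharts.

(** * Differentials of linear maps and products *)

Section Differentials.
Variable K : numFieldType.
Implicit Types V W U : normedModType K.

Lemma framed_continuous W U (l : W -> U) : framed W -> linear l -> continuous l.
Proof.
move=> [I [e [c [cc cE]]]] lL.
pose L : {linear W -> U} := HB.pack l (GRing.isLinear.Build _ _ _ _ _ lL).
have -> : l = fun w => \sum_i c i w *: l (e i).
  apply/funext => w; rewrite {1}[w]cE -[l]/(L : W -> U) linear_sum.
  by apply: eq_bigr => i _; rewrite linearZ.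
move=> w; elim: (index_enum I) => [|i r IH].
  have -> : (fun w => \sum_(i <- [::]) c i w *: l (e i)) = fun=> 0.
    by apply/funext => ?; rewrite big_nil.
  exact: cvg_cst.
have -> : (fun w => \sum_(j <- i :: r) c j w *: l (e j)) =
   fun w => c i w *: l (e i) + \sum_(j <- r) c j w *: l (e j).
  by apply/funext => ?; rewrite big_cons.
apply: cvgD; last exact: IH.
by apply: cvgZr_tmp; exact: cc.
Qed.

Lemma is_diff_linear V W U (l : W -> U) (f : V -> W) df x : framed W -> linear l ->
  is_diff x f df -> is_diff x (fun y => l (f y)) (fun v => l (df v)).
Proof.
move=> frW lL fd; have lc := framed_continuous frW lL.
pose L : {linear W -> U} := HB.pack l (GRing.isLinear.Build _ _ _ _ _ lL).
have dL : is_diff (f x) L L.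
  by split; [exact: linear_differentiable|exact: diff_lin].
have [dc E] : is_diff x (L \o f) (L \o df) by apply: is_diff_comp.
by split.
Qed.

Lemma is_diff_sum V W (I : Type) (r : seq I) (f df : I -> V -> W) x :
  (forall i, is_diff x (f i) (df i)) ->
  is_diff x (fun y => \sum_(i <- r) f i y) (fun v => \sum_(i <- r) df i v).
Proof.
move=> fd; elim: r => [|i r IH].
  have -> : (fun y => \sum_(i <- [::]) f i y) = cst 0 by apply/funext => y; rewrite big_nil.
  have -> : (fun y => \sum_(i <- [::]) df i y) = 0 by apply/funext => y; rewrite big_nil.
  exact: is_diff_cst.
have -> : (fun y => \sum_(j <- i :: r) f j y) = f i + (fun y => \sum_(j <- r) f j y).
  by apply/funext => y; rewrite big_cons.
have -> : (fun y => \sum_(j <- i :: r) df j y) = df i + (fun y => \sum_(j <- r) df j y).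
  by apply/funext => y; rewrite big_cons.
exact: is_diffD.
Qed.

Lemma is_diff_mulmx V m n l (f : V -> 'M[K]_(m, n)) (g : V -> 'M[K]_(n, l)) df dg x :
  is_diff x f df -> is_diff x g dg ->
  is_diff x (fun y => f y *m g y) (fun v => df v *m g x + f x *m dg v).
Proof.
move=> fd gd.
have E (A : 'M[K]_(m, n)) (B : 'M[K]_(n, l)) :
    A *m B = \sum_i \sum_j A i j *: (delta_mx i j *m B).
  rewrite {1}[A]matrix_sum_delta mulmx_suml; apply: eq_bigr => i _.
  by rewrite mulmx_suml; apply: eq_bigr => j _; rewrite scalemxAl.
have -> : (fun y => f y *m g y) = fun y => \sum_i \sum_j f y i j *: (delta_mx i j *m g y).
  by apply/funext => y.
have -> : (fun v => df v *m g x + f x *m dg v) = fun v => \sum_i \sum_j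
    (df v i j *: (delta_mx i j *m g x) + f x i j *: (delta_mx i j *m dg v)).
  apply/funext => v; rewrite E (E (f x)) -big_split; apply: eq_bigr => i _.
  by rewrite -big_split.
apply: is_diff_sum => i; apply: is_diff_sum => j.
have cL : linear (fun A : 'M[K]_(m, n) => A i j : K^o) by move=> a A B; rewrite !mxE.
have mL : linear (fun B : 'M[K]_(n, l) => delta_mx i j *m B).
  by move=> a A B; rewrite mulmxDr -scalemxAr.
have [d1 E1] := is_diff_linear (framed_mx K m n) cL fd.
have [d2 E2] := is_diff_linear (framed_mx K n l) mL gd.
have [d3 E3] := is_diff_scale d1 d2.
by split=> //; rewrite E3 E1 E2.
Qed.

(** Equations that hold identically are differentiated with this lemma. *)
Lemma near_const_diff V W (f : V -> W) (df : V -> W) (c : W) x v :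
  is_diff x f df -> (\forall y \near x, f y = c) -> df v = 0.
Proof.
move=> [d <-] fc; have cf : \forall y \near x, cst c y = f y by apply: filterS fc.
by have [_ ->] := near_eq_diff cf (differentiable_cst c x); rewrite diff_cst.
Qed.

Lemma near_is_diff V W (f g df : V -> W) x :
  (\forall y \near x, f y = g y) -> is_diff x f df -> is_diff x g df.
Proof. by move=> E [d <-]; have [? ?] := near_eq_diff E d; split. Qed.

Lemma comp_is_diff V W U (f : V -> W) (g : W -> U) x :
  differentiable f x -> differentiable g (f x) ->
  is_diff x (fun y => g (f y)) (fun v => 'd g (f x) ('d f x v)).
Proof. by move=> df dg; split; [exact: differentiable_comp|exact: diff_comp]. Qed.

End Differentials.

Section Products.
Variable K : numFieldType.
Implicit Types V U : normedModType K.

Lemma crossE (u w : 'cV[K]_3) : cross u w = sk u^T *m w.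
Proof.
by apply/cV3P; rewrite !mulmx3E !mxE /=; ring.
Qed.

Lemma skD a u w : sk (a *: u + w) = a *: sk u + sk w :> 'M[K]_3.
Proof. by apply: mx3P => j; case: (ord3P j) => ->; rewrite !mxE /=; ring. Qed.

Lemma diff_cross0 V (f g df dg : V -> 'cV[K]_3) x v :
  is_diff x f df -> is_diff x g dg ->
  (\forall y \near x, cross (f y) (g y) = 0) ->
  cross (df v) (g x) + cross (f x) (dg v) = 0.
Proof.
move=> fd gd fg.
have sL : linear (fun u : 'cV[K]_3 => sk u^T) by move=> a u w; rewrite linearP skD.
have d2 := is_diff_mulmx (is_diff_linear (framed_mx K 3 1) sL fd) gd.
have Z : \forall y \near x, sk (f y)^T *m g y = 0.
  by apply: filterS fg => y; rewrite crossE.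
by have := near_const_diff v d2 Z; rewrite !crossE.
Qed.

(** For [n2 = a n1] the derivative of [n1 x n2 = 0] determines [n2 x dn2]. *)
Lemma cross_scale (a : K) (n w1 w2 : 'cV[K]_3) :
  cross w1 (a *: n) + cross n w2 = 0 ->
  cross (a *: n) w2 = a ^+ 2 *: cross n w1.
Proof.
move=> /eqP; rewrite addrC addr_eq0 => /eqP H.
have -> : cross (a *: n) w2 = a *: cross n w2 by apply/cV3P; rewrite !mxE /=; ring.
by rewrite H; apply/cV3P; rewrite !mxE /=; ring.
Qed.

Lemma crossZ (a : K) (u : 'cV[K]_3) : cross u (a *: u) = 0.
Proof. by apply/cV3P; rewrite !mxE /=; ring. Qed.

(** Tangent vectors of SO(3) at [g] are the [g *m X] with [X] antisymmetric. *)
Definition tangent (g w : 'M[K]_3) := (g^T *m w)^T = - (g^T *m w).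

Lemma diff_tangent V (f df : V -> 'M[K]_3) x v : is_diff x f df ->
  (\forall y \near x, (f y)^T *m f y = 1%:M) -> tangent (f x) (df v).
Proof.
move=> fd ff.
have tL : linear (@trmx K 3 3) by move=> a A B; rewrite linearP.
have d2 := is_diff_mulmx (is_diff_linear (framed_mx K 3 3) tL fd) fd.
have H := near_const_diff v d2 ff.
by rewrite /tangent trmx_mul trmxK; apply/eqP; rewrite -addr_eq0 H.
Qed.

(** In the frame [g = 1] this identifies the given form with [(i / q) n x dn]. *)
Lemma antisym_cross (i : K) (X : 'M[K]_3) : i * i = -1 -> X^T = - X ->
  bil (X *m e3 K) (col3 [:: 1; i; 0]) *: col3 [:: 1; i; 0] =
  i *: cross (col3 [:: 1; i; 0]) (X *m col3 [:: 1; i; 0]).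
Proof.
move=> i2 /skK <-; move: (ax X) => v {X}.
have E a b c : sk v *m col3 [:: a; b; c] = col3 [:: v 0 o1 * c - v 0 o2 * b;
    v 0 o2 * a - v 0 o0 * c; v 0 o0 * b - v 0 o1 * a].
  by apply/cV3P; rewrite mulmx3E !mxE /=; ring.
rewrite /e3 !E bil3; apply/cV3P; rewrite !mxE /=.
- by transitivity (v 0 o1 - i * v 0 o0); [ring|transitivity (- (i * i) * v 0 o1 + (i * i) * (i * v 0 o0)); [rewrite i2; ring|ring]].
- ring.
- by transitivity (i * v 0 o2 * (1 + i * i)); [rewrite i2; ring|ring].
Qed.

End Products.

(** * The form on the complex bundle *)

Section GammaForm.
Variable R : realType.
Notation C := (Num.NumField.sort R[i]).
Notation VC := ('M[C]_3 * 'rV[C]_1)%type.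
Notation PC := (SO3 C * C)%type.
Notation emb := (@emb_SO3CxC R).
Implicit Types (m : PC) (w : VC).

(** The value of the form at [m] in terms of the isotropic vector [n = g n0]
    and its derivative. *)
Definition gam m w : 'cV[C]_3 :=
  ((@iC R) / m.2) *: cross (val m.1 *m n0 R) (w.1 *m n0 R).

Lemma gam_linear m : linear (gam m).
Proof.
move=> a u v; rewrite /gam /= mulmxDl -scalemxAl !crossE mulmxDr -scalemxAr.
by rewrite scalerDr !scalerA mulrC.
Qed.

Lemma diff_emb1 (U : normedModType R[i]) (phi : U -> PC) x :
  differentiable (emb \o phi) x ->
  is_diff x (fun y => val (phi y).1) (fun v => ('d (emb \o phi) x v).1).
Proof.
move=> dphi; have fL : linear (fst : VC -> 'M[C]_3) by [].
exact: (is_diff_linear (framedVC R) fL (differentiableP dphi)).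
Qed.

Lemma emb_tangent (U : normedModType R[i]) (phi : U -> PC) x v :
  differentiable (emb \o phi) x ->
  tangent (val (phi x).1) ('d (emb \o phi) x v).1.
Proof.
move=> /diff_emb1 d; apply: (diff_tangent v d).
near=> y; exact/SO3_trK/SO3_val.
Unshelve. all: by end_near. Qed.

Lemma diff_emb_n (U : normedModType R[i]) (phi : U -> PC) x :
  differentiable (emb \o phi) x ->
  is_diff x (fun y => val (phi y).1 *m n0 R) (fun v => ('d (emb \o phi) x v).1 *m n0 R).
Proof.
move=> /diff_emb1 d.
have nL : linear (fun A : 'M[C]_3 => A *m n0 R) by move=> a A B; rewrite mulmxDl -scalemxAl.
exact: (is_diff_linear (framed_mx C 3 3) nL d).
Qed.

Lemma n0_iC : n0 R = col3 [:: 1; @iC R; 0]. Proof. by []. Qed.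

Lemma Omega_tilde_gam m w : tangent (val m.1) w.1 ->
  (m.2^-1 * bil (invmx (val m.1) *m (w.1 *m e3 C)) (n0 R)) *: (val m.1 *m n0 R)
  = gam m w.
Proof.
move=> T; have gS := SO3_val m.1; rewrite (SO3_invmx gS) mulmxA.
rewrite -scalerA scalemxAr n0_iC (antisym_cross (iC2 R) T) -n0_iC -scalemxAr -(SO3_cross gS) -mulmxA.
by rewrite (SO3_Ktrm gS) scalerA mulrC.
Qed.

(** Along two lifts of the same curve the isotropic vectors stay proportional:
    differentiating [n1 x n2 = 0] shows that the form does not see the choice
    of the lift. *)
Lemma gam_indep (U : normedModType R[i]) (phi psi : U -> PC) x v :
  differentiable (emb \o phi) x -> differentiable (emb \o psi) x ->
  (\forall y \near x, pi_assC (phi y) = pi_assC (psi y)) -> (phi x).2 != 0 ->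
  gam (psi x) ('d (emb \o psi) x v) = gam (phi x) ('d (emb \o phi) x v).
Proof.
move=> dphi dpsi E q0.
have /assC_eqP[a a0 [nE qE]] := nbhs_singleton E.
have d1 := diff_emb_n dphi; have d2 := diff_emb_n dpsi.
have Z : \forall y \near x, cross (val (phi y).1 *m n0 R) (val (psi y).1 *m n0 R) = 0.
  apply: filterS E => y /assC_eqP[b b0 [-> _]].
  by rewrite crossZ.
have := diff_cross0 v d1 d2 Z; rewrite /gam nE qE.
move=> /cross_scale ->.
by rewrite scalerA; congr (_ *: _); field; rewrite a0 q0.
Qed.

End GammaForm.

Section Omega.
Variable R : realType.
Notation C := (Num.NumField.sort R[i]).
Notation rg := (holomorphic_good R).
Notation VC := ('M[C]_3 * 'rV[C]_1)%type.
Notation PC := (SO3 C * C)%type.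
Notation emb := (@emb_SO3CxC R).
Notation AC := (@assC_atlas R).
Implicit Types (c : chart C (1 + 1) (assC R)) (x : assC R).

Lemma assC_nzP (m : PC) : assC_nz (pi_assC m) <-> m.2 != 0.
Proof.
split=> [ [m' m'0] /assC_eqP[a a0 [_ ->]]|m0]; last by exists m.
by rewrite mulf_neq0 // expf_neq0.
Qed.

Definition is_lift c x (s : 'rV[C]_(1 + 1) -> PC) :=
  [/\ differentiable (emb \o s) (cmap c x), pi_assC (s (cmap c x)) = x
    & \forall z \near cmap c x, pi_assC (s z) = cinv c z].

Lemma section_lift c (m : PC) : AC c -> cdom c (pi_assC m) ->
  exists N s, [/\ open N, N (cmap c (pi_assC m)), @holomorphic R _ _ N (emb \o s),
     s (cmap c (pi_assC m)) = m
   & forall z, N z -> [/\ cdom c (cinv c z), cmap c (cinv c z) = z &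
       pi_assC (s z) = cinv c z]].
Proof.
move=> Ac cm.
have [N [s [ oN Nm sN sm Ns]]] := local_section rg Ac cm (@openT VC) I.
exists N, s; split=> // z Nz; have [cz pz _] := Ns z Nz.
by have [] := cinv_cimg (quot_ok Ac) cz.
Qed.

Lemma lift_exists c x : AC c -> cdom c x -> exists s, is_lift c x s.
Proof.
rewrite -[x]rassCK => Ac cx; have [N [s [ oN Nm sN sm Ns]]] := section_lift Ac cx.
exists s; split; first exact: sN.
  by rewrite sm.
by apply: open_near oN Nm _ => z /Ns[].
Qed.

(** A chosen lift; by [Omega_lift] the choice does not matter. *)
Definition chart_lift c x : 'rV[C]_(1 + 1) -> PC :=
  if pselect (exists s, is_lift c x s) is left h then projT1 (cid h)
  else fun=> rassC x.

Lemma chart_liftP c x : AC c -> cdom c x -> is_lift c x (chart_lift c x).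
Proof.
move=> Ac cx; rewrite /chart_lift; case: pselect => [h|[]]; last exact: lift_exists.
by case: cid.
Qed.

Definition Omega : oneform (1 + 1) (assC R) 'cV[C]_3 := fun c x v =>
  gam (chart_lift c x (cmap c x)) ('d (emb \o chart_lift c x) (cmap c x) v).

Lemma near_preim (U V : normedModType R[i]) (f : U -> V) (O : set V) y :
  {for y, continuous f} -> open O -> O (f y) -> \forall z \near y, O (f z).
Proof. by move=> fc oO Oy; apply: fc; exact: open_nbhs_nbhs. Qed.

(** The coordinates of the class of [phi z] are [F (emb (phi z))], where [F] extends
    the chart; so they are differentiable by the chain rule. *)
Lemma coord_lift c (U : normedModType R[i]) (phi : U -> PC) y : AC c ->
  differentiable (emb \o phi) y -> cdom c (pi_assC (phi y)) ->
  exists (O : set VC) (F : VC -> 'rV[C]_(1 + 1)), [/\ open O, O (emb (phi y)),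
    @holomorphic R _ _ O F,
    forall m, O (emb m) -> cdom c (pi_assC m) /\ cmap c (pi_assC m) = F (emb m)
  & (\forall z \near y, O (emb (phi z))) /\
    is_diff y (fun z => cmap c (pi_assC (phi z)))
      (fun v => 'd F (emb (phi y) : VC) ('d (emb \o phi) y v))].
Proof.
move=> Ac dphi cy; have [ [ O [F [ oO Oy FO OF]]] _] := Ac.2 _ cy.
exists O, F; split=> //.
have nO : \forall z \near y, O (emb (phi z)).
  exact: (near_preim (differentiable_continuous dphi) oO Oy).
split=> //.
have dF : differentiable F (emb (phi y) : VC) by exact: FO.
apply: (near_is_diff _ (comp_is_diff dphi dF)).
by apply: filterS nO => z /OF[_ ->].
Qed.

(** The chosen lift, composed with the coordinates of [phi], lifts the same classes
    as [phi]; so [gam_indep] applies. *)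
Lemma Omega_lift c (U : normedModType R[i]) (phi : U -> PC) y v : AC c ->
  differentiable (emb \o phi) y -> cdom c (pi_assC (phi y)) -> (phi y).2 != 0 ->
  differentiable (fun z => cmap c (pi_assC (phi z))) y /\
  Omega c (pi_assC (phi y)) ('d (fun z => cmap c (pi_assC (phi z))) y v) =
    gam (phi y) ('d (emb \o phi) y v).
Proof.
move=> Ac dphi cy q0.
have [ O [F [ oO Oy FO OF [nO [dc _] ] ] ] ] := coord_lift Ac dphi cy.
split; first exact: dc.
have [ds sx ns] := chart_liftP Ac cy; pose s := chart_lift c (pi_assC (phi y)).
pose k z := cmap c (pi_assC (phi z)).
have kc : {for y, continuous k} by exact: differentiable_continuous.
have E : \forall z \near y, pi_assC (phi z) = pi_assC (s (k z)).
  have h := kc _ ns; near=> z.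
  have -> : pi_assC (s (k z)) = cinv c (k z) by near: z; exact: h.
  have /OF[cz _] : O (emb (phi z)) by near: z; exact: nO.
  by rewrite /k (quot_ok Ac).2.
have [dsk Esk] : is_diff y (emb \o (s \o k)) _ := comp_is_diff dc ds.
rewrite -(gam_indep v dphi dsk E q0) Esk; reflexivity.
Unshelve. all: by end_near. Qed.

Lemma Omega_linear c x : linear (Omega c x).
Proof.
move=> a u v; rewrite /Omega linearP; exact: gam_linear.
Qed.

End Omega.

Section Forms.
Variable R : realType.
Notation C := (Num.NumField.sort R[i]).
Notation rg := (holomorphic_good R).
Notation VC := ('M[C]_3 * 'rV[C]_1)%type.
Notation PC := (SO3 C * C)%type.
Notation emb := (@emb_SO3CxC R).
Notation AC := (@assC_atlas R).

Lemma hol_gam (U : normedModType R[i]) (O : set U) (phi : U -> PC) (w : U -> VC) :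
  open O -> @holomorphic R _ _ O (emb \o phi) -> @holomorphic R _ _ O w ->
  (forall y, O y -> (phi y).2 != 0) ->
  @holomorphic R _ _ O (fun y => gam (phi y) (w y)).
Proof.
move=> oO hphi hw q0.
have h1 : @holomorphic R _ _ O (fun y => val (phi y).1).
  exact: (reg_fst rg (framed_mx C 3 3) (framed_mx C 1 1) oO hphi).
have h2 : @holomorphic R _ _ O (fun y => (phi y).2 : C).
  have := reg_coord rg 0 0 oO (reg_snd rg (framed_mx C 3 3) (framed_mx C 1 1) oO hphi).
  by apply: (reg_eq rg oO) => y _; rewrite /= vecCE.
have hn : @holomorphic R _ _ O (fun y => val (phi y).1 *m n0 R).
  by apply: (reg_mulmx rg oO); [exact: h1|exact: (reg_cst rg)].
have hw1 : @holomorphic R _ _ O (fun y => (w y).1 *m n0 R).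
  apply: (reg_mulmx rg oO); last exact: (reg_cst rg).
  exact: (reg_fst rg (framed_mx C 3 3) (framed_mx C 1 1) oO hw).
apply: (reg_scale rg oO).
  apply: (reg_mul rg oO); first exact: (reg_cst rg).
  exact: (reg_inv rg oO q0 h2).
have E : (fun y => cross (val (phi y).1 *m n0 R) ((w y).1 *m n0 R)) =
    fun y => sk (val (phi y).1 *m n0 R)^T *m ((w y).1 *m n0 R).
  by apply/funext => y; rewrite crossE.
rewrite E; apply: (reg_mulmx rg oO) hw1.
have hT : @holomorphic R _ _ O (fun y => (val (phi y).1 *m n0 R)^T).
  exact: (reg_trmx rg oO hn).
have hc j : @holomorphic R _ _ O (fun y => (val (phi y).1 *m n0 R)^T 0 j).
  exact: (reg_coord rg 0 j oO hT).
by apply: (reg_mx3 rg oO); first [exact: (reg_cst rg)|exact: hc|apply: (reg_opp rg oO); exact: hc].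
Qed.

(** Near a given point one holomorphic lift computes the form at all points. *)
Lemma Omega_section c (m : PC) : AC c -> cdom c (pi_assC m) -> m.2 != 0 ->
  exists N (s : 'rV[C]_(1 + 1) -> PC),
   [/\ open N, N (cmap c (pi_assC m)), @holomorphic R _ _ N (emb \o s),
     forall z, N z -> (s z).2 != 0
   & forall z v, N z -> Omega c (cinv c z) v = gam (s z) ('d (emb \o s) z v)].
Proof.
move=> Ac cm m0; have [N [s [ oN Nm sN sm Ns]]] := section_lift Ac cm.
have hq : @holomorphic R _ _ N (fun y => (s y).2 : C).
  have := reg_coord rg 0 0 oN (reg_snd rg (framed_mx C 3 3) (framed_mx C 1 1) oN sN).
  by apply: (reg_eq rg oN) => y _; rewrite /= vecCE.
exists (N `&` [set y | (s y).2 != 0]), s; split.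
- exact: (reg_open_preim rg oN (@open_neq0 C) hq).
- by split=> //=; rewrite sm.
- by apply: (reg_sub rg) sN => y [].
- by move=> z [].
move=> z v [Nz q0]; have [cz cK pz] := Ns z Nz.
have ds : differentiable (emb \o s) z by exact: sN.
have cs : cdom c (pi_assC (s z)) by rewrite pz.
have [_ <-] := Omega_lift v Ac ds cs q0; rewrite pz.
have E : \forall y \near z, id y = cmap c (pi_assC (s y)).
  by apply: open_near oN Nz _ => y /Ns[_ yK ->]; rewrite yK.
by have [_ ->] := near_is_diff E (is_diff_id z).
Qed.

Lemma Omega_oneform : is_oneform (@holomorphic R) AC (@assC_nz R) (@Omega R).
Proof.
split.
- by move=> c x _ _ _; exact: Omega_linear.
- move=> c c' x v Ac Ac' xnz cx c'x; have [ds sx ns] := chart_liftP Ac cx.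
  have q0 : (chart_lift c x (cmap c x)).2 != 0 by apply/assC_nzP; rewrite sx.
  have cs : cdom c' (pi_assC (chart_lift c x (cmap c x))) by rewrite sx.
  have [dk E] := Omega_lift v Ac' ds cs q0; rewrite sx in E.
  rewrite {1}/Omega -E.
  have N : \forall z \near cmap c x, cmap c' (pi_assC (chart_lift c x z)) = (cmap c' \o cinv c) z.
    by apply: filterS ns => z /= ->.
  have [_ EN] := near_eq_diff N dk.
  exact: (congr1 (fun f => Omega c' x (f v)) (esym EN)).
move=> c v Ac; apply: (reg_locally rg) => _ [x [cx xnz] <-].
move: cx xnz; rewrite -[x]rassCK => cx /assC_nzP m0.
have [N [s [ oN Nx sN sq Ns]]] := Omega_section Ac cx m0.
exists N; split=> //.
have hw := holomorphic_diff v (framedVC R) oN sN.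
have hg := hol_gam oN sN hw sq.
apply: (@reg_eq _ _ rg _ _ _ _ _ oN _ hg) => z Nz.
by rewrite (Ns z v Nz).
Qed.

Lemma cinv_holomorphic c : @SO3CxC_atlas R c ->
  open (cimg c) /\ @holomorphic R _ _ (cimg c) (emb \o cinv c).
Proof. exact: (cinv_reg rg). Qed.

Lemma Omega_tildeE c m v : @SO3CxC_atlas R c -> cdom c m ->
  Omega_tilde c m v = gam m ('d (emb \o cinv c) (cmap c m) v).
Proof.
move=> Ac cm; have [ oc hc] := cinv_holomorphic Ac.
have dc : differentiable (emb \o cinv c) (cmap c m) by apply: hc; exists m.
have := emb_tangent v dc; have E0 : cinv c (cmap c m) = m := (quot_ok Ac).2 m cm.
rewrite E0 => T; exact: Omega_tilde_gam.
Qed.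

Lemma Omega_tilde_oneform :
  is_oneform (@holomorphic R) (@SO3CxC_atlas R) (@SO3CxC_nz R) (@Omega_tilde R).
Proof.
split.
- move=> c m Ac _ cm a u v; rewrite !(Omega_tildeE _ Ac cm) linearP; exact: gam_linear.
- move=> c c' m v Ac Ac' _ cm c'm; rewrite (Omega_tildeE v Ac cm) (Omega_tildeE _ Ac' c'm).
  apply: (congr1 (gam m)).
  have [ oI hI] := quot_compat rg (framedVC R) (fun x => ex_intro _ x erefl) Ac Ac'.
  have Im : (cmap c @` (cdom c `&` cdom c')) (cmap c m) by exists m.
  have dt : differentiable (cmap c' \o cinv c) (cmap c m) by exact: hI.
  have E0 : (cmap c' \o cinv c) (cmap c m) = cmap c' m by rewrite /= (quot_ok Ac).2.
  have dc' : differentiable (emb \o cinv c') ((cmap c' \o cinv c) (cmap c m)).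
    by rewrite E0; apply: (cinv_holomorphic Ac').2; exists m.
  have [d E] := comp_is_diff dt dc'.
  have N : \forall z \near cmap c m,
      (emb \o cinv c') ((cmap c' \o cinv c) z) = (emb \o cinv c) z.
    apply: open_near oI Im _ => _ [x [cx c'x] <-] /=.
    by rewrite (quot_ok Ac).2 // (quot_ok Ac').2.
  have [_ EN] := near_eq_diff N d.
  have D z w : z = cmap c' m ->
    'd (emb \o cinv c') z w = 'd (emb \o cinv c') (cmap c' m) w by move=> ->.
  have E1 := congr1 (fun f => f v) EN; have E2 := congr1 (fun f => f v) E.
  exact: etrans E1 (etrans E2 (D _ _ E0)).
move=> c v Ac; have [ oc hc] := cinv_holomorphic Ac.
have oI : open (cmap c @` (cdom c `&` @SO3CxC_nz R)).
  apply: (quot_image_open rg (p := id) (fun x => ex_intro _ x erefl) Ac) => m m0.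
  exists [set p : VC | p.2 0 0 != 0]; split.
  - have := reg_open_preim rg (@openT VC) (@open_neq0 C)
      (reg_coord rg 0 0 (@openT VC) (@hol_snd R setT (@openT VC))).
    by rewrite setTI.
  - by rewrite /= vecCE.
  - by move=> m' /=; rewrite vecCE.
have sub : cmap c @` (cdom c `&` @SO3CxC_nz R) `<=` cimg c by move=> _ [x [cx _] <-]; exists x.
have hw := reg_sub rg sub (holomorphic_diff v (framedVC R) oc hc).
have q0 z : (cmap c @` (cdom c `&` @SO3CxC_nz R)) z -> (cinv c z).2 != 0.
  by move=> [x [cx x0] <-]; rewrite (quot_ok Ac).2.
have hg := hol_gam oI (reg_sub rg sub hc) hw q0.
apply: (@reg_eq _ _ rg _ _ _ _ _ oI _ hg) => _ [x [cx _] <-].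
by rewrite (Omega_tildeE _ Ac) (quot_ok Ac).2.
Qed.

Lemma pullback_pi : is_pullback (@SO3CxC_atlas R) AC (@SO3CxC_nz R)
  (@pi_assC R) (@Omega R) (@Omega_tilde R).
Proof.
move=> c c' m Ac Ac' m0 cm c'm; have [ oc hc] := cinv_holomorphic Ac.
have dc : differentiable (emb \o cinv c) (cmap c m) by apply: hc; exists m.
have E0 : cinv c (cmap c m) = m by rewrite (quot_ok Ac).2.
have cs : cdom c' (pi_assC (cinv c (cmap c m))) by rewrite E0.
have q0 : (cinv c (cmap c m)).2 != 0 by rewrite E0.
split; first by have [] := Omega_lift 0 Ac' dc cs q0.
move=> v; have [_ E] := Omega_lift v Ac' dc cs q0.
rewrite (Omega_tildeE v Ac cm).
have G w : gam m w = gam (cinv c (cmap c m)) w by rewrite E0.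
apply: etrans (G _) (etrans (esym E) _).
exact: (congr1 (fun p => Omega c' (pi_assC p) _) E0).
Qed.

Lemma gam_mul (h : SO3 C) (m : PC) (w : VC) :
  gam (SO3mul h m.1, m.2) (val h *m w.1, w.2) = val h *m gam m w.
Proof.
by rewrite /gam /= -!mulmxA (SO3_cross (SO3_val h)) scalemxAr.
Qed.

Lemma pullback_Lmul (h : SO3 C) : is_pullback AC AC (@assC_nz R) (Lmul h)
  (@Omega R) (fun c x v => val h *m Omega c x v).
Proof.
move=> c c' x Ac Ac' xnz cx c'x; have [ds sx ns] := chart_liftP Ac cx.
set s := chart_lift c x in ds sx ns; pose phi z : PC := (SO3mul h (s z).1, (s z).2).
have hL : linear (fun p : VC => (val h *m p.1, p.2) : VC).
  by move=> a p q; rewrite /= mulmxDr -scalemxAr.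
have [dphi Ephi] : is_diff (cmap c x) (emb \o phi) _ :=
  is_diff_linear (framedVC R) hL (differentiableP ds).
have E0 : pi_assC (phi (cmap c x)) = Lmul h x by rewrite -sx LmulE sx.
have cs : cdom c' (pi_assC (phi (cmap c x))) by rewrite E0.
have q0 : (phi (cmap c x)).2 != 0.
  by apply: (assC_nzP (s (cmap c x))).1; rewrite sx.
have N : \forall z \near cmap c x,
    cmap c' (pi_assC (phi z)) = (cmap c' \o Lmul h \o cinv c) z.
  by apply: filterS ns => z /= <-; rewrite LmulE.
have [dk _] := Omega_lift 0 Ac' dphi cs q0.
have [dk' Ek'] := near_eq_diff N dk; split; first exact: dk'.
move=> v.
have [_ E] := Omega_lift v Ac' dphi cs q0.
have E1 := congr1 (fun f => Omega c' (Lmul h x) (f v)) Ek'.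
have E2 := congr1 (fun f => gam (phi (cmap c x)) (f v)) Ephi.
apply: esym; apply: (etrans E1); rewrite -E0; apply: (etrans E).
apply: (etrans E2); exact: gam_mul.
Qed.

End Forms.

(** * Curves with a given tangent vector *)

Section TangentCurves.
Variable R : realType.
Notation C := (Num.NumField.sort R[i]).
Notation rg := (holomorphic_good R).
Notation VC := ('M[C]_3 * 'rV[C]_1)%type.
Notation PC := (SO3 C * C)%type.
Notation emb := (@emb_SO3CxC R).
Notation AC := (@assC_atlas R).

Section Curve.
Variables (m : PC) (w : VC).
Hypothesis wT : tangent (val m.1) w.1.

Let B : 'M[C]_3 := 2^-1 *: ((val m.1)^T *m w.1).

Let tB (y : 'rV[C]_1) : 'M[C]_3 := y 0 0 *: B.

Let D : set 'rV[C]_1 := [set y | \det (1%:M - tB y) != 0].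

Let curve (y : 'rV[C]_1) : PC := (SO3of (val m.1 *m cay (tB y)), m.2 + y 0 0 * w.2 0 0).

Let tB_hol (O : set 'rV[C]_1) : open O -> @holomorphic R _ _ O (fun y => 1%:M - tB y).
Proof.
move=> oO; apply: (reg_subr rg oO); first exact: (reg_cst rg).
apply: (reg_scale rg oO); last exact: (reg_cst rg).
exact: (reg_coord rg 0 0 oO (reg_id rg O)).
Qed.

Let open_D : open D.
Proof.
have oT := @openT 'rV[C]_1; have h := reg_det rg oT (tB_hol oT).
by have := reg_open_preim rg oT (@open_neq0 C) h; rewrite setTI.
Qed.

Let tB_antisym y : (tB y)^T = - tB y.
Proof. by rewrite /tB /B !linearZ /= wT !scalerN. Qed.

Let curveE y : D y -> val (curve y).1 = val m.1 *m cay (tB y).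
Proof.
move=> dy; rewrite /= SO3ofE //; apply: inSO3M; first exact: SO3_val.
by apply: inSO3_cay; [exact: tB_antisym|exact: dy].
Qed.

Let tB0 : tB 0 = 0.
Proof. by rewrite /tB mxE scale0r. Qed.

Let D0 : D 0.
Proof. by rewrite /D /= tB0 subr0 det1 oner_neq0. Qed.

Let curve0 : curve 0 = m.
Proof.
apply: injective_projections; last by rewrite /= mxE mul0r addr0.
apply: SO3_ext; rewrite (curveE D0) tB0 /cay /cayR subr0 addr0.
by rewrite invr1 mulr1; exact: mulmx1.
Qed.

Let curve_diff : differentiable (emb \o curve) 0.
Proof.
have oD := open_D; suff h : @holomorphic R _ _ D (emb \o curve) by exact: h D0.
have hy : @holomorphic R _ _ D (fun y => y 0 0) := reg_coord rg 0 0 oD (reg_id rg D).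
apply: (@reg_eq _ _ rg _ _ _ (fun y => (val m.1 *m cay (tB y), vecC (m.2 + y 0 0 * w.2 0 0))) _ oD).
  by move=> y dy; rewrite /emb_SO3CxC /comp curveE.
apply: (reg_pair rg (framed_mx C 3 3) (framed_mx C 1 1) oD).
  apply: (reg_mulmx rg oD); first exact: (reg_cst rg).
  apply: (reg_mulmx rg oD).
    by apply: (reg_invmx rg oD); [move=> y; exact|exact: tB_hol].
  apply: (reg_add rg oD); first exact: (reg_cst rg).
  apply: (reg_scale rg oD) hy _; exact: (reg_cst rg).
apply: (hol_vecC oD); apply: (reg_add rg oD); first exact: (reg_cst rg).
by apply: (reg_mul rg oD) hy _; exact: (reg_cst rg).
Qed.

Let dcurve v := 'd (emb \o curve) 0 v.

Let dcurve1 v : (dcurve v).1 = v 0 0 *: w.1.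
Proof.
have gS := SO3_val m.1; set g := val m.1 in gS *.
pose P (y : 'rV[C]_1) : 'M[C]_3 := y 0 0 *: (B *m g^T).
have PL : linear P by move=> a x y; rewrite /P !mxE scalerDl scalerA.
have QL : linear tB by move=> a x y; rewrite /tB !mxE scalerDl scalerA.
have dP := is_diff_linear (framed_mx C 1 1) PL (is_diff_id (0 : 'rV[C]_1)).
have dQ := is_diff_linear (framed_mx C 1 1) QL (is_diff_id (0 : 'rV[C]_1)).
have dgP : is_diff (0 : 'rV[C]_1) (fun y => g^T - P y) (fun v => 0 - P v).
  exact: (is_diffB (is_diff_cst g^T 0) dP).
have dH := diff_emb1 curve_diff.
have dE := is_diffB (is_diff_mulmx dgP dH) dQ.
have E : \forall y \near (0 : 'rV[C]_1),
    ((fun y => (g^T - P y) *m val (curve y).1) - (fun y => tB y)) y = 1%:M.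
  apply: open_near open_D D0 _ => y dy.
  change ((g^T - P y) *m val (curve y).1 - tB y = 1%:M).
  rewrite (curveE dy) -/g /P scalemxAl -{1}[g^T]mul1mx -mulmxBl -mulmxA (SO3_trKm gS).
  rewrite /cay /cayR -/(tB y); apply/eqP; rewrite subr_eq; apply/eqP.
  by apply: mulVKr; rewrite det_unit.
have : (0 - P v) *m val (curve 0).1 + (g^T - P 0) *m (dcurve v).1 - tB v = 0.
  exact: (near_const_diff v dE E).
rewrite curve0 -/g /P /tB mxE scale0r subr0 sub0r mulNmx -scalemxAl -mulmxA (SO3_trK gS) mulmx1.
move/eqP; rewrite addrAC -opprD addrC subr_eq0 -scalerDl => /eqP H.
rewrite -[LHS](SO3_Ktrm gS) H /B.
rewrite -!scalemxAr (SO3_Ktrm gS) scalerA; congr (_ *: _).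
by field.
Qed.

Let dcurve2 v : (dcurve v).2 = v 0 0 *: w.2.
Proof.
have sL : linear (snd : VC -> 'rV[C]_1) by [].
have [_ E] := is_diff_linear (framedVC R) sL (differentiableP curve_diff).
pose P (y : 'rV[C]_1) : 'rV[C]_1 := y 0 0 *: w.2.
have PL : linear P by move=> a x y; rewrite /P !mxE scalerDl scalerA.
have dP := is_diff_linear (framed_mx C 1 1) PL (is_diff_id (0 : 'rV[C]_1)).
have dcP := is_diffD (is_diff_cst (vecC m.2 : 'rV[C]_1) (0 : 'rV[C]_1)) dP.
have N : \forall y \near (0 : 'rV[C]_1),
    (cst (vecC m.2) + (fun y => P y)) y = ((emb \o curve) y).2.
  by apply: open_near (@openT _) I _ => y _; apply/rowP => j; rewrite ord1 !mxE.
have [_ E'] := near_is_diff N dcP.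
apply: (etrans (esym (congr1 (fun f => f v) E))).
apply: (etrans (congr1 (fun f => f v) E')).
by change (0 + P v = v 0 0 *: w.2); rewrite add0r.
Qed.

(** The curve is [g cay (t B)] with [2 B = g^-1 w]. Its velocity is found by
    differentiating [(1 - t B) cay (t B) = 1 + t B]. *)
Lemma tangent_curve : exists phi : 'rV[C]_1 -> PC,
  [/\ phi 0 = m, differentiable (emb \o phi) 0
    & 'd (emb \o phi) 0 (const_mx 1) = w].
Proof.
exists curve; split; [exact: curve0|exact: curve_diff|].
apply: injective_projections.
  by rewrite [LHS]dcurve1 mxE scale1r.
by rewrite [LHS]dcurve2 mxE scale1r.
Qed.

End Curve.

(** By [Omega_lift], applied to the curve of [tangent_curve]. *)
Lemma Omega_tangent c (m : PC) (w : VC) (O : set VC) (F : VC -> 'rV[C]_(1 + 1)) :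
  AC c -> cdom c (pi_assC m) -> m.2 != 0 -> tangent (val m.1) w.1 ->
  open O -> O (emb m) -> differentiable F (emb m : VC) ->
  (forall m', O (emb m') -> cmap c (pi_assC m') = F (emb m')) ->
  Omega c (pi_assC m) ('d F (emb m : VC) w) = gam m w.
Proof.
move=> Ac cm m0 wT oO Om dF OF; have [phi [phi0 dphi dw]] := tangent_curve wT.
have cs : cdom c (pi_assC (phi 0)) by rewrite phi0.
have q0 : (phi 0).2 != 0 by rewrite phi0.
have [_ E] := Omega_lift (const_mx 1) Ac dphi cs q0.
rewrite dw phi0 in E; rewrite -E; apply: (congr1 (Omega c (pi_assC m))).
have Om' : O ((emb \o phi) 0) by rewrite /= phi0.
have dF' : differentiable F ((emb \o phi) 0 : VC) by rewrite /= phi0.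
have N : \forall z \near (0 : 'rV[C]_1), F ((emb \o phi) z) = cmap c (pi_assC (phi z)).
  have := near_preim (differentiable_continuous dphi) oO Om'.
  by apply: filterS => z Oz; rewrite OF.
have [_ E'] := near_is_diff N (comp_is_diff dphi dF').
apply: (etrans _ (esym (congr1 (fun f => f (const_mx 1)) E'))).
by rewrite dw /= phi0.
Qed.

End TangentCurves.

(** * The real part of the form *)

Section RealBounds.
Variable R : realType.
Notation C := (Num.NumField.sort R[i]).

Lemma framed_real_linear (V : normedModType R) (V' : normedModType R[i]) (j : V -> V') :
  framed V -> (forall (a : R) u v, j (a *: u + v) = (a%:C : C) *: j u + j v) ->
  real_linear j.
Proof.
move=> [I [e [l [lc lE]]]] jL; split=> //.
have j0 : j 0 = 0.
  by have := jL 1 0 0; rewrite scaler0 addr0 scale1r => /eqP; rewrite -subr_eq0 opprD addNKr oppr_eq0 => /eqP.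
have jS (r : seq I) h : j (\sum_(i <- r) l i h *: e i) = \sum_(i <- r) ((l i h)%:C : C) *: j (e i).
  by elim: r => [|i r IH]; rewrite ?big_nil ?big_cons // jL IH.
suff [k k0 jk] : exists2 k : R, 0 <= k & forall h,
    `|\sum_(i <- index_enum I) ((l i h)%:C : C) *: j (e i)| <= (k * `|h|)%:C.
  exists (k + 1); first by rewrite ltr_wpDl.
  move=> h; rewrite {1}[h]lE jS; apply: le_trans (jk h) _.
  by rewrite lecR ler_wpM2r // lerDl.
elim: (index_enum I) => [|i r [k k0 IH]].
  by exists 0 => // h; rewrite big_nil normr0 mul0r.
have [k' k'0 lk] := linear_lipschitz (lc i).
have /ge0_cplx[n n0 nE] : 0 <= `|j (e i)| by [].
exists (k' * n + k); first by rewrite addr_ge0 // mulr_ge0 // ltW.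
move=> h; rewrite big_cons; apply: le_trans (ler_normD _ _) _.
rewrite mulrDl rmorphD; apply: lerD (IH h).
rewrite normrZ normc_real nE -rmorphM lecR mulrAC; exact: ler_wpM2r (lk h).
Qed.

Lemma framed_real_form (W : normedModType R[i]) (W' : normedModType R) (r : W -> W') :
  framed W -> (forall (a : R) u v, r ((a%:C : C) *: u + v) = a *: r u + r v) ->
  real_form r.
Proof.
move=> [I [e [l [lc lE]]]] rL; split=> //.
have r0 : r 0 = 0.
  by have := rL 1 0 0; rewrite scaler0 addr0 scale1r => /eqP; rewrite -subr_eq0 opprD addNKr oppr_eq0 => /eqP.
have rD u v : r (u + v) = r u + r v by have := rL 1 u v; rewrite !scale1r.
have rZ (a : R) u : r ((a%:C : C) *: u) = a *: r u by have := rL a u 0; rewrite r0 !addr0.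
have rS (s : seq I) h : r (\sum_(i <- s) l i h *: e i) = \sum_(i <- s) r (l i h *: e i).
  by elim: s => [|i s IH]; rewrite ?big_nil ?big_cons // rD IH.
suff [k k0 rk] : exists2 k : R, 0 <= k & forall h,
    `|\sum_(i <- index_enum I) r (l i h *: e i)|%:C <= k%:C * `|h|.
  exists (k + 1); first by rewrite ltr_wpDl.
  move=> h; rewrite {1}[h]lE rS; apply: le_trans (rk h) _.
  by rewrite ler_wpM2r // lecR lerDl.
elim: (index_enum I) => [|i s [k k0 IH]].
  by exists 0 => // h; rewrite big_nil normr0 mul0r.
have [k' /pos_cplx[k'' k''0 ->] lk] := linear_lipschitz (lc i).
exists (k'' * (`|r (e i)| + `|r ((@iC R : C) *: e i)|) + k).
  apply: addr_ge0 k0; apply: mulr_ge0; [exact: ltW|exact: addr_ge0].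
move=> h; rewrite big_cons; apply: le_trans (_ : (`|r (l i h *: e i)| + `|\sum_(j <- s) r (l j h *: e j)|)%:C <= _).
  by rewrite lecR ler_normD.
rewrite rmorphD rmorphD mulrDl; apply: lerD (IH h).
apply: le_trans (_ : `|l i h| * (`|r (e i)| + `|r ((@iC R : C) *: e i)|)%:C <= _); last first.
  by rewrite rmorphM mulrAC; apply: ler_wpM2r (lk h); rewrite lecR addr_ge0.
have zE (z : C) : z = (complex.Re z)%:C + (complex.Im z)%:C * @iC R.
  by case: z => a b; apply/eqP; rewrite eq_complex /=; apply/andP; split; apply/eqP; ring.
have -> : r (l i h *: e i) = complex.Re (l i h) *: r (e i) + complex.Im (l i h) *: r ((@iC R : C) *: e i).
  by rewrite {1}(zE (l i h)) scalerDl rD -scalerA !rZ.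
apply: le_trans (_ : (`|complex.Re (l i h)| * `|r (e i)| + `|complex.Im (l i h)| * `|r ((@iC R : C) *: e i)|)%:C <= _).
  by rewrite lecR -!normrZ ler_normD.
rewrite !rmorphD !rmorphM mulrDr /=; apply: lerD.
  by apply: ler_wpM2r; [rewrite lecR|exact: Re_le_norm].
by apply: ler_wpM2r; [rewrite lecR|exact: Im_le_norm].
Qed.

Lemma real_linear_near (V : normedModType R) (V' : normedModType R[i]) (j : V -> V')
    (O : set V') x : real_linear j -> open O -> O (j x) -> \forall y \near x, O (j y).
Proof.
move=> [jL [k k0 jk]] oO Ox.
have : nbhs (j x) O by exact: open_nbhs_nbhs.
move=> /nbhs_ballP[_ /= /pos_cplx[e e0 ->] eO].
have ek0 : 0 < e / k by rewrite divr_gt0.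
have : nbhs x (ball x (e / k)) by exact: nbhsx_ballx.
apply: filterS => y xy; apply: eO; move: xy; rewrite -!ball_normE /= => xy.
have -> : j x - j y = j (x - y).
  have := jL (-1) y x; rewrite rmorphN1 !scaleN1r => jE.
  by rewrite addrC -jE (addrC x).
by apply: le_lt_trans (jk _) _; rewrite ltcR mulrC -ltr_pdivlMr.
Qed.

Lemma diff_real0 (V : normedModType R) (V' W : normedModType R[i])
    (W' : normedModType R) (j : V -> V') (r : W -> W') (F : V' -> W) x :
  real_linear j -> real_form r -> differentiable F (j x) ->
  is_diff x (fun y => r (F (j y))) (fun h => r ('d F (j x) (j h))).
Proof.
move=> jL rF dF; have dF0 : differentiable F (0 + j x) by rewrite add0r.
have [d E] := diff_real jL rF dF0.
have FE : (fun y => r (F (0 + j y))) = fun y => r (F (j y)).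
  by apply/funext => y; rewrite add0r.
rewrite FE in d E; split=> //; apply: (etrans E).
by apply/funext => h; rewrite add0r.
Qed.

End RealBounds.

Section RealPart.
Variable R : realType.
Notation C := (Num.NumField.sort R[i]).
Notation VC := ('M[C]_3 * 'rV[C]_1)%type.
Notation VR := ('M[R]_3 * 'rV[R]_2)%type.
Notation VQ := ('cV[R]_3 * 'M[R]_3)%type.
Notation PC := (SO3 C * C)%type.
Notation PR := (SO3 R * C)%type.
Notation emb := (@emb_SO3CxC R).

Lemma framedVQ : framed VQ. Proof. by apply: framed_prod; exact: framed_mx. Qed.

Definition cplxify (p : VR) : VC := (cm p.1, vecC (lC p.2)).

Definition inclP (m : PR) : PC := (SO3incl m.1, m.2).

Lemma emb_inclP m : emb (inclP m) = cplxify (emb_SO3RxC m).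
Proof. by rewrite /emb_SO3CxC /cplxify /= lC_vecR. Qed.

Lemma cplxify_real_linear : real_linear cplxify.
Proof.
apply: (framed_real_linear (@framedVR R)) => a u v; apply: injective_projections.
  by apply/matrixP => i j; rewrite !mxE rmorphD rmorphM.
apply/rowP => j; rewrite !mxE; apply/eqP; rewrite eq_complex /= !mxE.
by rewrite !mul0r subr0 addr0 !eqxx.
Qed.

Lemma real_vec_form n : real_form (@real_vec R n).
Proof.
apply: (framed_real_form (framed_mx C 1 n)) => a u v.
rewrite /real_vec scale_row_mx add_row_mx; congr row_mx; apply/rowP => j; rewrite !mxE.
  by case: (u 0 j) (v 0 j) => [u1 u2] [v1 v2] /=; ring.
by case: (u 0 j) (v 0 j) => [u1 u2] [v1 v2] /=; ring.
Qed.

Lemma Re_mulmx (g : 'M[R]_3) (z : 'cV[C]_3) :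
  map_mx (@complex.Re R) (cm g *m z) = g *m map_mx (@complex.Re R) z.
Proof.
have rm (a : R) (w : C) : complex.Re ((a%:C : C) * w) = a * complex.Re w.
  by case: w => x y /=; rewrite mul0r subr0.
apply/cV3P; rewrite mxE !mulmx3E !mxE !raddfD /= !rm; reflexivity.
Qed.

Lemma Re_n0 (z : C) : map_mx (@complex.Re R) (z *: n0 R) =
  col3 [:: complex.Re z; - complex.Im z; 0].
Proof. by case: z => a b; apply/cV3P; rewrite !mxE /=; ring. Qed.

Lemma Qe3_col (q z : C) : Qe3 q *m col3 [:: complex.Re z; - complex.Im z; 0] =
  col3 [:: complex.Re (q * z); complex.Im (q * z); 0].
Proof. by case: q z => [q1 q2] [a b]; apply/cV3P; rewrite mulmx3E !mxE /=; ring. Qed.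

(** In the frame [g] the inverse of [q] on the tangent plane is
    [z |-> conj (z / q)], which is the real part of [(z / q) *: g n0]. *)
Lemma Q_invE (m : PR) (z : C) : m.2 != 0 ->
  Q_inv (Fpi m) (val m.1 *m col3 [:: complex.Re z; complex.Im z; 0]) =
  map_mx (@complex.Re R) ((z / m.2) *: (cm (val m.1) *m n0 R)).
Proof.
move=> q0; have gS := SO3_val m.1.
rewrite scalemxAr Re_mulmx Re_n0; apply: xget_unique => /=.
  split; first by rewrite (SO3_bil gS) bil3 !mxE /=; ring.
  rewrite (SO3_invmx gS) -!mulmxA (SO3_trKm gS) Qe3_col.
  by rewrite mulrC divfK.
move=> w [sw qw]; have [u uE] : exists u, u = (val m.1)^T *m w by eexists.
rewrite -[w](SO3_Ktrm gS) -uE; congr (_ *m _).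
have u2 : u o2 0 = 0.
  have : bil (e3 R) u = 0 by rewrite -(SO3_bil gS) uE (SO3_Ktrm gS).
  by rewrite bil3 !mxE /= => <-; ring.
pose y : C := u o0 0 +i* - u o1 0.
have yE : u = col3 [:: complex.Re y; - complex.Im y; 0].
  by apply/cV3P; rewrite !mxE /= ?opprK ?u2.
have : Qe3 m.2 *m u = col3 [:: complex.Re z; complex.Im z; 0].
  rewrite -[LHS](SO3_trKm gS) uE -(SO3_trKm gS (col3 _)) -qw (SO3_invmx gS).
  by rewrite !mulmxA.
rewrite {1}yE Qe3_col => /colP E.
have yz : m.2 * y = z.
  have := E o0; have := E o1; rewrite !mxE /=.
  by case: (z) (m.2 * y) => [z1 z2] [y1 y2] /= -> ->.
by rewrite yE -yz (mulrC m.2) mulfK.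
Qed.

Lemma tangent_cm (g w : 'M[R]_3) : tangent g w -> tangent (cm g) (cm w).
Proof.
move=> T; rewrite /tangent -cm_tr -cmM -cm_tr T; apply/matrixP => i j.
by rewrite !mxE rmorphN.
Qed.

(** In the frame [g] both sides only involve the third column of [g^T w]. *)
Lemma Re_gam (m : PR) (w : VR) : m.2 != 0 -> tangent (val m.1) w.1 ->
  Q_inv (Fpi m) (w.1 *m e3 R) = map_mx (@complex.Re R) (gam (inclP m) (cplxify w)).
Proof.
move=> q0 T; have gS := SO3_val m.1; have gSC := SO3_val (SO3incl m.1).
have TC : tangent (val (inclP m).1) (cplxify w).1 by exact: tangent_cm.
rewrite -(Omega_tilde_gam TC) (SO3_invmx gSC).
have [X XE] : exists X, X = (val m.1)^T *m w.1 by eexists.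
have X2 : X o2 o2 = 0.
  have /matrixP/(_ o2 o2) := T; rewrite -XE !mxE => /eqP.
  by rewrite -addr_eq0 -mulr2n -mulr_natl mulf_eq0 pnatr_eq0 /= => /eqP.
pose z : C := X o0 o2 +i* X o1 o2.
have -> : w.1 *m e3 R = val m.1 *m col3 [:: complex.Re z; complex.Im z; 0].
  rewrite -[LHS](SO3_Ktrm gS); congr (_ *m _); rewrite mulmxA -XE.
  by apply/cV3P; rewrite mulmx3E !mxE /= ?X2; ring.
rewrite Q_invE //; congr (map_mx _ (_ *: _)); rewrite mulrC; congr (_ * _).
have -> : (val (inclP m).1)^T *m ((cplxify w).1 *m e3 C) = cm X *m e3 C.
  by rewrite mulmxA XE cmM cm_tr.
have E i : (cm X *m e3 C) i 0 = ((X i o2)%:C : C).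
  by rewrite mulmx3E !mxE /= !mulr0 mulr1 !add0r.
rewrite bil3 !E n0_iC /col3 ![(\col__ _) _ _]mxE /= mulr1 mulr0 addr0 /z.
by apply/eqP; rewrite eq_complex /= !mul0r !mulr0 !mulr1 subr0 !addr0 add0r !eqxx.
Qed.

End RealPart.

Section Pullback.
Variable R : realType.
Notation C := (Num.NumField.sort R[i]).
Notation rg := (smooth_good R).
Notation VC := ('M[C]_3 * 'rV[C]_1)%type.
Notation VR := ('M[R]_3 * 'rV[R]_2)%type.
Notation VQ := ('cV[R]_3 * 'M[R]_3)%type.
Notation PR := (SO3 R * C)%type.
Notation emb := (@emb_SO3CxC R).

Lemma Fpi_rassR (x : Q R) : Fpi (rassR (Q_assR x)) = x.
Proof. exact: (Q_assRK x). Qed.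

(** The inverse of the chart, followed by the local lift of [Q_assR] to
    SO(3) x C. *)
Lemma Q_lift c x : @Q_atlas R c -> cdom c x ->
  exists k : 'rV[R]_(2 + 2) -> PR,
  [/\ differentiable (@emb_SO3RxC R \o k) (cmap c x),
      differentiable (@emb_Q R \o cinv c) (cmap c x),
      Fpi (k (cmap c x)) = x
    & \forall z \near cmap c x,
        pi_assR (k z) = Q_assR (cinv c z) /\ cinv c z = Fpi (k z)].
Proof.
move=> Ac cx; set m := rassR (Q_assR x).
have mx : Fpi m = x := Fpi_rassR x.
have [phi [U [Phi [ oU Ux sPhi phix Uphi]]]] := Q_assR_lift_at m; rewrite mx in Ux phix.
have [ oc hc] := cinv_reg rg Ac.
have cK : cinv c (cmap c x) = x := (quot_ok Ac).2 x cx.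
have cc : cimg c (cmap c x) by exists x.
have Uc : U ((@emb_Q R \o cinv c) (cmap c x)) by rewrite /= cK.
have oN := reg_open_preim rg oc oU hc.
have Nx : (cimg c `&` (@emb_Q R \o cinv c) @^-1` U) (cmap c x) by split.
exists (phi \o cinv c); split.
- apply: (near_eq_differentiable (f := Phi \o (@emb_Q R \o cinv c))).
    by apply: open_near oN Nx _ => z [_ Uz]; rewrite /= (Uphi _ Uz).1.
  apply: differentiable_comp; first exact: (reg_diff rg hc cc).
  exact: (reg_diff rg sPhi Uc).
- exact: (reg_diff rg hc cc).
- by rewrite /= cK phix.
apply: open_near oN Nx _ => z [_ Uz]; have [_ E] := Uphi _ Uz.
by split; [exact: E|rewrite /= -assR_QE E Q_assRK].
Qed.

(** In charts the map is the extension of a complex chart composed with the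
    complexification of a smooth lift to SO(3) x C. Its differential is thus the
    complex differential on complexified tangent vectors, where [Omega_tangent]
    computes the form. *)
Lemma pullback_omega : is_pullback (@Q_atlas R) (real_atlas (@assC_atlas R)) (@Q_nz R)
  (@assR_assC R \o @Q_assR R) (re_form (@Omega R)) (@omega R).
Proof.
move=> c d x Ac Ad xnz cx dx.
have [k [dG dQ kx nk]] := Q_lift Ac cx.
set y := cmap c x in dG dQ kx nk *; set m := k y in kx *.
have [kP kF] := nbhs_singleton nk.
have cK : cinv c y = x := (quot_ok Ac).2 x cx; rewrite cK in kP kF.
have JE : (@assR_assC R \o @Q_assR R) x = pi_assC (inclP m) by rewrite /= -kP assR_assCE.
have q0 : m.2 != 0.
  apply/eqP => q0; move/eqP: xnz; apply; rewrite -kx /= q0.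
  rewrite (_ : Qe3 0 = 0) ?mulmx0 ?mul0mx //.
  by apply/matrixP => i j; rewrite !mxE; case: i j => [[|[|[|//]]] ?] [[|[|[|//]]] ?] /=; rewrite ?oppr0.
have cD : cdom (cplx_chart d) (pi_assC (inclP m)) by rewrite -JE.
have [ [ O [F [ oO Om FO OF]]] _] := Ad.2 (inclP m) cD.
have dF : differentiable F (emb (inclP m) : VC) by exact: FO.
have Om' : O (cplxify ((@emb_SO3RxC R \o k) y)) by rewrite /= -emb_inclP.
have dF' : differentiable F (cplxify ((@emb_SO3RxC R \o k) y) : VC) by rewrite /= -emb_inclP.
have dFi := diff_real0 (@cplxify_real_linear R) (@real_vec_form R (1 + 1)) dF'.
have [dH EH] := is_diff_comp (differentiableP dG) dFi.
have nO : \forall z \near y, O (emb (inclP (k z))).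
  have h : \forall z \near y, O (cplxify ((@emb_SO3RxC R \o k) z)).
    exact: (differentiable_continuous dG (real_linear_near (@cplxify_real_linear R) oO Om')).
  by apply: filterS h => z; rewrite emb_inclP.
have N : \forall z \near y,
    ((fun p => real_vec (F (cplxify p))) \o (@emb_SO3RxC R \o k)) z =
    (cmap d \o (@assR_assC R \o @Q_assR R) \o cinv c) z.
  apply: filterS2 nk nO => z [zP zF] Oz.
  rewrite /= -zP assR_assCE -emb_inclP -(OF _ Oz).2; exact: cplx_vecK.
have [dK EK] := near_eq_diff N dH; split; first exact: dK.
move=> v; set w := 'd (@emb_SO3RxC R \o k) y v.
have E1 := etrans (congr1 (fun f => f v) EK) (congr1 (fun f => f v) EH).
have wT : tangent (val m.1) w.1.
  have fL : linear (fst : VR -> 'M[R]_3) := fun a p q => erefl.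
  have d1 := is_diff_linear (@framedVR R) fL (differentiableP dG).
  apply: (diff_tangent v d1); near=> z; exact/SO3_trK/SO3_val.
have E2 : ('d (@emb_Q R \o cinv c) y v).1 = w.1 *m e3 R.
  have fL : linear (fst : VQ -> 'cV[R]_3) := fun a p q => erefl.
  have [_ d1] := is_diff_linear (@framedVQ R) fL (differentiableP dQ).
  have gL : linear (fun p : VR => p.1 *m e3 R) by move=> a p q; rewrite mulmxDl -scalemxAl.
  have d2 := is_diff_linear (@framedVR R) gL (differentiableP dG).
  have N2 : \forall z \near y, ((@emb_SO3RxC R \o k) z).1 *m e3 R = ((@emb_Q R \o cinv c) z).1.
    by apply: filterS nk => z [_ zF]; rewrite /= zF.
  have [_ E] := near_is_diff N2 d2.
  exact: etrans (esym (congr1 (fun f => f v) d1)) (congr1 (fun f => f v) E).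
have -> : omega c x v = Q_inv (Fpi m) (w.1 *m e3 R) by rewrite -E2 kx.
rewrite (Re_gam q0 wT).
have wTC : tangent (val (inclP m).1) (cplxify w).1 by exact: tangent_cm.
have <- := Omega_tangent Ad cD q0 wTC oO Om dF (fun m' Om' => (OF m' Om').2).
have E3 : cplx_vec ('d (cmap d \o (@assR_assC R \o @Q_assR R) \o cinv c) y v) =
    'd F (emb (inclP m) : VC) (cplxify w).
  apply: etrans (congr1 (@cplx_vec R (1 + 1)) E1) _.
  by rewrite /= real_vecK -emb_inclP.
rewrite -E3 -JE; reflexivity.
Unshelve. all: by end_near. Qed.

End Pullback.

Lemma cm_rotz_inB (R : realType) (phi : R) : inB (map_mx (real_complex R) (rotz phi)).
Proof.
have E : rotz phi = invmx (rotz (- phi)) by rewrite invmx_rotz opprK.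
apply: (@inBP _ _ (expi (- phi))); [|exact: expi_neq0|].
  apply: inSO3_cplx; apply/inSO3P; split.
    rewrite det3 !mxE /=.
    by transitivity (cos phi ^+ 2 + sin phi ^+ 2); [ring|exact: cos2Dsin2].
  by apply: mx3P => j; case: (ord3P j) => ->; rewrite mulmx3E !mxE /=;
    first [ring|transitivity (cos phi ^+ 2 + sin phi ^+ 2); [ring|exact: cos2Dsin2]].
by rewrite E; exact: rotz_n0.
Qed.

Theorem mainTheorem2 (R : realType) :
  (* SO(2) is contained in B *)
  (forall phi : R, inB (map_mx (real_complex R) (rotz phi))) /\
  (* the bundles, and the complex manifold SO(3,C) x C *)
  [/\ is_vector_bundle (@smooth R) (L := 'rV[R]_2) id
        (@Q_atlas R) (@sphere_atlas R) (@proj_Q R) (@lin_Q R),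
      is_vector_bundle (@smooth R) (L := R[i]^o) (@vecR R)
        (@assR_atlas R) (@homR_atlas R) (@proj_assR R) (@lin_assR R),
      is_vector_bundle (@holomorphic R) (L := R[i]^o) (@vecC R)
        (@assC_atlas R) (@homC_atlas R) (@proj_assC R) (@lin_assC R)
    & is_manifold (@holomorphic R) (@SO3CxC_atlas R)] /\
  exists (f : homR R -> sphere R) (F : assR R -> Q R) (Finv : Q R -> assR R)
         (j : homR R -> homC R) (J : assR R -> assC R),
  [/\ (* the identification of SO(3) x_SO(2) C with Q *)
      [/\ forall g : SO3 R, val (f (pi_homR g)) = val g *m e3 R,
          forall (g : SO3 R) (q : R[i]),
            val (F (pi_assR (g, q))) =
              (val g *m e3 R, val g *m Qe3 q *m invmx (val g)),
          cancel F Finv /\ cancel Finv F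
        & bundle_iso (@smooth R)
            (@assR_atlas R) (@homR_atlas R) (@proj_assR R)
              (fun a : R => lin_assR a%:C)
            (@Q_atlas R) (@sphere_atlas R) (@proj_Q R) (@lin_Q R) F f],
      (* the isomorphism of complex line bundles induced by the inclusions *)
      [/\ forall g : SO3 R, j (pi_homR g) = pi_homC (SO3incl g),
          forall (g : SO3 R) (q : R[i]),
            J (pi_assR (g, q)) = pi_assC (SO3incl g, q)
        & bundle_iso (@smooth R)
            (@assR_atlas R) (@homR_atlas R) (@proj_assR R) (@lin_assR R)
            (real_atlas (@assC_atlas R)) (real_atlas (@homC_atlas R))
              (@proj_assC R) (@lin_assC R) J j],
      is_oneform (@holomorphic R) (@SO3CxC_atlas R) (@SO3CxC_nz R)
        (@Omega_tilde R)
    & exists Omega : oneform (1 + 1) (assC R) 'cV[R[i]]_3,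
        [/\ is_oneform (@holomorphic R) (@assC_atlas R) (@assC_nz R) Omega,
            is_pullback (@SO3CxC_atlas R) (@assC_atlas R) (@SO3CxC_nz R)
              (@pi_assC R) Omega (@Omega_tilde R),
            forall h : SO3 R[i],
              is_pullback (@assC_atlas R) (@assC_atlas R) (@assC_nz R)
                (Lmul h) Omega (fun c x v => val h *m Omega c x v)
          & is_pullback (@Q_atlas R) (real_atlas (@assC_atlas R)) (@Q_nz R)
              (J \o Finv) (re_form Omega) (@omega R)]].
Proof.
split; first exact: cm_rotz_inB.
split.
  split; [exact: Q_bundle|exact: assR_bundle|exact: assC_bundle|exact: SO3CxC_manifold].
exists (@homR_sphere R), (@assR_Q R), (@Q_assR R), (@homR_homC R), (@assR_assC R); split.
- split; [by move=> g; rewrite homR_sphereE|by move=> g q; rewrite assR_QE|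
    by split; [exact: assR_QK|exact: Q_assRK]|exact: F_iso].
- split; [exact: homR_homCE|by move=> g q; rewrite assR_assCE|exact: J_iso].
- exact: Omega_tilde_oneform.
exists (@Omega R); split; [exact: Omega_oneform|exact: pullback_pi|
  exact: pullback_Lmul|exact: pullback_omega].
Qed.
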